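(* Let $d\ge1$ and let $\Theta_\sigma\in\mathcal{S}'(\mathbb{R}^{2d})$ be the distributional symplectic Fourier transform of the function $\Theta(x,\omega)=\mathrm{sinc}(x\omega)$ on $\mathbb{R}^{2d}$. Then, for $(\zeta_1,\zeta_2)\in\mathbb{R}^d\times\mathbb{R}^d$, $$\Theta_\sigma(\zeta_1,\zeta_2)=\begin{cases}-2\,\mathrm{Ci}(4\pi|\zeta_1\zeta_2|), & d=1,\\[2pt] \mathcal{F}\big(\chi_{\{|s|\ge2\}}|s|^{d-2}\big)(\zeta_1\zeta_2), & d\ge2,\end{cases}$$ where in the second line $\chi_{\{|s|\ge2\}}$ is the characteristic function of $\{s\in\mathbb{R}:|s|\ge2\}$, $\mathcal{F}$ is the one-dimensional Fourier transform in the variable $s\in\mathbb{R}$, evaluated at the scalar product $\zeta_1\zeta_2\in\mathbb{R}$; that is, in the sense of tempered distributions on $\mathbb{R}^{2d}$, $$\Theta_\sigma(\zeta_1,\zeta_2)=\int_{|s|\ge2}e^{-2\pi i s(\zeta_1\zeta_2)}|s|^{d-2}\,ds .$$ Moreover, the case $d=1$ is recaptured by the formula of the case $d\ge2$ (taken with $d=1$) and the definition of $\mathrm{Ci}$.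
   Context: For $x,\omega\in\mathbb{R}^d$, $x\omega$ denotes the scalar product. $\mathrm{sinc}(t)=\frac{\sin(\pi t)}{\pi t}$ for $t\ne0$ and $\mathrm{sinc}(0)=1$. Fourier transform: $\mathcal{F}f(\omega)=\int e^{-2\pi i x\omega}f(x)\,dx$. The symplectic Fourier transform on $\mathbb{R}^{2d}$ is $\mathcal{F}_\sigma F(\zeta)=\int_{\mathbb{R}^{2d}}e^{-2\pi i\sigma(\zeta,z)}F(z)\,dz$ with $\sigma((x,\omega),(\zeta_1,\zeta_2))=\omega\cdot\zeta_1-x\cdot\zeta_2$, extended to $\mathcal{S}'(\mathbb{R}^{2d})$. The cosine integral is $\mathrm{Ci}(t)=-\int_t^{+\infty}\frac{\cos s}{s}\,ds$, $t>0$; the formula for $d=1$ is an equality of a function defined almost everywhere (where $\zeta_1\zeta_2\neq0$) with a tempered distribution. The integral $\int_{|s|\ge2}e^{-2\pi i s(\zeta_1\zeta_2)}|s|^{d-2}\,ds$ as a tempered distribution means: its pairing with $\varphi\in\mathcal{S}(\mathbb{R}^{2d})$ is $\int_{|s|\ge2}|s|^{d-2}\Big(\int_{\mathbb{R}^{2d}}e^{-2\pi i s\,\zeta_1\zeta_2}\varphi(\zeta_1,\zeta_2)\,d\zeta_1d\zeta_2\Big)ds$. *)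

(* Defs.v *)
From HB Require Import structures.
From mathcomp Require Import all_boot all_order all_algebra.
From mathcomp Require Import all_classical all_reals all_analysis.
From mathcomp Require Import complex.

Set Implicit Arguments.
Unset Strict Implicit.
Unset Printing Implicit Defensive.

Import Order.TTheory GRing.Theory Num.Theory.
Import numFieldNormedType.Exports.

Local Open Scope classical_set_scope.
Local Open Scope ring_scope.
Local Open Scope complex_scope.

(* The sigma-algebra on 'rV[R]_n generated by the coordinate functions, as the
   library does for n.-tuple; row vectors are used because they carry the
   normed-space structure needed for derivatives. *)
Section measurable_rV.
Variables (R : realType) (n : nat).

Let coor (i : 'I_n) (v : 'rV[R]_n) : R := v ord0 i.

Let rV_set0 : g_sigma_preimage coor set0.
Proof. exact: sigma_algebra0. Qed.

Let rV_setC A : g_sigma_preimage coor A -> g_sigma_preimage coor (~` A).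
Proof. exact: sigma_algebraC. Qed.

Let rV_bigcup (F : _^nat) : (forall i, g_sigma_preimage coor (F i)) ->
  g_sigma_preimage coor (\bigcup_i (F i)).
Proof. exact: sigma_algebra_bigcup. Qed.

HB.instance Definition _ := @isMeasurable.Build default_measure_display
  'rV[R]_n (g_sigma_preimage coor) rV_set0 rV_setC rV_bigcup.

End measurable_rV.

Section rV_measurability.
Variable R : realType.

Lemma measurable_coord n (i : 'I_n) :
  measurable_fun [set: 'rV[R]_n] (fun v : 'rV[R]_n => v ord0 i : R).
Proof.
move=> _ Y mY; rewrite setTI; apply: sub_sigma_algebra => /=.
rewrite -bigcup_seq/=; exists i => /=; first by rewrite mem_index_enum.
by exists Y => //; rewrite setTI.
Qed.

Lemma measurable_fun_rV d (T : measurableType d) n (f : T -> 'rV[R]_n) :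
  (forall i, measurable_fun [set: T] (fun x => f x ord0 i : R)) ->
  measurable_fun [set: T] f.
Proof.
move=> mf _ Y mY; rewrite setTI.
pose G : set (set 'rV[R]_n) := [set A | measurable (f @^-1` A)].
suff : measurable `<=` G by apply.
apply: smallest_sub.
  split => [|A GA|F GF]; rewrite /G /=.
  - by rewrite preimage_set0.
  - by rewrite setTD preimage_setC; exact: measurableC.
  - by rewrite preimage_bigcup; exact: bigcupT_measurable.
rewrite -bigcup_seq; apply: bigcup_sub => i _ A [B mB <-].
have := mf i measurableT B mB.
by rewrite !setTI /G/= -comp_preimage.
Qed.

End rV_measurability.

Section lebesgue_rV.
Variable R : realType.

Definition rV_cons n (p : measurableTypeR R * 'rV[R]_n) : 'rV[R]_n.+1 :=
  row_mx (p.1 : R)%:M p.2 : 'rV[R]_(1 + n).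

Definition rV_uncons n (v : 'rV[R]_n.+1) : measurableTypeR R * 'rV[R]_n :=
  (v ord0 ord0, rsubmx (v : 'rV[R]_(1 + n))).

Lemma rV_consE0 n (p : measurableTypeR R * 'rV[R]_n) :
  rV_cons p ord0 ord0 = p.1.
Proof.
have -> : ord0 = lshift n (ord0 : 'I_1) :> 'I_n.+1 by apply: val_inj.
by rewrite /rV_cons (row_mxEl ((p.1 : R)%:M)) mxE eqxx mulr1n.
Qed.

Lemma rV_consES n (p : measurableTypeR R * 'rV[R]_n) (i : 'I_n) :
  rV_cons p ord0 (lift ord0 i) = p.2 ord0 i.
Proof.
have -> : lift ord0 i = rshift 1 i :> 'I_n.+1 by apply: val_inj.
by rewrite /rV_cons (row_mxEr ((p.1 : R)%:M)).
Qed.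

Lemma rV_consK n : cancel (@rV_cons n) (@rV_uncons n).
Proof.
case=> x v; rewrite /rV_uncons rV_consE0; congr pair.
by rewrite /rV_cons row_mxKr.
Qed.

Lemma measurable_rV_cons n : measurable_fun setT (@rV_cons n).
Proof.
apply: measurable_fun_rV => i; case: (unliftP ord0 i) => [j|] ->.
- under eq_fun do rewrite rV_consES.
  by apply: (measurableT_comp (measurable_coord j)); exact: measurable_snd.
- under eq_fun do rewrite rV_consE0.
  exact: measurable_fst.
Qed.

Lemma measurable_rV_uncons n : measurable_fun setT (@rV_uncons n).
Proof.
apply/measurable_fun_pair => /=; first exact: measurable_coord.
apply: measurable_fun_rV => i.
apply: (eq_measurable_fun (fun v : 'rV[R]_n.+1 => v ord0 (rshift 1 i) : R)).
  by move=> v _; rewrite mxE.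
exact: measurable_coord.
Qed.

Section step.
Variables (n : nat) (m : {sigma_finite_measure set 'rV[R]_n -> \bar R}).

Definition lebesgue_rV_step : set 'rV[R]_n.+1 -> \bar R :=
  pushforward (lebesgue_measure \x m)%E (@rV_cons n).

Let mcons (A : set 'rV[R]_n.+1) : measurable A ->
  measurable (@rV_cons n @^-1` A).
Proof.
by move=> mA; rewrite -[X in measurable X]setTI; exact: measurable_rV_cons.
Qed.

Let step0 : lebesgue_rV_step set0 = 0%E.
Proof. by rewrite /lebesgue_rV_step /pushforward preimage_set0 measure0. Qed.

Let step_ge0 A : (0 <= lebesgue_rV_step A)%E.
Proof.
by rewrite /lebesgue_rV_step /pushforward;
  exact: (measure_ge0 (lebesgue_measure \x m)%E).
Qed.

Let step_sigma_additive : semi_sigma_additive lebesgue_rV_step.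
Proof.
move=> F mF tF mUF; rewrite /lebesgue_rV_step /pushforward preimage_bigcup.
apply: measure_semi_sigma_additive.
- by move=> k; exact: mcons.
- apply/trivIsetP => /= i j _ _ ij; rewrite -preimage_setI.
  by move/trivIsetP : tF => /(_ _ _ _ _ ij) ->//; rewrite preimage_set0.
- by rewrite -preimage_bigcup; exact: mcons.
Qed.

HB.instance Definition _ := isMeasure.Build _ _ _ lebesgue_rV_step
  step0 step_ge0 step_sigma_additive.

Let step_sigma_finite : sigma_finite setT lebesgue_rV_step.
Proof.
have /sigma_finiteP[F [TF ndF Foo]] := sigma_finiteT (@lebesgue_measure R).
have /sigma_finiteP[G [TG ndG Goo]] := sigma_finiteT m.
exists (fun k => @rV_uncons n @^-1` (F k `*` G k)) => [|k].
  apply/seteqP; split => // v _.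
  have [i _ Fi] : (\bigcup_k F k) (@rV_uncons n v).1 by rewrite -TF.
  have [j _ Gj] : (\bigcup_k G k) (@rV_uncons n v).2 by rewrite -TG.
  exists (maxn i j) => //; split => /=.
    by move: Fi; exact/subsetPset/ndF/leq_maxl.
  by move: Gj; exact/subsetPset/ndG/leq_maxr.
have [mF Fk] := Foo k; have [mG Gk] := Goo k; split.
  rewrite -[X in measurable X]setTI; apply: measurable_rV_uncons => //.
  exact: measurableX.
rewrite /lebesgue_rV_step /pushforward -comp_preimage.
rewrite (_ : _ \o _ = id) ?preimage_id.
  by rewrite product_measure1E// lte_mul_pinfty// ge0_fin_numE.
by apply/funext => p /=; rewrite rV_consK.
Qed.

HB.instance Definition _ := Measure_isSigmaFinite.Build _ _ _
  lebesgue_rV_step step_sigma_finite.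

End step.

(* Lebesgue measure on R^n: a point mass for n = 0, and for n.+1 the image of
   the product measure on R * R^n under rV_cons. *)
Fixpoint lebesgue_rV (n : nat) :
    {sigma_finite_measure set 'rV[R]_n -> \bar R} :=
  match n with
  | 0 => \d_(0 : 'rV[R]_0)
  | k.+1 => lebesgue_rV_step (lebesgue_rV k)
  end.

Lemma lebesgue_rV_box n (A : 'I_n -> set R) :
  (forall i, measurable (A i)) ->
  lebesgue_rV n [set v | forall i, A i (v ord0 i)] =
  (\prod_(i < n) lebesgue_measure (A i : set (measurableTypeR R)))%E.
Proof.
elim: n A => [|n IHn] A mA.
  by rewrite big_ord0 /= diracE mem_set//= => -[].
have mB : measurable [set v : 'rV[R]_n | forall i, A (lift ord0 i) (v ord0 i)].
  rewrite (_ : mkset _ = \bigcap_(i in [set: 'I_n])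
    ((fun v : 'rV[R]_n => v ord0 i) @^-1` A (lift ord0 i))); last first.
    by apply/seteqP; split => [v Av i _|v Av i]; [exact: Av|exact: (Av i I)].
  apply: fin_bigcap_measurable => [|i _]; first exact: finite_finset.
  by rewrite -[X in measurable X]setTI; exact: measurable_coord.
rewrite big_ord_recl -(IHn (fun i => A (lift ord0 i)))//=.
rewrite -(product_measure1E lebesgue_measure (lebesgue_rV n))//; last exact: mA.
rewrite /pushforward; congr product_measure1.
apply/seteqP; split => [p /= Ap|p /= [A0 AS] i].
  split => [|i]; first by have := Ap ord0; rewrite rV_consE0.
  by have := Ap (lift ord0 i); rewrite rV_consES.
by case: (unliftP ord0 i) => [j|] ->; rewrite ?rV_consES// rV_consE0.
Qed.

End lebesgue_rV.

Notation phase R d := ('rV[R]_d * 'rV[R]_d)%type.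

Section complex_integral.
Context (R : realType) (disp : measure_display) (T : measurableType disp).
Variables (mu : {measure set T -> \bar R}) (D : set T) (f : T -> R[i]).

Definition cintegrable : Prop :=
  mu.-integrable D (fun x => (complex.Re (f x))%:E) /\
  mu.-integrable D (fun x => (complex.Im (f x))%:E).

Definition cintegral : R[i] :=
  (\int[mu]_(x in D) complex.Re (f x)) +i* (\int[mu]_(x in D) complex.Im (f x)).

End complex_integral.

Section special_functions.
Variable R : realType.

Definition expi (t : R) : R[i] := cos t +i* sin t.

Definition sinc (t : R) : R := if t == 0 then 1 else sin (pi * t) / (pi * t).

(* The integral over [t, +oo[ converges only conditionally. *)
Definition Ci (t : R) : R :=
  - lim ((\int[lebesgue_measure]_(s in `[t, A]) (cos s / s)) @[A --> +oo]).

End special_functions.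

Section distributions.
Variables (R : realType) (d : nat).

Definition dot (x y : 'rV[R]_d) : R := \sum_(i < d) x ord0 i * y ord0 i.

Definition symplectic (z w : phase R d) : R := dot z.2 w.1 - dot z.1 w.2.

Definition phase_measure : {measure set (phase R d) -> \bar R} :=
  (lebesgue_rV R d \x lebesgue_rV R d)%E.

Definition basis (i : 'I_d + 'I_d) : phase R d :=
  match i with
  | inl j => (delta_mx ord0 j, 0)
  | inr j => (0, delta_mx ord0 j)
  end.

(* Iterated partial derivatives; a multi-index is given as the list of the
   coordinates along which one differentiates. *)
Definition partial (b : seq ('I_d + 'I_d)) (f : phase R d -> R) :
  phase R d -> R := foldr (fun i g z => 'D_(basis i) g z) f b.

Definition cpartial b (phi : phase R d -> R[i]) (z : phase R d) : R[i] :=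
  partial b (fun w => complex.Re (phi w)) z +i* partial b (fun w => complex.Im (phi w)) z.

Definition smooth (f : phase R d -> R) : Prop :=
  forall b z, differentiable (partial b f) z.

(* [seminorm_le N phi M] says that the N-th Schwartz seminorm
   sup { (1 + |z|)^N |D^b phi(z)| : z, |b| <= N } of phi is at most M. *)
Definition seminorm_le (N : nat) (phi : phase R d -> R[i]) (M : R) : Prop :=
  forall b z, (size b <= N)%N ->
    (1 + `|z|) ^+ N * ComplexField.Normc.normc (cpartial b phi z) <= M.

Definition schwartz (phi : phase R d -> R[i]) : Prop :=
  [/\ smooth (fun z => complex.Re (phi z)), smooth (fun z => complex.Im (phi z))
    & forall N, exists M, seminorm_le N phi M].

(* Functionals are total on functions; only their values on Schwartz functions
   are ever constrained or compared. *)
Definition functional := (phase R d -> R[i]) -> R[i].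

Definition tempered (T : functional) : Prop :=
  (forall (a : R[i]) phi psi, schwartz phi -> schwartz psi ->
     T (fun z => a * phi z + psi z) = a * T phi + T psi) /\
  (exists N (K : R), forall phi M, schwartz phi -> seminorm_le N phi M ->
     ComplexField.Normc.normc (T phi) <= K * M).

Definition eq_dist (T U : functional) : Prop :=
  forall phi, schwartz phi -> T phi = U phi.

Definition dist_of_fun (g : phase R d -> R[i]) : functional :=
  fun phi => cintegral phase_measure setT (fun z => g z * phi z).

Definition symplectic_fourier (F : phase R d -> R[i]) (zeta : phase R d) :
    R[i] :=
  cintegral phase_measure setT
    (fun z => expi (- (2 * pi * symplectic zeta z)) * F z).

(* The extension by duality for the bilinear pairing: as
   symplectic zeta z = - symplectic z zeta, for integrable F one has
   int (F_sigma F) phi = int F(z) (F_sigma phi)(- z) dz. *)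
Definition symplectic_fourier_dist (T : functional) : functional :=
  fun phi => T (fun z => symplectic_fourier phi (- z)).

Definition Theta (z : phase R d) : R[i] := (sinc (dot z.1 z.2))%:C.

(* Meaningful where dot zeta.1 zeta.2 != 0, i.e. almost everywhere; Ci 0 is an
   arbitrary value. *)
Definition Ci_kernel (zeta : phase R d) : R[i] :=
  (- 2 * Ci (4 * pi * `|dot zeta.1 zeta.2|))%:C.

Definition oscillatory (phi : phase R d -> R[i]) (s : R) : R[i] :=
  cintegral phase_measure setT
    (fun zeta => expi (- (2 * pi * s * dot zeta.1 zeta.2)) * phi zeta).

(* The exponent d - 2 is an integer, equal to -1 for d = 1. *)
Definition weight (s : R) : R := `|s| ^ (d%:Z - 2).

(* F(chi_{|s| >= 2} |s|^(d - 2))(zeta1 zeta2) in the sense of distributions. *)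
Definition fourier_weight : functional := fun phi =>
  cintegral lebesgue_measure [set s : R | 2 <= `|s|]
    (fun s => (weight s)%:C * oscillatory phi s).

Definition fourier_weight_converges : Prop := forall phi, schwartz phi ->
  cintegrable lebesgue_measure [set s : R | 2 <= `|s|]
    (fun s => (weight s)%:C * oscillatory phi s).

Definition tested_integrable (g : phase R d -> R[i]) : Prop :=
  forall phi, schwartz phi ->
    cintegrable phase_measure setT (fun z => g z * phi z).

(* The Fourier integral of chi_{|s| >= 2} |s|^(d - 2), truncated at A. *)
Definition truncated_fourier_weight (t A : R) : R[i] :=
  cintegral lebesgue_measure [set s : R | 2 <= `|s| <= A]
    (fun s => expi (- (2 * pi * s * t)) * (weight s)%:C).

End distributions.

(* Main.v *)
Require Import Defs.
From HB Require Import structures.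
From mathcomp Require Import all_boot all_order all_algebra.
From mathcomp Require Import all_classical all_reals all_analysis.
From mathcomp Require Import complex.
From mathcomp Require Import ring lra measurable_realfun.

(* Since [sinc] is the Fourier transform of the indicator of [-1/2, 1/2], the
   substitution s -> 1/s gives
     sinc t = int_{|s| >= 2} |s|^-2 exp(-2 pi i t / s) ds.
   By duality the chirp exp(-2 pi i x.omega / s) has symplectic Fourier transform
   |s|^d exp(-2 pi i s zeta_1.zeta_2); for fixed s this is proved by Fubini after
   damping with exp(-eps |x_j|), whose transform is elementary, so that the damped
   chirp integral is a product of explicit one-dimensional kernels, bounded by
   2|s| uniformly in eps.  Integrating over s, which is again Fubini because a
   Schwartz function and its transform decay faster than a product of Cauchy
   densities, gives the formula in every dimension.

   For d = 1 the integral truncated at |s| <= A is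
     2 int_2^A cos(2 pi s t) / s ds, with t = zeta_1 zeta_2,
   which tends to -2 Ci(4 pi |t|) and is bounded by a multiple of |t|^{-1/2},
   uniformly in A.  As |t|^{-1/2} is locally integrable in (zeta_1, zeta_2),
   dominated convergence identifies the distribution with this function. *)

Set Implicit Arguments.
Unset Strict Implicit.
Unset Printing Implicit Defensive.

Import Order.TTheory GRing.Theory Num.Theory.
Import numFieldNormedType.Exports.

Local Open Scope classical_set_scope.
Local Open Scope ring_scope.
Local Open Scope complex_scope.

(** The chirp has modulus 1, so its transform does not converge absolutely. Each use of Fubini
    therefore relies on an extra integrable factor, a damping or a truncation, which dominated
    convergence removes afterwards. The damping [exp(-eps |x_j|)] is preferred to a Gaussian because
    an explicit primitive gives its transform, a Cauchy density of width [eps]. Rescaling by that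
    width leaves a fixed Cauchy density, whence a bound independent of [eps]; products of Cauchy
    densities then serve as majorants throughout. The pairing that defines the transform of [Theta]
    unfolds to an integral of [Theta] against the transform of the test function, so what is
    required of that transform is measurability and an integrable bound. The weight [|s|^(d - 2)] is
    not integrable over [|s| >= 2] for any [d >= 1]. The joint integrand in [(s, z)] carries only
    [|s|^-2]; the factor [|s|^d] appears once [z] is integrated out, and convergence of the
    remaining integral over [s] is inherited from Fubini. *)

Local Notation normc := ComplexField.Normc.normc.

(** * Fubini theorem and dominated convergence for complex integrands *)

Section product_sigma_finite.
Context d1 d2 (T1 : measurableType d1) (T2 : measurableType d2) (R : realType).
Variable m1 : {sigma_finite_measure set T1 -> \bar R}.
Variable m2 : {sigma_finite_measure set T2 -> \bar R}.

(* The library's sigma-finite instance of the product covers finite measures only. *)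
Definition product_sfm : set (T1 * T2) -> \bar R := (m1 \x m2)%E.

HB.instance Definition _ := Measure.on product_sfm.

Let product_sigma_finite : sigma_finite setT product_sfm.
Proof.
have /sigma_finiteP[F [TF ndF Foo]] := sigma_finiteT m1.
have /sigma_finiteP[G [TG ndG Goo]] := sigma_finiteT m2.
exists (fun k => F k `*` G k) => [|k].
  apply/seteqP; split => // -[x y] _.
  have [i _ Fi] : (\bigcup_k F k) x by rewrite -TF.
  have [j _ Gj] : (\bigcup_k G k) y by rewrite -TG.
  exists (maxn i j) => //; split => /=.
    by move: Fi; exact/subsetPset/ndF/leq_maxl.
  by move: Gj; exact/subsetPset/ndG/leq_maxr.
have [mF Fk] := Foo k; have [mG Gk] := Goo k.
split; first exact: measurableX.
by rewrite /product_sfm product_measure1E// lte_mul_pinfty// ge0_fin_numE.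
Qed.

HB.instance Definition _ := Measure_isSigmaFinite.Build _ _ _
  product_sfm product_sigma_finite.

End product_sigma_finite.

Section real_integrals.
Context (R : realType).

(** Measurability of [f] is enough: the positive and negative parts are handled by Tonelli, and
    [fine] gives a real value where their difference is infinite. *)
Lemma measurable_Rintegral2 d1 d2 (T1 : measurableType d1)
    (T2 : measurableType d2) (m2 : {sigma_finite_measure set T2 -> \bar R})
    (f : T1 * T2 -> R) : measurable_fun setT f ->
  measurable_fun setT (fun x => \int[m2]_y f (x, y) : R).
Proof.
move=> mf; rewrite /Rintegral.
apply: (measurableT_comp (fine_measurable measurableT)).
have -> : (fun x => \int[m2]_y (f (x, y))%:E)%E =
    (fubini_F m2 (EFin \o f)^\+ \- fubini_F m2 (EFin \o f)^\-)%E.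
  apply/funext => x; rewrite integralE /fubini_F.
  by congr (_ - _)%E; apply: eq_integral => y _; rewrite ?funeposE ?funenegE.
have mEf : measurable_fun setT (EFin \o f) by exact/measurable_EFinP.
apply: emeasurable_funB; apply: measurable_fun_fubini_tonelli_F => //.
- exact: measurable_funepos.
- exact: measurable_funeneg.
Qed.

Section fubini.
Context d1 d2 (T1 : measurableType d1) (T2 : measurableType d2).
Variable m1 : {sigma_finite_measure set T1 -> \bar R}.
Variable m2 : {sigma_finite_measure set T2 -> \bar R}.
Variable f : T1 * T2 -> R.
Hypothesis fint : (m1 \x m2)%E.-integrable setT (EFin \o f).

(** Since [fine] sends infinite values to 0, the real inner integral is dominated by the extended
    one, which is integrable by Fubini. *)
Lemma integrable_Rfubini1 :
  m1.-integrable setT (fun x => (\int[m2]_y f (x, y))%:E).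
Proof.
apply: (le_integrable _ _ _ (integrable_fubini_F fint)) => //.
  apply/measurable_EFinP/measurable_Rintegral2/measurable_EFinP.
  exact: measurable_int fint.
move=> x _ /=; rewrite /fubini_F /Rintegral.
by case: (integral _ _ _) => [r| |]//=; rewrite normr0 ?leey// lee_fin.
Qed.

(** The extended inner integral is finite almost everywhere, so taking [fine] changes it only on a
    null set. *)
Lemma Rfubini1 : \int[m1]_x \int[m2]_y f (x, y) = \int[(m1 \x m2)%E]_z f z.
Proof.
rewrite [RHS]/Rintegral -(integral12_prod_meas1 fint) [LHS]/Rintegral.
congr fine; apply: ae_eq_integral => //.
- exact: measurable_int integrable_Rfubini1.
- exact: measurable_int (integrable_fubini_F fint).
- apply: filterS (integrable_ae _ (integrable_fubini_F fint)) => //= x h _.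
  by rewrite /Rintegral fineK//; exact: h.
Qed.

End fubini.

Section fubini_swap.
Context d1 d2 (T1 : measurableType d1) (T2 : measurableType d2).
Variable m1 : {sigma_finite_measure set T1 -> \bar R}.
Variable m2 : {sigma_finite_measure set T2 -> \bar R}.
Variable f : T1 * T2 -> R.
Hypothesis fint : (m1 \x m2)%E.-integrable setT (EFin \o f).

Let fswap : T2 * T1 -> R := fun z => f (z.2, z.1).

Lemma integrable_swap : (m2 \x m1)%E.-integrable setT (EFin \o fswap).
Proof.
have mf := measurable_int _ fint.
apply/integrable12ltyP; last exact: (@integrable21ltyP _ _ _ _ _ m1 m2 _ mf).1.
by apply: (measurableT_comp mf); exact/measurable_fun_pair.
Qed.

Lemma integrable_Rfubini2 :
  m2.-integrable setT (fun y => (\int[m1]_x f (x, y))%:E).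
Proof. exact: integrable_Rfubini1 integrable_swap. Qed.

Lemma Rfubini2 : \int[m2]_y \int[m1]_x f (x, y) = \int[(m1 \x m2)%E]_z f z.
Proof.
rewrite [RHS]/Rintegral -(integral21_prod_meas1 fint) [LHS]/Rintegral.
congr fine; apply: ae_eq_integral => //.
- exact: measurable_int integrable_Rfubini2.
- exact: measurable_int (integrable_fubini_F integrable_swap).
- have h := integrable_fubini_F integrable_swap.
  apply: filterS (integrable_ae _ h) => //= y hy _.
  by rewrite /Rintegral fineK//; exact: hy.
Qed.

End fubini_swap.

Section product.
Context d1 d2 (T1 : measurableType d1) (T2 : measurableType d2).
Variable m1 : {sigma_finite_measure set T1 -> \bar R}.
Variable m2 : {sigma_finite_measure set T2 -> \bar R}.

Lemma integrable_prod (f : T1 -> R) (g : T2 -> R) :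
  m1.-integrable setT (EFin \o f) -> m2.-integrable setT (EFin \o g) ->
  (m1 \x m2)%E.-integrable setT (fun z => (f z.1 * g z.2)%:E).
Proof.
move=> fi gi.
have /measurable_EFinP mf := measurable_int _ fi.
have /measurable_EFinP mg := measurable_int _ gi.
apply/integrable12ltyP.
  apply/measurable_EFinP/measurable_funM.
    by apply: (measurableT_comp mf).
  by apply: (measurableT_comp mg).
rewrite [ltLHS](_ : _ = (\int[m1]_x (`|(f x)%:E| * \int[m2]_y `|(g y)%:E|))%E).
  rewrite ge0_integralZr//.
  - rewrite lte_mul_pinfty//; first exact: integral_ge0.
      rewrite ge0_fin_numE; last exact: integral_ge0.
      by case/integrableP : fi.
    by case/integrableP : gi.
  - by apply/measurableT_comp => //; exact/measurable_EFinP.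
  - exact: integral_ge0.
apply: eq_integral => x _.
rewrite -ge0_integralZl//; first last.
  by apply/measurableT_comp => //; exact/measurable_EFinP.
by apply: eq_integral => y _ /=; rewrite normrM EFinM.
Qed.

End product.

Lemma integrableZ_real d (T : measurableType d)
    (mu : {measure set T -> \bar R}) (D : set T) (f : T -> R) (k : R) :
  measurable D -> mu.-integrable D (EFin \o f) ->
  mu.-integrable D (EFin \o (fun x => k * f x)).
Proof. by move=> mD fi; exact: (integrableZl mD k fi). Qed.

Lemma Rdominated_cvg d (T : measurableType d) (mu : {measure set T -> \bar R})
    (D : set T) (f_ : nat -> T -> R) (f g : T -> R) : measurable D ->
  (forall n, measurable_fun D (f_ n)) -> measurable_fun D f ->
  {ae mu, forall x, D x -> f_ n x @[n --> \oo] --> f x} ->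
  mu.-integrable D (EFin \o g) ->
  {ae mu, forall x, D x -> forall n, `|f_ n x| <= g x} ->
  mu.-integrable D (EFin \o f) /\
  \int[mu]_(x in D) f_ n x @[n --> \oo] --> \int[mu]_(x in D) f x.
Proof.
move=> mD mf_ mf cf ig fg.
have [|||||h1 _ h2] := @dominated_convergence _ T R mu D mD
   (fun n => EFin \o f_ n) (EFin \o f) (EFin \o g).
- by move=> n; apply/measurable_EFinP.
- by apply/measurable_EFinP.
- apply: filterS cf => x h Dx; apply: cvg_EFin; first exact: nearW.
  exact: h.
- by [].
- by apply: filterS fg => x h n Dx; rewrite /= lee_fin h.
split => //; apply: fine_cvg; rewrite fineK//.
exact: integrable_fin_num.
Qed.

End real_integrals.

Section complex_numbers.
Variable R : realType.
Implicit Types (x y z : R[i]) (a b : R).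

Lemma Re_mulc x y : complex.Re (x * y) =
  complex.Re x * complex.Re y - complex.Im x * complex.Im y.
Proof. by case: x y => a b [c d]. Qed.

Lemma Im_mulc x y : complex.Im (x * y) =
  complex.Re x * complex.Im y + complex.Im x * complex.Re y.
Proof. by case: x y => a b [c d]. Qed.

Lemma complex_eqP x y : complex.Re x = complex.Re y ->
  complex.Im x = complex.Im y -> x = y.
Proof. by case: x y => a b [c d] /= -> ->. Qed.

Lemma normc_ge0 x : 0 <= normc x.
Proof. by case: x => a b /=; exact: sqrtr_ge0. Qed.

Lemma normr_Re_le x : `|complex.Re x| <= normc x.
Proof.
by case: x => a b /=; rewrite -sqrtr_sqr ler_wsqrtr// lerDl sqr_ge0.
Qed.

Lemma normr_Im_le x : `|complex.Im x| <= normc x.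
Proof.
by case: x => a b /=; rewrite -sqrtr_sqr ler_wsqrtr// lerDr sqr_ge0.
Qed.

Lemma normc_le x : normc x <= `|complex.Re x| + `|complex.Im x|.
Proof.
case: x => a b /=.
rewrite -[leRHS]ger0_norm ?addr_ge0// -sqrtr_sqr ler_wsqrtr// sqrrD.
rewrite !real_normK ?num_real// lerD2r lerDl.
by rewrite mulrn_wge0// mulr_ge0.
Qed.

Lemma normcR a : normc a%:C = `|a|.
Proof. by rewrite /= expr0n/= addr0 sqrtr_sqr. Qed.

Lemma normc_expi a : normc (expi a) = 1.
Proof. by rewrite /= cos2Dsin2 sqrtr1. Qed.

Lemma normc_prod (I : Type) (s : seq I) (P : pred I) (F : I -> R[i]) :
  normc (\prod_(i <- s | P i) F i) = \prod_(i <- s | P i) normc (F i).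
Proof.
apply: (big_morph _ (@ComplexField.Normc.normcM R)).
exact: ComplexField.Normc.normc1.
Qed.

Lemma expiD a b : expi (a + b) = expi a * expi b.
Proof.
apply: complex_eqP; rewrite ?Re_mulc ?Im_mulc /= ?cosD ?sinD//.
by rewrite addrC.
Qed.

Lemma expi_sum (I : Type) (s : seq I) (P : pred I) (F : I -> R) :
  expi (\sum_(i <- s | P i) F i) = \prod_(i <- s | P i) expi (F i).
Proof.
apply: (big_morph _ expiD).
by apply: complex_eqP; rewrite /= ?cos0 ?sin0.
Qed.

End complex_numbers.

Section complex_integrals.
Context (R : realType).

Definition cmeasurable d (T : measurableType d) (f : T -> R[i]) :=
  measurable_fun setT (fun x => complex.Re (f x)) /\
  measurable_fun setT (fun x => complex.Im (f x)).

Section measurability.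
Context d (T : measurableType d).
Implicit Types (f g : T -> R[i]) (h : T -> R).

Lemma cmeasurableM f g : cmeasurable f -> cmeasurable g ->
  cmeasurable (fun x => f x * g x).
Proof.
move=> [f1 f2] [g1 g2]; split.
- under eq_fun do rewrite Re_mulc.
  by apply: measurable_funB; exact: measurable_funM.
- under eq_fun do rewrite Im_mulc.
  by apply: measurable_funD; exact: measurable_funM.
Qed.

Lemma cmeasurable_real h : measurable_fun setT h ->
  cmeasurable (fun x => (h x)%:C).
Proof. by move=> mh; split => //=; exact: measurable_cst. Qed.

Lemma cmeasurable_expi h : measurable_fun setT h ->
  cmeasurable (fun x => expi (h x)).
Proof.
move=> mh; split => /=; apply: (measurableT_comp _ mh).
- apply: continuous_measurable_fun; exact: continuous_cos.
- apply: continuous_measurable_fun; exact: continuous_sin.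
Qed.

Lemma cmeasurable_comp d' (T' : measurableType d') (k : T' -> T) f :
  measurable_fun setT k -> cmeasurable f -> cmeasurable (f \o k).
Proof.
move=> mk [f1 f2]; split => /=.
- exact: (measurableT_comp f1 mk).
- exact: (measurableT_comp f2 mk).
Qed.

Lemma cmeasurable_prod (I : Type) (s : seq I) (F : I -> T -> R[i]) :
  (forall i, cmeasurable (F i)) -> cmeasurable (fun x => \prod_(i <- s) F i x).
Proof.
move=> mF; elim: s => [|i s ih].
  by under eq_fun do rewrite big_nil; exact: cmeasurable_real.
by under eq_fun do rewrite big_cons; exact: cmeasurableM.
Qed.

Lemma measurable_normc f : cmeasurable f ->
  measurable_fun setT (fun x => normc (f x)).
Proof.
move=> [f1 f2]; rewrite (_ : (fun _ => _) = (fun x =>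
  Num.sqrt (complex.Re (f x) ^+ 2 + complex.Im (f x) ^+ 2))).
  apply: measurableT_comp.
    by apply: continuous_measurable_fun; exact: sqrt_continuous.
  by apply: measurable_funD; exact: measurable_funX.
by apply/funext => x; case: (f x).
Qed.

End measurability.

Lemma cmeasurable_cintegral d1 d2 (T1 : measurableType d1)
    (T2 : measurableType d2) (m2 : {sigma_finite_measure set T2 -> \bar R})
    (f : T1 * T2 -> R[i]) : cmeasurable f ->
  cmeasurable (fun x => cintegral m2 setT (fun y => f (x, y))).
Proof.
move=> [f1 f2]; split => /=.
- exact: (measurable_Rintegral2 m2 f1).
- exact: (measurable_Rintegral2 m2 f2).
Qed.

Section basics.
Context d (T : measurableType d) (mu : {measure set T -> \bar R}).
Variable D : set T.
Hypothesis mD : measurable D.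
Implicit Types (f g : T -> R[i]).

Lemma le_cintegrable f (h : T -> R) : cmeasurable f ->
  mu.-integrable D (EFin \o h) -> (forall x, D x -> normc (f x) <= h x) ->
  cintegrable mu D f.
Proof.
move=> [f1 f2] hi fh; split; apply: (le_integrable _ _ _ hi) => //.
- by apply/measurable_EFinP; exact: measurable_funS f1.
- move=> x Dx; rewrite lee_fin (le_trans (normr_Re_le _))//.
  by rewrite (le_trans (fh _ Dx))// ler_norm.
- by apply/measurable_EFinP; exact: measurable_funS f2.
- move=> x Dx; rewrite lee_fin (le_trans (normr_Im_le _))//.
  by rewrite (le_trans (fh _ Dx))// ler_norm.
Qed.

Lemma cintegrable_normc f : cmeasurable f -> cintegrable mu D f ->
  mu.-integrable D (fun x => (normc (f x))%:E).
Proof.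
move=> mf [f1 f2].
have f3 : mu.-integrable D
    (fun x => `|complex.Re (f x)|%:E + `|complex.Im (f x)|%:E)%E.
  by apply: integrableD => //; exact: integrable_norm.
apply: (le_integrable _ _ _ f3) => //.
  apply/measurable_EFinP; apply: (measurable_funS measurableT) => //.
  exact: measurable_normc.
move=> x Dx; rewrite -EFinD lee_fin ger0_norm ?normc_ge0//.
by rewrite (le_trans (normc_le _))// ler_norm.
Qed.

Lemma eq_cintegral f g : {in D, f =1 g} ->
  cintegral mu D f = cintegral mu D g.
Proof.
by move=> fg; apply: complex_eqP; apply: eq_Rintegral => x Dx; rewrite fg.
Qed.

(** Fubini is used on whole spaces; an integral over a set enters it through its indicator. *)
Lemma cintegral_mkcond f : cintegral mu D f =
  cintegral mu setT (fun x => (\1_D x)%:C * f x).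
Proof.
apply: complex_eqP; rewrite /= Rintegral_mkcond; apply: eq_Rintegral => x _;
  rewrite ?Re_mulc ?Im_mulc /= patchE indicE; case: ifPn => _;
  by rewrite ?mul1r ?mul0r ?subr0 ?addr0.
Qed.

Lemma cintegrable_mkcond f : cintegrable mu D f <->
  cintegrable mu setT (fun x => (\1_D x)%:C * f x).
Proof.
rewrite /cintegrable (integrable_mkcond _ mD).
rewrite (integrable_mkcond (fun x => (complex.Im (f x))%:E) mD).
have -> : (fun x => (complex.Re (f x))%:E) \_ D =
    (fun x => (complex.Re ((\1_D x)%:C * f x))%:E).
  apply/funext => x; rewrite patchE Re_mulc indicE /=; case: ifPn => _;
  by rewrite ?mul1r ?mul0r ?subr0 ?addr0.
have -> // : (fun x => (complex.Im (f x))%:E) \_ D =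
    (fun x => (complex.Im ((\1_D x)%:C * f x))%:E).
apply/funext => x; rewrite patchE Im_mulc indicE /=; case: ifPn => _;
by rewrite ?mul1r ?mul0r ?subr0 ?addr0.
Qed.

Lemma cintegralZl (c : R[i]) f : cintegrable mu D f ->
  cintegral mu D (fun x => c * f x) = c * cintegral mu D f.
Proof.
case: c => a b [f1 f2]; apply: complex_eqP; rewrite ?Re_mulc ?Im_mulc /=.
- under eq_Rintegral do rewrite Re_mulc /=.
  by rewrite RintegralB ?RintegralZl//; exact: integrableZ_real.
- under eq_Rintegral do rewrite Im_mulc /=.
  by rewrite RintegralD ?RintegralZl//; exact: integrableZ_real.
Qed.

(* The sharp constant is 1. *)
Lemma normc_cintegral_le f (h : T -> R) : cmeasurable f ->
  mu.-integrable D (EFin \o h) -> (forall x, D x -> normc (f x) <= h x) ->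
  normc (cintegral mu D f) <= 2 * \int[mu]_(x in D) h x.
Proof.
move=> mf hi fh; have [f1 f2] := le_cintegrable mf hi fh.
rewrite (le_trans (normc_le _))//= mulr_natl mulr2n lerD//.
- apply: (le_trans (le_normr_Rintegral mD f1)).
  apply: le_Rintegral => //; first exact: integrable_norm.
  by move=> x Dx; rewrite (le_trans (normr_Re_le _))// fh.
- apply: (le_trans (le_normr_Rintegral mD f2)).
  apply: le_Rintegral => //; first exact: integrable_norm.
  by move=> x Dx; rewrite (le_trans (normr_Im_le _))// fh.
Qed.

Lemma cdominated_cvg (f_ : nat -> T -> R[i]) f (h : T -> R) :
  (forall n, cmeasurable (f_ n)) -> cmeasurable f ->
  {ae mu, forall x, D x ->
    (complex.Re (f_ n x) @[n --> \oo] --> complex.Re (f x)) /\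
    (complex.Im (f_ n x) @[n --> \oo] --> complex.Im (f x))} ->
  mu.-integrable D (EFin \o h) ->
  {ae mu, forall x, D x -> forall n, normc (f_ n x) <= h x} ->
  [/\ cintegrable mu D f,
  complex.Re (cintegral mu D (f_ n)) @[n --> \oo] -->
    complex.Re (cintegral mu D f) &
  complex.Im (cintegral mu D (f_ n)) @[n --> \oo] -->
    complex.Im (cintegral mu D f)].
Proof.
move=> mf_ [f1 f2] cf hi fh.
have [|||||i1 c1] := @Rdominated_cvg R _ _ mu D
  (fun n x => complex.Re (f_ n x)) (fun x => complex.Re (f x)) h mD.
- by move=> n; have [+ _] := mf_ n; exact: measurable_funS.
- exact: measurable_funS f1.
- by apply: filterS cf => x h' Dx; have [] := h' Dx.
- by [].
- by apply: filterS fh => x h' Dx n; rewrite (le_trans (normr_Re_le _))// h'.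
have [|||||i2 c2] := @Rdominated_cvg R _ _ mu D
  (fun n x => complex.Im (f_ n x)) (fun x => complex.Im (f x)) h mD.
- by move=> n; have [_ +] := mf_ n; exact: measurable_funS.
- exact: measurable_funS f2.
- by apply: filterS cf => x h' Dx; have [] := h' Dx.
- by [].
- by apply: filterS fh => x h' Dx n; rewrite (le_trans (normr_Im_le _))// h'.
by [].
Qed.

End basics.

Section cfubini.
Context d1 d2 (T1 : measurableType d1) (T2 : measurableType d2).
Variable m1 : {sigma_finite_measure set T1 -> \bar R}.
Variable m2 : {sigma_finite_measure set T2 -> \bar R}.

Section fubini.
Variable f : T1 * T2 -> R[i].
Hypothesis fint : cintegrable (m1 \x m2)%E setT f.

Lemma cfubini1 : cintegral m1 setT (fun x => cintegral m2 setT
  (fun y => f (x, y))) = cintegral (m1 \x m2)%E setT f.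
Proof.
have [f1 f2] := fint; apply: complex_eqP => /=.
- exact: (Rfubini1 f1).
- exact: (Rfubini1 f2).
Qed.

Lemma cfubini2 : cintegral m2 setT (fun y => cintegral m1 setT
  (fun x => f (x, y))) = cintegral (m1 \x m2)%E setT f.
Proof.
have [f1 f2] := fint; apply: complex_eqP => /=.
- exact: (Rfubini2 f1).
- exact: (Rfubini2 f2).
Qed.

Lemma cfubini : cintegral m1 setT (fun x => cintegral m2 setT
  (fun y => f (x, y))) = cintegral m2 setT (fun y => cintegral m1 setT
  (fun x => f (x, y))).
Proof. by rewrite cfubini1 cfubini2. Qed.

End fubini.

Lemma cintegrable_prod (f : T1 -> R[i]) (g : T2 -> R[i]) :
  cmeasurable f -> cmeasurable g ->
  cintegrable m1 setT f -> cintegrable m2 setT g ->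
  cintegrable (m1 \x m2)%E setT (fun z => f z.1 * g z.2).
Proof.
move=> mf mg fi gi; apply: (@le_cintegrable _ _ _ _ _ _
    (fun z : T1 * T2 => normc (f z.1) * normc (g z.2))) => //.
- apply: cmeasurableM.
  + exact: (cmeasurable_comp measurable_fst).
  + exact: (cmeasurable_comp measurable_snd).
- by apply: (integrable_prod (f := fun x => normc (f x))
    (g := fun y => normc (g y))); exact: cintegrable_normc.
- by move=> z _; rewrite ComplexField.Normc.normcM.
Qed.

Lemma cintegral_prod (f : T1 -> R[i]) (g : T2 -> R[i]) :
  cmeasurable f -> cmeasurable g ->
  cintegrable m1 setT f -> cintegrable m2 setT g ->
  cintegral (m1 \x m2)%E setT (fun z => f z.1 * g z.2) =
  cintegral m1 setT f * cintegral m2 setT g.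
Proof.
move=> mf mg fi gi; rewrite -(cfubini1 (cintegrable_prod mf mg fi gi)) /=.
transitivity (cintegral m1 setT (fun x => cintegral m2 setT g * f x)).
  by apply: eq_cintegral => x _; rewrite cintegralZl// mulrC.
by rewrite cintegralZl// mulrC.
Qed.

End cfubini.

End complex_integrals.

(** * One-dimensional calculus *)

Section affine_change_of_variable.
Context (R : realType).
Local Notation mu := (@lebesgue_measure R).
Variables a b : R.
Hypothesis b0 : b != 0.

Let phi : measurableTypeR R -> measurableTypeR R := fun x => a + b * x.

Let cphi : continuous (phi : R -> R).
Proof.
by move=> x; apply: cvgD; [exact: cvg_cst|apply: cvgMr; exact: cvg_id].
Qed.

Let mphi : measurable_fun setT phi.
Proof. exact: (continuous_measurable_fun cphi). Qed.

Let push : {measure set (measurableTypeR R) -> \bar R}.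
Proof. by refine (pushforward mu phi : measure _ R); exact: mphi. Defined.

(** By uniqueness of Lebesgue measure it suffices to compare both sides on the intervals []x, y]]. A
    negative slope turns the preimage into an interval open on the other side, of the same
    length. *)
Let pushforward_affine (A : set (measurableTypeR R)) : measurable A ->
  mu A = mscale `|b|%:nng push A.
Proof.
apply: lebesgue_measure_unique => _ [[x y]] _ <-.
rewrite [RHS](_ : _ = `|b|%:E * mu (phi @^-1` `]x, y]))%E//=.
rewrite lebesgue_measure_itv/= lte_fin.
have [b_gt0|b_lt0] := ltP 0 b.
- have -> : phi @^-1` `]x, y] = `]((x - a) / b), ((y - a) / b)]%classic.
    apply/seteqP; split => z /=; rewrite !in_itv/= ltr_pdivrMr// ler_pdivlMr//;
      rewrite /phi; nra.
  rewrite lebesgue_measure_itv/= lte_fin ltr_pM2r ?invr_gt0// ltrD2r.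
  case: ifPn => xy; last by rewrite mule0.
  rewrite -!EFinB -EFinM; congr (_%:E).
  by rewrite gtr0_norm//; field.
- have {}b_lt0 : b < 0 by rewrite lt_neqAle b0.
  have -> : phi @^-1` `]x, y] = `[((y - a) / b), ((x - a) / b)[%classic.
    apply/seteqP; split => z /=; rewrite !in_itv/= ltr_ndivlMr// ler_ndivrMr//;
      rewrite /phi; nra.
  rewrite lebesgue_measure_itv/= lte_fin ltr_nM2r ?invr_lt0// ltrD2r.
  case: ifPn => xy; last by rewrite mule0.
  rewrite -!EFinB -EFinM; congr (_%:E).
  by rewrite ltr0_norm//; field.
Qed.

Let ge0_integral_affine (f : R -> \bar R) :
  measurable_fun setT f -> (forall x, 0 <= f x)%E ->
  (\int[mu]_x f x = `|b|%:E * \int[mu]_x f (a + b * x)%R)%E.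
Proof.
move=> mf f0.
rewrite (eq_measure_integral (mscale `|b|%:nng push)); last first.
  by move=> A mA _; exact: pushforward_affine.
rewrite ge0_integral_mscale//; congr (_ * _)%E.
by rewrite ge0_integral_pushforward.
Qed.

Lemma integrable_affine (f : R -> R) : mu.-integrable setT (EFin \o f) ->
  mu.-integrable setT (fun x => (f (a + b * x))%:E).
Proof.
move=> /integrableP[mf fi].
have mf' : measurable_fun setT (fun x => (f (a + b * x))%:E).
  exact: (measurableT_comp mf mphi).
apply/integrableP; split => //.
move: fi; rewrite ge0_integral_affine//; last exact: measurableT_comp.
have : (0 <= \int[mu]_x `|f (a + b * x)|%:E)%E by exact: integral_ge0.
rewrite /=; case: (integral _ _ _) => [r||]//= _; first by rewrite !ltry.
(* An infinite integral would remain infinite after multiplication by the positive factor. *)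
by rewrite gt0_muley// lte_fin normr_gt0.
Qed.

Lemma Rintegral_affine (f : R -> R) : mu.-integrable setT (EFin \o f) ->
  \int[mu]_x f x = `|b| * \int[mu]_x f (a + b * x).
Proof.
move=> fi; have fi' := integrable_affine fi.
have mf := measurable_int _ fi.
have [i1 i2] := (integrable_pos_fin_num measurableT fi',
  integrable_neg_fin_num measurableT fi').
rewrite /Rintegral integralE [in RHS]integralE.
rewrite (@ge0_integral_affine (EFin \o f)^\+%E)//; last exact: measurable_funepos.
rewrite (@ge0_integral_affine (EFin \o f)^\-%E)//; last exact: measurable_funeneg.
have e1 : (\int[mu]_x (EFin \o f)^\+ (a + b * x)%R =
    \int[mu]_x (fun x => (f (a + b * x))%:E)^\+ x)%E.
  by apply: eq_integral => x _; rewrite !funeposE.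
have e2 : (\int[mu]_x (EFin \o f)^\- (a + b * x)%R =
    \int[mu]_x (fun x => (f (a + b * x))%:E)^\- x)%E.
  by apply: eq_integral => x _; rewrite !funenegE.
rewrite e1 e2 -muleBr//; last by rewrite fin_num_adde_defr.
by rewrite fineM// fin_numB i1 i2.
Qed.

End affine_change_of_variable.

(** * Even and odd functions on symmetric sets *)

Section symmetric_sets.
Context (R : realType).
Local Notation mu := (@lebesgue_measure R).
Variable D : set R.
Hypotheses (mD : measurable D) (symD : forall x, D (- x) <-> D x).

Let patchN (f : R -> R) x : (f \_ D) (0 + -1 * x) = ((fun y => f (- y)) \_ D) x.
Proof.
rewrite add0r mulN1r !patchE.
have -> // : (- x \in D) = (x \in D).
by apply/idP/idP => /set_mem h; apply/mem_set/symD; rewrite ?opprK.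
Qed.

Lemma Rintegral_opp (f : R -> R) : mu.-integrable D (EFin \o f) ->
  \int[mu]_(x in D) f x = \int[mu]_(x in D) f (- x).
Proof.
move=> fi; rewrite [LHS]Rintegral_mkcond [RHS]Rintegral_mkcond.
rewrite (@Rintegral_affine _ 0 (-1))//.
  by rewrite normrN1 mul1r; apply: eq_Rintegral => x _; exact: patchN.
by rewrite -restrict_EFin; apply/(@integrable_mkcond _ _ _ mu D _ mD).
Qed.

Lemma Rintegral_odd (f : R -> R) : mu.-integrable D (EFin \o f) ->
  (forall x, f (- x) = - f x) -> \int[mu]_(x in D) f x = 0.
Proof.
move=> fi fN; have := Rintegral_opp fi.
have -> : \int[mu]_(x in D) f (- x) = \int[mu]_(x in D) (-1 * f x).
  by congr (Rintegral _ _ _); apply/funext => x; rewrite fN mulN1r.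
by rewrite RintegralZl// => h; lra.
Qed.

Lemma Rintegral_even (f : R -> R) : mu.-integrable D (EFin \o f) ->
  (forall x, f (- x) = f x) ->
  \int[mu]_(x in D) f x = 2 * \int[mu]_(x in D `&` `[0, +oo[) f x.
Proof.
move=> fi fN.
pose P := D `&` `[0, +oo[; pose N := D `&` `]-oo, 0[.
have mP : measurable P by exact: measurableI.
have mN : measurable N by exact: measurableI.
have DE : D = N `|` P.
  rewrite /N /P -setIUr; apply/esym/setIidPl => x _.
  by rewrite /= !in_itv/= andbT; case: ltP => _; [left|right].
have fP : mu.-integrable P (EFin \o f) by apply: integrableS fi => //; exact: subIsetl.
have fNi : mu.-integrable N (EFin \o f) by apply: integrableS fi => //; exact: subIsetl.
rewrite [LHS](_ : _ = \int[mu]_(x in N `|` P) f x); last by rewrite -DE.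
rewrite Rintegral_setU//; first last.
- apply/disj_setPS => x [[_ /=]]; rewrite !in_itv/= => x0 [_].
  by rewrite /= in_itv/= andbT leNgt x0.
- by rewrite -DE.
rewrite mulr_natl mulr2n; congr (_ + _).
rewrite [LHS]Rintegral_mkcond (@Rintegral_affine _ 0 (-1))//; last first.
  by rewrite -restrict_EFin; apply/(@integrable_mkcond _ _ _ mu N _ mN).
rewrite normrN1 mul1r.
(* Reflection carries the negative half onto [P] deprived of 0, and a single point is negligible. *)
transitivity (\int[mu]_(x in P `\ 0) f x).
  rewrite [RHS]Rintegral_mkcond; apply: eq_Rintegral => x _.
  rewrite add0r mulN1r !patchE fN.
  have -> // : (- x \in N) = (x \in P `\ 0).
  apply/idP/idP => /set_mem h; apply/mem_set.
    case: h => /symD Dx /=; rewrite in_itv/= oppr_lt0 => x0.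
    split; first by split => //=; rewrite in_itv/= ltW.
    by move=> /= xE; rewrite xE ltxx in x0.
  case: h => -[Dx /=]; rewrite in_itv/= andbT => x0 /eqP xn0.
  by split; [exact/symD|rewrite /= in_itv/= oppr_lt0 lt_neqAle eq_sym xn0].
rewrite /Rintegral integral_setD1//.
- exact: measurableD.
- by apply: measurable_funS (measurable_int _ fP) => // x [].
Qed.

End symmetric_sets.

(** * Improper integrals by the fundamental theorem of calculus *)

Section improper_integrals.
Context (R : realType).
Local Notation mu := (@lebesgue_measure R).
Implicit Types (f F : R -> R) (a b l m x : R).

Lemma is_derive1_continuous f x l : is_derive x 1 f l -> {for x, continuous f}.
Proof.
by move=> df; apply/differentiable_continuous/derivable1_diffP; exact: ex_derive.
Qed.

Lemma Rintegral_FTC f F a b : a < b ->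
  (forall x, a <= x <= b -> {for x, continuous f}) ->
  (forall x, a <= x <= b -> is_derive x 1 F (f x)) ->
  \int[mu]_(x in `[a, b]) f x = F b - F a.
Proof.
move=> ab cf dF; rewrite /Rintegral (@continuous_FTC2 _ f F a b)//.
- apply/continuous_within_itvP => //; split.
  + by move=> x; rewrite in_itv/= => /andP[ax xb]; apply: cf; rewrite !ltW.
  + by apply: cvg_at_right_filter; apply: cf; rewrite lexx ltW.
  + by apply: cvg_at_left_filter; apply: cf; rewrite lexx ltW.
- split.
  + move=> x; rewrite in_itv/= => /andP[ax xb].
    by have ? : is_derive x 1 F (f x) by apply: dF; rewrite !ltW.
  + by apply/cvg_at_right_filter/is_derive1_continuous/dF; rewrite lexx ltW.
  + by apply/cvg_at_left_filter/is_derive1_continuous/dF; rewrite lexx ltW.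
- move=> x; rewrite in_itv/= => /andP[ax xb].
  have ? : is_derive x 1 F (f x) by apply: dF; rewrite !ltW.
  by rewrite derive1E derive_val.
Qed.

(** As [f] is assumed integrable, dominated convergence along the intervals [[a, a + n.+1]]
    identifies the integral, so the limit of [F] is required along one sequence only. The successor
    keeps these intervals nondegenerate, as [Rintegral_FTC] demands. *)
Lemma Rintegral_FTCy f F a l :
  (forall x, a <= x -> {for x, continuous f}) ->
  (forall x, a <= x -> is_derive x 1 F (f x)) ->
  mu.-integrable `[a, +oo[ (EFin \o f) ->
  F (a + n.+1%:R) @[n --> \oo] --> l ->
  \int[mu]_(x in `[a, +oo[) f x = l - F a.
Proof.
move=> cf dF fi Fl.
pose D n : set R := `[a, a + n.+1%:R]%classic.
have DS n : D n `<=` `[a, +oo[.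
  by move=> x; rewrite /D /= !in_itv/= => /andP[-> _].
have mD n : measurable (D n) by exact: measurable_itv.
have /measurable_EFinP mf := measurable_int mu fi.
have [||||||_] := @Rdominated_cvg R _ _ mu `[a, +oo[%classic
  (fun n => f \_ (D n)) f (fun x => `|f x|).
- by [].
- move=> n; apply/measurable_restrict; [exact: mD|by []|apply: measurable_funS mf => //].
  exact: subIsetl.
- apply: nearW => x; rewrite /= in_itv/= andbT => ax.
  apply: cvg_near_cst; near=> n; rewrite patchE mem_set//=.
  rewrite /D /= in_itv/= ax /= -lerBlDl.
  near: n; apply: filterS (nbhs_infty_ger (x - a)) => n /le_trans; apply.
  by rewrite ler_nat.
- exact: integrable_norm.
- by apply: nearW => x _ n; rewrite patchE; case: ifPn => // _; rewrite normr0.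
have -> : (fun n => \int[mu]_(x in `[a, +oo[) (f \_ (D n)) x) =
    (fun n => F (a + n.+1%:R) - F a).
  apply/funext => n; rewrite -Rintegral_mkcondr setIC (setIidl (DS n)).
  apply: Rintegral_FTC; first by rewrite ltrDl.
  - by move=> x /andP[ax _]; exact: cf.
  - by move=> x /andP[ax _]; exact: dF.
move=> h1; have h2 : F (a + n.+1%:R) - F a @[n --> \oo] --> l - F a.
  by apply: cvgB => //; exact: cvg_cst.
exact: (cvg_unique _ h1 h2).
Unshelve. all: by end_near. Qed.

Lemma Rintegral_FTCT f F l m : continuous f ->
  (forall x, is_derive x 1 F (f x)) ->
  mu.-integrable setT (EFin \o f) ->
  F n.+1%:R @[n --> \oo] --> l -> F (- n.+1%:R) @[n --> \oo] --> m ->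
  \int[mu]_x f x = l - m.
Proof.
move=> cf dF fi Fl Fm.
have fNi : mu.-integrable setT (EFin \o (fun x => f (- x))).
  have := @integrable_affine _ 0 (-1) _ f fi.
  rewrite oppr_eq0 oner_eq0 => /(_ isT).
  by under eq_fun do rewrite add0r mulN1r.
have TU : [set: R] = `]-oo, 0[%classic `|` `[0, +oo[%classic.
  apply/esym; rewrite -subTset => x _ /=; rewrite !in_itv/= andbT.
  by case: ltP => _; [left|right].
have fyi : mu.-integrable `[0, +oo[ (EFin \o f) by exact: integrableS fi.
have fyNi : mu.-integrable `[0, +oo[ (EFin \o (fun x => f (- x))).
  exact: integrableS fNi.
have e1 : \int[mu]_(x in `[0, +oo[) f x = l - F 0.
  apply: Rintegral_FTCy => //; first by move=> x _; exact: cf.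
  by rewrite (_ : (fun _ => _) = (fun n => F n.+1%:R))//; apply/funext => n;
    rewrite add0r.
(* The negative half-line is reflected; [x |-> - F (- x)] is a primitive of [x |-> f (- x)]. *)
have e2 : \int[mu]_(x in `[0, +oo[) f (- x) = - m - (- F (- 0)).
  apply: (@Rintegral_FTCy _ (fun x => - F (- x))) => //.
  - move=> x _; apply: (@continuous_comp _ _ _ -%R f x); last exact: cf.
    exact: opp_continuous.
  - move=> x _; have := dF (- x) => dFx.
    have dN : is_derive x 1 (fun y : R => - y) (-1).
      exact: is_deriveN.
    have := is_deriveN (is_derive1_comp dFx dN).
    by rewrite mulrN1 opprK.
  - rewrite (_ : (fun _ => _) = (fun n => - F (- n.+1%:R))); first exact: cvgN.
    by apply/funext => n; rewrite add0r.
rewrite {1}TU Rintegral_setU//; last 2 first.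
- by rewrite -TU.
- by apply/disj_setPS => x [] /=; rewrite !in_itv/= andbT leNgt => ->.
have -> : \int[mu]_(x in `]-oo, 0[) f x = \int[mu]_(x in `[0, +oo[) f (- x).
  rewrite -[RHS]Rintegral_itv_obnd_cbnd; last first.
    by apply/(integrableS _ _ _ fNi).
  rewrite [LHS]Rintegral_mkcond (@Rintegral_affine _ 0 (-1))//; last first.
    rewrite -restrict_EFin; apply/(@integrable_mkcond _ _ _ mu `]-oo, 0[%classic) => //.
    exact: integrableS fi.
  rewrite normrN1 mul1r [RHS]Rintegral_mkcond; apply: eq_Rintegral => x _.
  rewrite add0r mulN1r !patchE.
  have -> // : (- x \in `]-oo, 0[%classic) = (x \in `]0%R, +oo[%classic).
  apply/idP/idP => /set_mem /=; rewrite in_itv/= => h; apply/mem_set => /=.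
    by rewrite in_itv/= andbT -oppr_lt0.
  by rewrite in_itv/= oppr_lt0; move: h; rewrite andbT.
rewrite e1 e2 oppr0; ring.
Qed.

(** Unnormalised Cauchy density, of total mass [pi]. It is both the standard majorant and the
    profile of the transform of the damping factor. *)
Definition cauchy_fun x : R := (1 + x ^+ 2)^-1.

Lemma cauchy_fun_gt0 x : 0 < cauchy_fun x.
Proof. by rewrite invr_gt0 ltr_pwDl// sqr_ge0. Qed.

Lemma continuous_cauchy_fun : continuous cauchy_fun.
Proof. exact: continuous_oneDsqrV. Qed.

Lemma integral_cauchy_fun : (\int[mu]_x (cauchy_fun x)%:E = pi%:E)%E.
Proof.
rewrite ge0_symfun_integralT.
- rewrite -set_itvcy integral0y_oneDsqr -EFinM; congr (_%:E).
  by rewrite mulrCA divff ?mulr1.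
- by move=> x; exact/ltW/cauchy_fun_gt0.
- exact: continuous_cauchy_fun.
- by move=> x /=; rewrite /cauchy_fun sqrrN.
Qed.

Lemma integrable_cauchy_fun : mu.-integrable setT (EFin \o cauchy_fun).
Proof.
apply/integrableP; split.
  apply/measurable_EFinP; apply: continuous_measurable_fun.
  exact: continuous_cauchy_fun.
under eq_integral do rewrite /= ger0_norm ?(ltW (cauchy_fun_gt0 _))//.
by rewrite integral_cauchy_fun ltry.
Qed.

Lemma Rintegral_cauchy_fun : \int[mu]_x cauchy_fun x = pi.
Proof. by rewrite /Rintegral integral_cauchy_fun. Qed.

End improper_integrals.

Section complex_limits.
Context (R : realType).
Implicit Types (u v : nat -> R[i]) (k l : R[i]).

(** Componentwise convergence is the form in which [cdominated_cvg] takes and returns limits. *)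
Definition ccvg u l :=
  complex.Re (u n) @[n --> \oo] --> complex.Re l /\
  complex.Im (u n) @[n --> \oo] --> complex.Im l.

Lemma ccvgM u v k l : ccvg u k -> ccvg v l -> ccvg (fun n => u n * v n) (k * l).
Proof.
move=> [u1 u2] [v1 v2]; split.
- under eq_fun do rewrite Re_mulc.
  by rewrite Re_mulc; apply: cvgB; exact: cvgM.
- under eq_fun do rewrite Im_mulc.
  by rewrite Im_mulc; apply: cvgD; exact: cvgM.
Qed.

Lemma ccvg_cst l : ccvg (fun=> l) l.
Proof. by split; exact: cvg_cst. Qed.

Lemma ccvg_real (u : nat -> R) (l : R) :
  u n @[n --> \oo] --> l -> ccvg (fun n => (u n)%:C) l%:C.
Proof. by move=> ul; split => //=; exact: cvg_cst. Qed.

Lemma ccvg_expi (u : nat -> R) (l : R) :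
  u n @[n --> \oo] --> l -> ccvg (fun n => expi (u n)) (expi l).
Proof.
move=> ul; split => /=.
- by apply: continuous_cvg => //; exact: continuous_cos.
- by apply: continuous_cvg => //; exact: continuous_sin.
Qed.

Lemma ccvg_prod (I : Type) (r : seq I) (u : I -> nat -> R[i]) (l : I -> R[i]) :
  (forall i, ccvg (u i) (l i)) ->
  ccvg (fun n => \prod_(i <- r) u i n) (\prod_(i <- r) l i).
Proof.
move=> ul; elim: r => [|i r ih].
  by rewrite big_nil; under eq_fun do rewrite big_nil; exact: ccvg_cst.
by rewrite big_cons; under eq_fun do rewrite big_cons; exact: ccvgM.
Qed.

Lemma ccvg_unique u k l : ccvg u k -> ccvg u l -> k = l.
Proof.
move=> [u1 u2] [v1 v2]; apply: complex_eqP.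
- exact: (cvg_unique _ u1 v1).
- exact: (cvg_unique _ u2 v2).
Qed.

End complex_limits.

(** With [N = n.+1] one has [1 + N ^+ 2 >= N], so the Cauchy bound lies below [K] times the harmonic
    sequence. *)
Lemma cauchy_bound_cvg0 (R : realType) (u : nat -> R) (K : R) :
  (forall n, `|u n| <= K * cauchy_fun n.+1%:R) -> u n @[n --> \oo] --> 0.
Proof.
move=> h; have K0 : 0 <= K.
  have := le_trans (normr_ge0 _) (h 0%N).
  by rewrite pmulr_lge0// cauchy_fun_gt0.
have hK : K * harmonic n @[n --> \oo] --> 0.
  by rewrite -(mulr0 K); apply: cvgMr; exact: cvg_harmonic.
apply: norm_cvg0; apply: (squeeze_cvgr _ (cvg_cst 0) hK).
apply: nearW => n; rewrite normr_ge0 (le_trans (h n))// ler_wpM2l//.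
have N1 : (1 : R) <= n.+1%:R by rewrite ler1n.
have N2 : (0 : R) < 1 + n.+1%:R ^+ 2 by rewrite ltr_pwDl// sqr_ge0.
rewrite /cauchy_fun /harmonic /= lef_pV2 ?posrE//.
nra.
Qed.

(** * The damping factor and its Fourier transform *)

Section regularised_kernel.
Context (R : realType).
Local Notation mu := (@lebesgue_measure R).
Implicit Types (a b c e x y : R).

Lemma cintegral_affine a b (f : R -> R[i]) : b != 0 ->
  cintegrable mu setT f ->
  cintegral mu setT f =
  `|b|%:C * cintegral mu setT (fun x => f (a + b * x)).
Proof.
move=> b0 [f1 f2]; apply: complex_eqP; rewrite ?Re_mulc ?Im_mulc /= ?mul0r ?subr0 ?addr0.
- exact: (Rintegral_affine a b0 f1).
- exact: (Rintegral_affine a b0 f2).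
Qed.

Definition laplace_fun e x := expR (- (e * `|x|)).

Lemma laplace_fun_gt0 e x : 0 < laplace_fun e x.
Proof. exact: expR_gt0. Qed.

Lemma laplace_fun_le1 e x : 0 < e -> laplace_fun e x <= 1.
Proof.
by move=> e0; rewrite -expR0 ler_expR oppr_le0 mulr_ge0// ltW.
Qed.

(** Squaring [exp(y/2) >= 1 + y/2] at [y = e|x|] gives [exp y >= 1 + e^2 x^2 / 4]. The constant is
    chosen so that [(1 + 4/e^2)(1 + e^2 x^2 / 4) >= 1 + x^2]. *)
Lemma laplace_fun_le e x : 0 < e ->
  laplace_fun e x <= (1 + 4 / e ^+ 2) * cauchy_fun x.
Proof.
move=> e0; rewrite /laplace_fun /cauchy_fun expRN.
have y0 : 0 <= e * `|x| by rewrite mulr_ge0// ltW.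
have h1 : 1 + e ^+ 2 * x ^+ 2 / 4 <= expR (e * `|x|).
  have -> : e * `|x| = e * `|x| / 2 + e * `|x| / 2 by field.
  rewrite expRD; have h := expR_ge1Dx (e * `|x| / 2).
  have h' : (1 + e * `|x| / 2) * (1 + e * `|x| / 2) <=
      expR (e * `|x| / 2) * expR (e * `|x| / 2).
    by rewrite ler_pM// addr_ge0// divr_ge0.
  apply: le_trans h'; have := real_normK (num_real x); nra.
have x1 : 0 < 1 + x ^+ 2 by rewrite ltr_pwDl// sqr_ge0.
rewrite -[leLHS]mul1r ler_pdivlMr// mulrAC ler_pdivrMr ?expR_gt0// mul1r.
apply: (@le_trans _ _ ((1 + 4 / e ^+ 2) * (1 + e ^+ 2 * x ^+ 2 / 4))); last first.
  by rewrite ler_pM2l// ltr_pwDl// divr_ge0// sqr_ge0.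
have -> : (1 + 4 / e ^+ 2) * (1 + e ^+ 2 * x ^+ 2 / 4) =
    1 + x ^+ 2 + (4 / e ^+ 2 + e ^+ 2 * x ^+ 2 / 4).
  by field; rewrite gt_eqF.
have [e2 x2] := (sqr_ge0 e, sqr_ge0 x).
by rewrite lerDl; apply: addr_ge0; apply: divr_ge0 => //; exact: mulr_ge0.
Qed.

Lemma continuous_laplace_fun e : continuous (laplace_fun e).
Proof.
move=> x; apply: (@continuous_comp _ _ _ (fun x => - (e * `|x|)) expR).
  by apply: cvgN; apply: cvgMr; exact: norm_continuous.
exact: continuous_expR.
Qed.

Lemma measurable_laplace_fun e : measurable_fun setT (laplace_fun e).
Proof. by apply: continuous_measurable_fun; exact: continuous_laplace_fun. Qed.

Lemma integrable_laplace_fun e : 0 < e ->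
  mu.-integrable setT (EFin \o laplace_fun e).
Proof.
move=> e0; have := integrableZ_real (1 + 4 / e ^+ 2) measurableT
  (@integrable_cauchy_fun R).
apply: le_integrable => //.
  by apply/measurable_EFinP; exact: measurable_laplace_fun.
move=> x _ /=; rewrite lee_fin ger0_norm; last exact/ltW/laplace_fun_gt0.
by rewrite (le_trans (laplace_fun_le _ e0))// ler_norm.
Qed.

Lemma is_derive_lin c x : is_derive x 1 (fun y => c * y) c.
Proof.
by have := is_deriveZ c (is_derive_id x (1 : R)); rewrite /GRing.scale/= mulr1.
Qed.

Lemma is_derive_expR_lin c x :
  is_derive x 1 (fun y => expR (c * y)) (c * expR (c * x)).
Proof.
have h := is_derive_lin c x.
by rewrite mulrC; exact: (is_derive1_comp (is_derive_expR _) h).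
Qed.

Lemma is_derive_cos_lin c x :
  is_derive x 1 (fun y => cos (c * y)) (- (c * sin (c * x))).
Proof.
have h := is_derive_lin c x.
rewrite mulrC -mulNr; exact: (is_derive1_comp (is_derive_cos _) h).
Qed.

Lemma is_derive_sin_lin c x :
  is_derive x 1 (fun y => sin (c * y)) (c * cos (c * x)).
Proof.
have h := is_derive_lin c x.
rewrite mulrC; exact: (is_derive1_comp (is_derive_sin _) h).
Qed.

Lemma cintegrable_laplace e c : 0 < e ->
  cintegrable mu setT (fun x => expi (c * x) * (laplace_fun e x)%:C).
Proof.
move=> e0.
apply: (@le_cintegrable R _ (measurableTypeR R) mu setT measurableT _
  (laplace_fun e)).
- apply: cmeasurableM; last by apply: cmeasurable_real; exact: measurable_laplace_fun.
  by apply: cmeasurable_expi; exact: measurable_funM.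
- exact: integrable_laplace_fun.
- move=> x _; rewrite ComplexField.Normc.normcM normc_expi mul1r normcR.
  by rewrite ger0_norm// ltW// laplace_fun_gt0.
Qed.

Lemma cintegral_laplace e c : 0 < e ->
  cintegral mu setT (fun x => expi (c * x) * (laplace_fun e x)%:C) =
  (2 * e / (e ^+ 2 + c ^+ 2))%:C.
Proof.
move=> e0; have [i1 i2] := cintegrable_laplace c e0.
have lapN x : laplace_fun e (- x) = laplace_fun e x.
  by rewrite /laplace_fun normrN.
have ec0 : e ^+ 2 + c ^+ 2 != 0 by rewrite gt_eqF// ltr_wpDr ?sqr_ge0// exprn_gt0.
apply: complex_eqP => /=; last first.
  apply: Rintegral_odd => // x; rewrite !mulr0 !add0r lapN mulrN sinN.
  by rewrite mulNr.
rewrite Rintegral_even//; last first.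
  by move=> x; rewrite !mulr0 !subr0 lapN mulrN cosN.
rewrite setTI -mulrA; congr (_ * _).
(* This is the real part of [exp((- e + i c) x) / (- e + i c)]. *)
pose F x := expR (- e * x) * (c * sin (c * x) - e * cos (c * x)) /
  (e ^+ 2 + c ^+ 2).
have dF x : is_derive x 1 F (cos (c * x) * expR (- e * x)).
  have := is_derive_expR_lin (- e) x.
  have := is_derive_cos_lin c x.
  have := is_derive_sin_lin c x => d1 d2 d3.
  rewrite /F; apply: is_derive_eq.
  by rewrite /GRing.scale /=; field.
transitivity (\int[mu]_(x in `[0, +oo[) (cos (c * x) * expR (- e * x))).
  apply: eq_Rintegral => x /set_mem /=; rewrite in_itv/= andbT => x0.
  by rewrite mulr0 subr0 /laplace_fun ger0_norm// mulNr.
rewrite (_ : e / _ = 0 - F 0); last first.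
  by rewrite /F !mulr0 sin0 cos0 expR0; field.
apply: Rintegral_FTCy.
- move=> x _; apply: continuousM.
    by apply: is_derive1_continuous (is_derive_cos_lin c x).
  by apply: is_derive1_continuous (is_derive_expR_lin (- e) x).
- have : mu.-integrable `[0, +oo[
      (fun x => (complex.Re (expi (c * x) * (laplace_fun e x)%:C))%:E).
    exact: integrableS i1.
  apply: eq_integrable => // x /set_mem /=; rewrite in_itv/= andbT => x0.
  by rewrite mulr0 subr0 /laplace_fun ger0_norm// mulNr.
have bF x : 0 <= x -> `|F x| <= (`|c| + e) / (e ^+ 2 + c ^+ 2) * (laplace_fun e x).
  move=> x0; rewrite /F !normrM (ger0_norm (expR_ge0 _)) /laplace_fun (ger0_norm x0).
  rewrite mulNr -[leLHS]mulrA [leLHS]mulrC ler_pM2r ?expR_gt0//.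
  rewrite [`|_^-1|]ger0_norm; last by rewrite invr_ge0 addr_ge0// sqr_ge0.
  rewrite ler_pM2r; last by rewrite invr_gt0 lt_neqAle eq_sym ec0 addr_ge0// sqr_ge0.
  rewrite (le_trans (ler_normB _ _))// !normrM lerD//.
    by rewrite ler_piMr// sin_max.
  by rewrite (gtr0_norm e0) ler_piMr ?cos_max// ltW.
apply: (@cauchy_bound_cvg0 _ _ ((`|c| + e) / (e ^+ 2 + c ^+ 2) * (1 + 4 / e ^+ 2))) => n.
rewrite add0r (le_trans (bF _ _))// -[leRHS]mulrA ler_wpM2l//.
  by rewrite divr_ge0// addr_ge0// ?sqr_ge0// ltW.
exact: laplace_fun_le.
Qed.

End regularised_kernel.

(** * The damped chirp in one dimension *)

Section chirp_kernel.
Context (R : realType).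
Local Notation mu := (@lebesgue_measure R).
Variable s : R.
Hypothesis s0 : s != 0.
Implicit Types (a b c e x y w : R).

(** One coordinate pair [(x, w)] of the damped chirp times the symplectic phase, [(a, b)] being the
    matching coordinates of the other phase-space point. The full integrand is a product of such
    factors (see [chirp_prod]). *)
Definition reg_chirp e a b x w : R[i] :=
  expi (2 * pi * (- (x * w / s) + (w * a - x * b))) *
  (laplace_fun e x * laplace_fun e w)%:C.

(** What remains of [reg_chirp] once [w] is integrated out: a Cauchy kernel that concentrates at
    [x = s a] as [e] tends to 0. *)
Definition reg_chirp1 e a b x : R[i] :=
  expi (- (2 * pi * x * b)) *
  (laplace_fun e x * (2 * e / (e ^+ 2 + (2 * pi * (a - x / s)) ^+ 2)))%:C.

Let reg_chirpE e a b x w : reg_chirp e a b x w =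
  (expi (- (2 * pi * x * b)) * (laplace_fun e x)%:C) *
  (expi (2 * pi * (a - x / s) * w) * (laplace_fun e w)%:C).
Proof.
rewrite /reg_chirp mulrACA -expiD -rmorphM; congr (expi _ * _).
by field.
Qed.

Lemma cmeasurable_reg_chirp e a b : cmeasurable
  (fun p : measurableTypeR R * measurableTypeR R => reg_chirp e a b p.1 p.2).
Proof.
have m1 : measurable_fun setT
    (fun p : measurableTypeR R * measurableTypeR R => p.1 : R).
  exact: measurable_fst.
have m2 : measurable_fun setT
    (fun p : measurableTypeR R * measurableTypeR R => p.2 : R).
  exact: measurable_snd.
apply: cmeasurableM.
- apply: cmeasurable_expi; apply: measurable_funM => //.
  apply: measurable_funD.
    apply: measurable_funN; apply: measurable_funM => //.
    exact: measurable_funM.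
  by apply: measurable_funB; exact: measurable_funM.
- apply: cmeasurable_real; apply: measurable_funM.
  + by apply: (measurableT_comp (measurable_laplace_fun e) m1).
  + by apply: (measurableT_comp (measurable_laplace_fun e) m2).
Qed.

Lemma normc_reg_chirp e a b x w :
  normc (reg_chirp e a b x w) = laplace_fun e x * laplace_fun e w.
Proof.
rewrite ComplexField.Normc.normcM normc_expi mul1r normcR ger0_norm//.
by rewrite mulr_ge0// ltW// laplace_fun_gt0.
Qed.

Lemma cintegrable_reg_chirp e a b x : 0 < e ->
  cintegrable mu setT (reg_chirp e a b x).
Proof.
move=> e0; apply: (@le_cintegrable R _ (measurableTypeR R) mu setT measurableT
  _ (fun w => laplace_fun e x * laplace_fun e w)).
- exact: (cmeasurable_comp (measurable_pair1 x) (cmeasurable_reg_chirp e a b)).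
- exact: integrableZ_real (integrable_laplace_fun e0).
- by move=> w _; rewrite normc_reg_chirp.
Qed.

Lemma cintegral_reg_chirp e a b x : 0 < e ->
  cintegral mu setT (reg_chirp e a b x) = reg_chirp1 e a b x.
Proof.
move=> e0; have -> : reg_chirp e a b x = (fun w =>
  (expi (- (2 * pi * x * b)) * (laplace_fun e x)%:C) *
  (expi (2 * pi * (a - x / s) * w) * (laplace_fun e w)%:C)).
  by apply/funext => w; exact: reg_chirpE.
rewrite cintegralZl//; last exact: cintegrable_laplace.
by rewrite cintegral_laplace// -mulrA -rmorphM.
Qed.

Lemma cmeasurable_reg_chirp1 e a b : 0 < e ->
  cmeasurable (reg_chirp1 e a b : measurableTypeR R -> R[i]).
Proof.
move=> e0; have -> : reg_chirp1 e a b = (fun x => cintegral mu setT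
    (fun w => reg_chirp e a b x w)).
  by apply/funext => x; rewrite -cintegral_reg_chirp.
exact: (cmeasurable_cintegral mu (cmeasurable_reg_chirp e a b)).
Qed.

Lemma cintegrable_reg_chirp1 e a b : 0 < e ->
  cintegrable mu setT (reg_chirp1 e a b).
Proof.
move=> e0; apply: (@le_cintegrable R _ (measurableTypeR R) mu setT measurableT
  _ (fun x => 2 / e * laplace_fun e x)).
- exact: cmeasurable_reg_chirp1.
- exact: integrableZ_real (integrable_laplace_fun e0).
move=> x _; rewrite ComplexField.Normc.normcM normc_expi mul1r normcR normrM.
rewrite (gtr0_norm (laplace_fun_gt0 _ _)) mulrC ler_pM2r ?laplace_fun_gt0//.
have h : 0 < e ^+ 2 + (2 * pi * (a - x / s)) ^+ 2.
  by rewrite ltr_wpDr ?sqr_ge0// exprn_gt0.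
rewrite ger0_norm ?divr_ge0 ?mulr_ge0 ?(ltW h) ?(ltW e0)//.
rewrite ler_pdivrMr// [leRHS]mulrAC ler_pdivlMr// -[leLHS]mulrA -expr2.
by rewrite ler_pM2l// lerDl sqr_ge0.
Qed.

Definition chirp_kernel e a b : R[i] := cintegral mu setT (reg_chirp1 e a b).

(** The substitution [x = node e a y] makes [2 pi (a - x / s)] equal to [e y], which turns the
    kernel of width [e] into the fixed profile [cauchy_fun y]. *)
Let node e a y := s * a + - (s * e / (2 * pi)) * y.

Let chirp_integrand e a b y :=
  expi (- (2 * pi * node e a y * b)) *
  (laplace_fun e (node e a y) * cauchy_fun y)%:C.

Let cmeasurable_chirp_integrand e a b :
  cmeasurable (chirp_integrand e a b : measurableTypeR R -> R[i]).
Proof.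
have m1 : measurable_fun setT (node e a).
  apply: measurable_funD; first exact: measurable_cst.
  by apply: measurable_funM.
apply: cmeasurableM.
- apply: cmeasurable_expi; apply: measurable_funN; apply: measurable_funM => //.
  exact: measurable_funM.
- apply: cmeasurable_real; apply: measurable_funM.
  + by apply: (measurableT_comp (measurable_laplace_fun e) m1).
  + by apply: continuous_measurable_fun; exact: continuous_cauchy_fun.
Qed.

Let normc_chirp_integrand e a b y : 0 < e ->
  normc (chirp_integrand e a b y) <= cauchy_fun y.
Proof.
move=> e0; rewrite ComplexField.Normc.normcM normc_expi mul1r normcR.
have := cauchy_fun_gt0 y => c0.
rewrite ger0_norm; last by rewrite mulr_ge0// ltW// laplace_fun_gt0.
by rewrite ler_piMl ?(ltW c0)// laplace_fun_le1.
Qed.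

(** The Jacobian [|s| e / (2 pi)] times the factor [2 / e] left by the kernel is [|s| / pi], free of
    [e]. *)
Let chirp_kernelE e a b : 0 < e -> chirp_kernel e a b =
  (`|s| / pi)%:C * cintegral mu setT (chirp_integrand e a b).
Proof.
move=> e0; have pi0 := @pi_gt0 R.
have pin0 : (pi : R) != 0 by rewrite gt_eqF.
have en0 : e != 0 by rewrite gt_eqF.
rewrite /chirp_kernel (@cintegral_affine _ (s * a) (- (s * e / (2 * pi)))); first last.
- exact: cintegrable_reg_chirp1.
- rewrite oppr_eq0; apply: mulf_neq0; first exact: mulf_neq0 s0 (lt0r_neq0 e0).
  by rewrite invr_eq0 lt0r_neq0// mulr_gt0.
have -> : (fun y => reg_chirp1 e a b (s * a + - (s * e / (2 * pi)) * y)) =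
    (fun y => (2 / e)%:C * chirp_integrand e a b y).
  apply/funext => y.
  rewrite /reg_chirp1 /chirp_integrand [RHS]mulrCA -rmorphM /node.
  congr (_ * (_)%:C); rewrite [RHS]mulrCA; congr (_ * _).
  have -> : 2 * pi * (a - (s * a + - (s * e / (2 * pi)) * y) / s) = e * y.
    by move: (pi : R) pin0 => p p0; field; rewrite s0 p0.
  have y0 : 1 + y ^+ 2 != 0 by rewrite gt_eqF// ltr_pwDl// sqr_ge0.
  rewrite /cauchy_fun exprMn -[X in X + _]mulr1 -mulrDr.
  by field; rewrite ?y0 ?en0.
rewrite cintegralZl//; last first.
  apply: (@le_cintegrable R _ (measurableTypeR R) mu setT measurableT
    _ (@cauchy_fun R)) => //.
  - exact: integrable_cauchy_fun.
  - by move=> y _; exact: normc_chirp_integrand.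
rewrite mulrA -rmorphM; congr ((_)%:C * _).
have p2 : 0 < 2 * (pi : R) by rewrite mulr_gt0.
rewrite normrN normrM [`|s * e|]normrM normfV (gtr0_norm e0) (gtr0_norm p2).
clear p2.
by move: (pi : R) pin0 => p p0; field; rewrite p0 en0.
Qed.

(** The mass [pi] of the Cauchy profile cancels the denominator; the 2 is the constant of
    [normc_cintegral_le]. *)
Lemma normc_chirp_kernel e a b : 0 < e -> normc (chirp_kernel e a b) <= 2 * `|s|.
Proof.
move=> e0; have pi0 := @pi_gt0 R.
rewrite chirp_kernelE// ComplexField.Normc.normcM normcR.
have h : normc (cintegral mu setT (chirp_integrand e a b)) <= 2 * pi.
  rewrite -[X in _ * X]Rintegral_cauchy_fun.
  apply: (@normc_cintegral_le R _ (measurableTypeR R) mu setT measurableT) => //.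
  - exact: integrable_cauchy_fun.
  - by move=> y _; exact: normc_chirp_integrand.
apply: (le_trans (ler_wpM2l (normr_ge0 _) h)).
rewrite normrM normr_id normfV (gtr0_norm pi0) le_eqVlt; apply/orP; left.
by apply/eqP; move: (pi : R) pi0 => p p0; field; rewrite gt_eqF.
Qed.

(** In the rescaled integral the node tends to [s a] and the damping to 1, so the integrand tends to
    a constant phase times the Cauchy profile, which is also the majorant. *)
Lemma ccvg_chirp_kernel a b : ccvg (fun n => chirp_kernel (harmonic n) a b)
  (`|s|%:C * expi (- (2 * pi * s * (a * b)))).
Proof.
have pi0 := @pi_gt0 R.
have h0 n : 0 < harmonic n :> R by rewrite /harmonic invr_gt0 ltr0n.
under eq_fun do rewrite (chirp_kernelE _ _ (h0 _)).
have -> : `|s|%:C * expi (- (2 * pi * s * (a * b))) = (`|s| / pi)%:C *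
    cintegral mu setT (fun y => expi (- (2 * pi * s * (a * b))) * (cauchy_fun y)%:C).
  rewrite cintegralZl; last first.
  - split; last by under eq_fun do rewrite /=; exact: integrable0.
    exact: integrable_cauchy_fun.
  - by [].
  have -> : cintegral mu setT (fun y : R => (cauchy_fun y)%:C) = pi%:C.
    apply: complex_eqP => /=; first exact: Rintegral_cauchy_fun.
    by rewrite /Rintegral integral0.
  rewrite [RHS]mulrCA -rmorphM [LHS]mulrC; congr (_ * (_)%:C).
  by move: (pi : R) pi0 => p p0; field; rewrite gt_eqF.
apply: ccvgM; first exact: ccvg_cst.
have cnode y : node (harmonic n) a y @[n --> \oo] --> s * a.
  rewrite -[X in _ --> X]addr0; apply: cvgD; first exact: cvg_cst.
  rewrite -(mul0r y); apply: cvgMl.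
  rewrite -oppr0; apply: cvgN.
  rewrite -(mul0r (2 * pi)^-1); apply: cvgMl.
  rewrite -(mulr0 s); apply: cvgMr; exact: cvg_harmonic.
have [|||||_ c1 c2] := @cdominated_cvg R _ (measurableTypeR R) mu setT measurableT
  (fun n => chirp_integrand (harmonic n) a b)
  (fun y => expi (- (2 * pi * s * (a * b))) * (cauchy_fun y)%:C)
  (@cauchy_fun R).
- by move=> n.
- apply: cmeasurableM.
    by apply: cmeasurable_expi; exact: measurable_cst.
  apply: cmeasurable_real.
  by apply: continuous_measurable_fun; exact: continuous_cauchy_fun.
- apply: nearW => y _; apply: ccvgM.
    apply: ccvg_expi; apply: cvgN.
    have -> : 2 * pi * s * (a * b) = 2 * pi * (s * a) * b by ring.
    by apply: cvgMl; apply: cvgMr; exact: cnode.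
  apply: ccvg_real; rewrite -[X in _ --> X]mul1r; apply: cvgMl.
  rewrite /laplace_fun -expR0; apply: continuous_cvg; first exact: continuous_expR.
  rewrite -oppr0; apply: cvgN; rewrite -(mul0r `|s * a|).
  by apply: cvgM; [exact: cvg_harmonic|apply: cvg_norm].
- exact: integrable_cauchy_fun.
- by apply: nearW => y _ n; exact: normc_chirp_integrand.
by split.
Qed.

End chirp_kernel.

(** * Integration on phase space *)

Section lebesgue_rV_integrals.
Context (R : realType).
Local Notation mu := (@lebesgue_measure R).

Section cons.
Variable n : nat.
Let nu := (mu \x lebesgue_rV R n)%E.

Lemma ge0_integral_rV_S (f : 'rV[R]_n.+1 -> \bar R) : measurable_fun setT f ->
  (forall v, 0 <= f v)%E ->
  (\int[lebesgue_rV R n.+1]_v f v = \int[nu]_p f (rV_cons p))%E.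
Proof.
move=> mf f0.
exact: (ge0_integral_pushforward (@measurable_rV_cons R n) nu measurableT mf).
Qed.

Lemma integrable_rV_S (f : 'rV[R]_n.+1 -> R) : measurable_fun setT f ->
  (lebesgue_rV R n.+1).-integrable setT (EFin \o f) <->
  nu.-integrable setT (fun p => (f (rV_cons p))%:E).
Proof.
move=> mf.
have mfc : measurable_fun setT (fun p => f (rV_cons p)).
  exact: (measurableT_comp mf (@measurable_rV_cons R n)).
split=> /integrableP[_ fi]; apply/integrableP; split; try exact/measurable_EFinP.
- by move: fi; rewrite ge0_integral_rV_S//; exact/measurableT_comp/measurable_EFinP.
- by rewrite ge0_integral_rV_S//; exact/measurableT_comp/measurable_EFinP.
Qed.

Lemma Rintegral_rV_S (f : 'rV[R]_n.+1 -> R) :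
  (lebesgue_rV R n.+1).-integrable setT (EFin \o f) ->
  \int[lebesgue_rV R n.+1]_v f v = \int[nu]_p f (rV_cons p).
Proof.
move=> fi; have mf := measurable_int _ fi.
rewrite /Rintegral integralE [in RHS]integralE.
rewrite ge0_integral_rV_S//; last exact: measurable_funepos.
rewrite ge0_integral_rV_S//; last exact: measurable_funeneg.
by congr (fine (_ - _)%E); apply: eq_integral => p _; rewrite ?funeposE ?funenegE.
Qed.

End cons.

(** Integrability and value go through one induction, since splitting off the first coordinate by
    Fubini uses integrability of the remaining product. *)
Lemma cintegral_rV_prod n (f : 'I_n -> measurableTypeR R -> R[i]) :
  (forall i, cmeasurable (f i)) -> (forall i, cintegrable mu setT (f i)) ->
  cintegrable (lebesgue_rV R n) setT (fun v => \prod_(i < n) f i (v ord0 i)) /\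
  cintegral (lebesgue_rV R n) setT (fun v => \prod_(i < n) f i (v ord0 i)) =
  \prod_(i < n) cintegral mu setT (f i).
Proof.
elim: n f => [|n ih] f mf fi.
  have e : (fun v : 'rV[R]_0 => \prod_(i < 0) f i (v ord0 i)) = (fun=> 1).
    by apply/funext => v; rewrite big_ord0.
  rewrite e; split.
    split => /=; first last.
      exact: integrable0.
    exact: finite_measure_integrable_cst.
  rewrite big_ord0; apply: complex_eqP => /=.
    by rewrite /Rintegral integral_dirac//= indicE mem_set// mulr1.
  by rewrite /Rintegral integral0.
have [ihi ihe] := ih (fun i => f (lift ord0 i)) (fun i => mf _) (fun i => fi _).
pose F (v : 'rV[R]_n.+1) := \prod_(i < n.+1) f i (v ord0 i).
pose G (p : measurableTypeR R * 'rV[R]_n) :=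
  f ord0 p.1 * \prod_(i < n) f (lift ord0 i) (p.2 ord0 i).
have FG p : F (rV_cons p) = G p.
  rewrite /F big_ord_recl rV_consE0; congr (_ * _).
  by apply: eq_bigr => i _; rewrite rV_consES.
have mP m (h : 'I_m -> measurableTypeR R -> R[i]) : (forall i, cmeasurable (h i)) ->
    cmeasurable (fun v : 'rV[R]_m => \prod_(i < m) h i (v ord0 i)).
  move=> mh; apply: (@cmeasurable_prod R _ _ _ _
    (fun i (v : 'rV[R]_m) => h i (v ord0 i))) => i.
  exact: (cmeasurable_comp (measurable_coord i) (mh i)).
have mF : cmeasurable F by exact: mP.
have mG := mP _ _ (fun i => mf (lift ord0 i)).
have Gi : cintegrable (mu \x lebesgue_rV R n)%E setT G.
  exact: (cintegrable_prod (mf ord0) mG (fi ord0) ihi).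
have Fi : cintegrable (lebesgue_rV R n.+1) setT F.
  have [m1 m2] := mF; have [g1 g2] := Gi; split.
  - apply/(integrable_rV_S m1); under eq_fun do rewrite FG; exact: g1.
  - apply/(integrable_rV_S m2); under eq_fun do rewrite FG; exact: g2.
split; first exact: Fi.
transitivity (cintegral (mu \x lebesgue_rV R n)%E setT G).
  have [i1 i2] := Fi; apply: complex_eqP => /=.
  - rewrite (Rintegral_rV_S i1); apply: eq_Rintegral => p _; by rewrite FG.
  - rewrite (Rintegral_rV_S i2); apply: eq_Rintegral => p _; by rewrite FG.
rewrite (cintegral_prod (mf ord0) mG (fi ord0) ihi).
by rewrite ihe [RHS]big_ord_recl.
Qed.

End lebesgue_rV_integrals.

Section phase_integrals.
Context (R : realType).
Local Notation mu := (@lebesgue_measure R).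

Lemma Rintegral_ae0 d (T : measurableType d) (m : {measure set T -> \bar R})
    (g : T -> R) : measurable_fun setT g -> {ae m, forall x, g x = 0} ->
  \int[m]_x g x = 0.
Proof.
move=> mg g0; rewrite /Rintegral (ae_eq_integral (cst 0%E))//.
- by rewrite integral0.
- exact/measurable_EFinP.
- by apply: filterS g0 => x /= -> _.
Qed.

(** The tool for integration by parts: a derivative along the [i]-th axis has zero integral on every
    line of that direction. Coordinates before the [i]-th are peeled off by Fubini, where only
    almost every section is known to be integrable. *)
Lemma Rintegral_rV_lines n (i : 'I_n) (f : 'rV[R]_n -> R) :
  (lebesgue_rV R n).-integrable setT (EFin \o f) ->
  (forall v, \int[mu]_t f (v + (t : R) *: delta_mx ord0 i) = 0) ->
  \int[lebesgue_rV R n]_v f v = 0.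
Proof.
elim: n i f => [[]//|n ih] i f fi f0.
have /measurable_EFinP mf := measurable_int _ fi.
have /(integrable_rV_S mf) fi' := fi.
rewrite (Rintegral_rV_S fi).
case: (unliftP ord0 i) f0 => [j ->|->] f0.
- rewrite -(Rfubini1 (f := fun p => f (rV_cons p)) fi').
  apply: Rintegral_ae0.
    by have /measurable_EFinP := measurable_int _ (integrable_Rfubini1 fi').
  apply: filterS (ae_integrable1 fi') => x /= fx.
  apply: (ih j) => // w; rewrite -(f0 (rV_cons (x, w))).
  apply: eq_Rintegral => t _; congr f; apply/rowP => k.
  rewrite [RHS]mxE; case: (unliftP ord0 k) => [l|] ->.
  + rewrite !rV_consES !mxE /=.
    by rewrite (inj_eq (@lift_inj _ ord0)).
  + by rewrite !rV_consE0 !mxE /= mulr0 addr0.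
- rewrite -(Rfubini2 (f := fun p => f (rV_cons p)) fi').
  rewrite (_ : (fun w => _) = (fun=> 0)); first by rewrite /Rintegral integral0.
  apply/funext => w; rewrite -(f0 (rV_cons (0, w))).
  apply: eq_Rintegral => t _; congr f; apply/rowP => k.
  rewrite [RHS]mxE; case: (unliftP ord0 k) => [l|] ->.
  + by rewrite !rV_consES !mxE /= mulr0 addr0.
  + by rewrite !rV_consE0 !mxE /= mulr1 add0r.
Qed.

Section phase.
Variable d : nat.
Local Notation pm := (lebesgue_rV R d \x lebesgue_rV R d)%E.

Lemma Rintegral_phase_lines (i : 'I_d + 'I_d) (f : phase R d -> R) :
  pm.-integrable setT (EFin \o f) ->
  (forall z, \int[mu]_t f (z + (t : R) *: Defs.basis R i) = 0) ->
  \int[pm]_z f z = 0.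
Proof.
move=> fi f0; case: i f0 => j f0.
- rewrite -(Rfubini2 fi); apply: Rintegral_ae0.
    by have /measurable_EFinP := measurable_int _ (integrable_Rfubini2 fi).
  have fi' := integrable_swap fi.
  apply: filterS (ae_integrable1 fi') => w /= fw.
  apply: (Rintegral_rV_lines (i := j)) => // v; rewrite -(f0 (v, w)).
  apply: eq_Rintegral => t _; congr f.
  by apply: injective_projections => //=; rewrite scaler0 addr0.
- rewrite -(Rfubini1 fi); apply: Rintegral_ae0.
    by have /measurable_EFinP := measurable_int _ (integrable_Rfubini1 fi).
  apply: filterS (ae_integrable1 fi) => x /= fx.
  apply: (Rintegral_rV_lines (i := j)) => // w; rewrite -(f0 (x, w)).
  apply: eq_Rintegral => t _; congr f.
  by apply: injective_projections => //=; rewrite scaler0 addr0.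
Qed.

Lemma integrable_rV_prod (f : R -> R) : measurable_fun setT f ->
  mu.-integrable setT (EFin \o f) ->
  (lebesgue_rV R d).-integrable setT (fun v => (\prod_(i < d) f (v ord0 i))%:E).
Proof.
move=> mf fi.
have [|| [h _] _] := @cintegral_rV_prod R d (fun _ x => (f x)%:C).
- by move=> _; apply: cmeasurable_real.
- by move=> _; split => //=; exact: integrable0.
apply: eq_integrable h => // v _ /=.
by rewrite -rmorph_prod.
Qed.

Definition phase_prod (f : R -> R) (z : phase R d) : R :=
  (\prod_(i < d) f (z.1 ord0 i)) * (\prod_(i < d) f (z.2 ord0 i)).

Lemma integrable_phase_prod (f : R -> R) : measurable_fun setT f ->
  mu.-integrable setT (EFin \o f) ->
  pm.-integrable setT (EFin \o phase_prod f).
Proof.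
move=> mf fi; have h := integrable_rV_prod mf fi.
exact: (integrable_prod (f := fun v : 'rV[R]_d => \prod_(i < d) f (v ord0 i))
  (g := fun v : 'rV[R]_d => \prod_(i < d) f (v ord0 i)) h h).
Qed.

Lemma measurable_phase1 (i : 'I_d) :
  measurable_fun setT (fun z : phase R d => z.1 ord0 i : R).
Proof. exact: (measurableT_comp (measurable_coord i) measurable_fst). Qed.

Lemma measurable_phase2 (i : 'I_d) :
  measurable_fun setT (fun z : phase R d => z.2 ord0 i : R).
Proof. exact: (measurableT_comp (measurable_coord i) measurable_snd). Qed.

(** The sigma-algebra is generated by the coordinates, so second countability has to be used: an
    open set is the union of the countably many cubes with rational centre and radius [1 / k.+1]
    that it contains. *)
Lemma measurable_phase_open (O : set (phase R d)) : open O -> measurable O.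
Proof.
move=> oO.
pose box (c : ('rV[rat]_d * 'rV[rat]_d) * nat) : set (phase R d) :=
  [set z : phase R d | (forall i, `|ratr (c.1.1 ord0 i) - z.1 ord0 i| < c.2.+1%:R^-1) /\
           (forall i, `|ratr (c.1.2 ord0 i) - z.2 ord0 i| < c.2.+1%:R^-1)].
pose S := [set c | box c `<=` O].
have -> : O = \bigcup_(c in S) box c.
  apply/seteqP; split => [z Oz|z [c Sc cz]]; last exact: Sc.
  have [e /= e0 eO] : exists2 e, 0 < e & ball z e `<=` O.
    have /nbhs_ballP[e e0 eO] : nbhs z O by exact: open_nbhs_nbhs.
    by exists e.
  (* A centre within [1 / k.+1 < e / 2] of [z] gives a cube that contains [z] and lies in the ball
     of radius [e]. *)
  pose k := Num.truncn (2 / e).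
  have ke : k.+1%:R^-1 < e / 2 :> R.
    rewrite -[ltRHS]invrK ltf_pV2 ?posrE ?invr_gt0 ?divr_gt0//.
    by rewrite invf_div truncnS_gt.
  have q (x : R) : exists q : rat, `|ratr q - x| < k.+1%:R^-1.
    have [|q] := @rat_in_itvoo R (x - k.+1%:R^-1) (x + k.+1%:R^-1).
      by rewrite ltrD2l gtrN// invr_gt0.
    by rewrite in_itv/= => h; exists q; rewrite ltr_distl.
  pose c := ((\row_i projT1 (cid (q (z.1 ord0 i))),
    \row_i projT1 (cid (q (z.2 ord0 i)))), k).
  exists c; last first.
    by split => i /=; rewrite mxE; case: cid.
  move=> w [w1 w2]; apply: eO; split; split => //= i j; rewrite (ord1 i) /ball /=.
  - have := w1 j; rewrite /= mxE; case: cid => /= r r1 r2.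
    rewrite (_ : _ - _ = (ratr r - w.1 ord0 j) - (ratr r - z.1 ord0 j)); last by ring.
    rewrite (le_lt_trans (ler_normB _ _))//.
    have -> : e = e / 2 + e / 2 by field.
    by rewrite ltrD// (lt_trans _ ke).
  - have := w2 j; rewrite /= mxE; case: cid => /= r r1 r2.
    rewrite (_ : _ - _ = (ratr r - w.2 ord0 j) - (ratr r - z.2 ord0 j)); last by ring.
    rewrite (le_lt_trans (ler_normB _ _))//.
    have -> : e = e / 2 + e / 2 by field.
    by rewrite ltrD// (lt_trans _ ke).
rewrite bigcup_mkcond; apply: countable_bigcupT_measurable; first exact: countableP.
move=> c; case: ifPn => // _.
have -> : box c =
    (\bigcap_(i in [set: 'I_d])
      [set z : phase R d | `|ratr (c.1.1 ord0 i) - z.1 ord0 i| < c.2.+1%:R^-1]) `&`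
    (\bigcap_(i in [set: 'I_d])
      [set z : phase R d | `|ratr (c.1.2 ord0 i) - z.2 ord0 i| < c.2.+1%:R^-1]).
  apply/seteqP; split => z [h1 h2]; split => i; try move=> _; [exact: h1|exact: h2|
    exact: (h1 i I)|exact: (h2 i I)].
have mlt (h : phase R d -> R) (r q : R) : measurable_fun setT h ->
    measurable [set z | `|q - h z| < r].
  move=> mh; rewrite -[X in measurable X]setTI.
  have mh' : measurable_fun setT (fun z => `|q - h z|).
    by apply: measurableT_comp => //; exact: measurable_funB.
  have := mh' measurableT `]-oo, r[%classic (measurable_itv _).
  by congr measurable; apply/seteqP; split => z /=; rewrite in_itv.
apply: measurableI; apply: fin_bigcap_measurable; try exact: finite_finset.
- by move=> i _; apply: mlt; exact: measurable_phase1.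
- by move=> i _; apply: mlt; exact: measurable_phase2.
Qed.

Lemma continuous_measurable_phase (f : phase R d -> R) :
  continuous f -> measurable_fun setT f.
Proof.
move=> cf; apply: (measurability _ (RGenOInfty.measurableE R)) => // _ [_ [a ->] <-].
rewrite setTI; apply: measurable_phase_open.
by apply: open_comp => // z _; exact: cf.
Qed.

End phase.
End phase_integrals.

(** * Decay of Schwartz functions and of their transforms *)

Section schwartz_functions.
Context (R : realType) (d : nat).
Local Notation pm := (lebesgue_rV R d \x lebesgue_rV R d)%E.
Local Notation e_ i := (Defs.basis R i).
Implicit Types (f g : phase R d -> R) (z w : phase R d) (i : 'I_d + 'I_d).

(** Derivatives act separately on the real and imaginary parts, so calculus is done on real
    functions and transferred by [schwartz_Re] and [schwartz_Im]. *)
Definition rschwartz f := smooth f /\ forall N, exists M, forall b z,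
  (size b <= N)%N -> (1 + `|z|) ^+ N * `|partial b f z| <= M.

Lemma schwartz_Re (phi : phase R d -> R[i]) :
  schwartz phi -> rschwartz (fun z => complex.Re (phi z)).
Proof.
move=> [sRe _ h]; split => // N; have [M hM] := h N; exists M => b z bN.
apply: le_trans (hM b z bN); rewrite ler_wpM2l ?exprn_ge0 ?addr_ge0//.
exact: normr_Re_le (cpartial b phi z).
Qed.

Lemma schwartz_Im (phi : phase R d -> R[i]) :
  schwartz phi -> rschwartz (fun z => complex.Im (phi z)).
Proof.
move=> [_ sIm h]; split => // N; have [M hM] := h N; exists M => b z bN.
apply: le_trans (hM b z bN); rewrite ler_wpM2l ?exprn_ge0 ?addr_ge0//.
exact: normr_Im_le (cpartial b phi z).
Qed.

Definition pderiv i f : phase R d -> R := fun z => 'D_(e_ i) f z.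

Lemma partial_pderiv b i f : partial b (pderiv i f) = partial (rcons b i) f.
Proof. by rewrite /partial foldr_rcons. Qed.

Lemma rschwartz_pderiv i f : rschwartz f -> rschwartz (pderiv i f).
Proof.
move=> [sf h]; split => [b z|N]; first by rewrite partial_pderiv.
(* One more derivative calls for the next seminorm, whose extra power of [1 + |z| >= 1] only
   helps. *)
have [M hM] := h N.+1; exists M => b z bN; rewrite partial_pderiv.
apply: le_trans (hM (rcons b i) z _); last by rewrite size_rcons.
rewrite ler_wpM2r// exprS ler_peMl ?exprn_ge0 ?addr_ge0//.
by rewrite lerDl.
Qed.

Lemma partialB b f g : smooth f -> smooth g ->
  partial b (fun z => f z - g z) = (fun z => partial b f z - partial b g z).
Proof.
move=> sf sg; elim: b => //= i b ->; apply/funext => z.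
by rewrite deriveB//; apply: diff_derivable; [exact: sf|exact: sg].
Qed.

Lemma rschwartzB f g : rschwartz f -> rschwartz g ->
  rschwartz (fun z => f z - g z).
Proof.
move=> [sf hf] [sg hg]; split => [b z|N].
  by rewrite partialB//; apply: differentiableB; [exact: sf|exact: sg].
have [M hM] := hf N; have [M' hM'] := hg N; exists (M + M') => b z bN.
rewrite partialB// (le_trans _ (lerD (hM b z bN) (hM' b z bN)))// -mulrDr.
by rewrite ler_wpM2l ?exprn_ge0 ?addr_ge0// ler_normB.
Qed.

Lemma rschwartz_continuous f : rschwartz f -> continuous f.
Proof. by move=> [sf _] z; apply: differentiable_continuous; exact: (sf [::]). Qed.

Lemma rschwartz_measurable f : rschwartz f -> measurable_fun setT f.
Proof.
by move=> sf; apply: continuous_measurable_phase; exact: rschwartz_continuous.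
Qed.

Lemma coord_norm_le n (v : 'rV[R]_n) (j : 'I_n) : `|v ord0 j| <= `|v|.
Proof.
rewrite [leRHS]/Num.norm /= mx_normE.
change ((`|v ord0 j|%:nng : {nonneg R})%:num <=
  (\big[Num.max/0%:nng]_(k : 'I_1 * 'I_n) `|v k.1 k.2|%:nng)%:num).
rewrite num_le; exact: (le_bigmax _ (fun k : 'I_1 * 'I_n => `|v k.1 k.2|%:nng) (ord0, j)).
Qed.

Lemma phase_norm1 z : `|z.1| <= `|z|.
Proof. by rewrite prod_normE le_max lexx. Qed.

Lemma phase_norm2 z : `|z.2| <= `|z|.
Proof. by rewrite prod_normE le_max lexx orbT. Qed.

Lemma cauchy_fun_norm_le (x r : R) : `|x| <= r ->
  (1 + r) ^+ 2 * cauchy_fun x >= 1.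
Proof.
move=> xr; rewrite /cauchy_fun ler_pdivlMr ?mul1r; last first.
  by rewrite ltr_pwDl// sqr_ge0.
have := real_normK (num_real x); have := normr_ge0 x; nra.
Qed.

(** Each of the [2 d] Cauchy factors is compensated by two powers of [1 + |z|], whence the exponent
    [4 d]. *)
Lemma phase_prod_norm_ge1 z :
  1 <= (1 + `|z|) ^+ (4 * d) * phase_prod (@cauchy_fun R) z.
Proof.
have h (v : 'rV[R]_d) : `|v| <= `|z| ->
    1 <= (1 + `|z|) ^+ (2 * d) * \prod_(i < d) cauchy_fun (v ord0 i).
  move=> vz; rewrite exprM -[X in _ ^+ X]card_ord -prodr_const -big_split /=.
  apply: (@le_trans _ _ (\prod_(i < d) 1)); first by rewrite big1_eq.
  apply: ler_prod => i _; rewrite ler01/= cauchy_fun_norm_le//.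
  exact: le_trans (coord_norm_le _ _) vz.
have -> : (4 * d = 2 * d + 2 * d)%N by rewrite -mulnDl.
rewrite exprD /phase_prod mulrACA -[leLHS]mulr1.
by rewrite ler_pM// h// ?phase_norm1 ?phase_norm2.
Qed.

Lemma phase_prod_ge0 z : 0 <= phase_prod (@cauchy_fun R) z.
Proof. by rewrite mulr_ge0// prodr_ge0// => i _; exact/ltW/cauchy_fun_gt0. Qed.

Lemma rschwartz_le f : rschwartz f ->
  exists2 M, 0 <= M & forall z, `|f z| <= M * phase_prod (@cauchy_fun R) z.
Proof.
move=> [_ h]; have [M hM] := h (4 * d)%N.
have M0 : 0 <= M.
  apply: le_trans (hM [::] 0 _); last by [].
  by rewrite mulr_ge0// exprn_ge0// addr_ge0.
exists M => // z; have {}hM := hM [::] z isT; rewrite /= in hM.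
apply: (le_trans (ler_peMl (normr_ge0 _) (phase_prod_norm_ge1 z))).
by rewrite mulrAC ler_wpM2r// phase_prod_ge0.
Qed.

Lemma integrable_phase_cauchy :
  pm.-integrable setT (EFin \o phase_prod (@cauchy_fun R)).
Proof.
apply: integrable_phase_prod; last exact: integrable_cauchy_fun.
by apply: continuous_measurable_fun; exact: continuous_cauchy_fun.
Qed.

Lemma integrable_phase_le (f : phase R d -> R) M : measurable_fun setT f ->
  (forall z, `|f z| <= M * phase_prod (@cauchy_fun R) z) ->
  pm.-integrable setT (EFin \o f).
Proof.
move=> mf hM.
apply: le_integrable (integrableZ_real M measurableT integrable_phase_cauchy) => //.
  exact/measurable_EFinP.
by move=> z _; rewrite lee_fin (le_trans (hM z))// ler_norm.
Qed.

Lemma rschwartz_integrable f : rschwartz f -> pm.-integrable setT (EFin \o f).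
Proof.
move=> sf; have [M _ hM] := rschwartz_le sf.
exact: integrable_phase_le (rschwartz_measurable sf) hM.
Qed.

Definition phase_coord i z : R :=
  match i with inl j => z.1 ord0 j | inr j => z.2 ord0 j end.

Lemma phase_coord_basis i z (t : R) :
  phase_coord i (z + t *: e_ i) = phase_coord i z + t.
Proof. by case: i => j /=; rewrite !mxE !eqxx mulr1. Qed.

Lemma cauchy_fun_le1 (x : R) : cauchy_fun x <= 1.
Proof. by rewrite invf_le1 ?lerDl ?sqr_ge0// ltr_pwDl// sqr_ge0. Qed.

(** On a line of direction [i] only this factor varies; the others are at most 1. It yields
    integrable bounds along lines. *)
Lemma phase_prod_le_coord i z :
  phase_prod (@cauchy_fun R) z <= cauchy_fun (phase_coord i z).
Proof.
have h (v : 'rV[R]_d) (P : pred 'I_d) :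
    0 <= \prod_(i < d | P i) cauchy_fun (v ord0 i) <= 1.
  apply/andP; split; first by rewrite prodr_ge0// => j _; exact/ltW/cauchy_fun_gt0.
  by apply: prodr_ile1 => j _; rewrite cauchy_fun_le1 ltW// cauchy_fun_gt0.
have c0 x := ltW (@cauchy_fun_gt0 R x).
have hj (v : 'rV[R]_d) j : \prod_(i < d) cauchy_fun (v ord0 i) <= cauchy_fun (v ord0 j).
  by rewrite (bigD1 j)//= ler_piMr//; case/andP: (h v (predC1 j)).
rewrite /phase_prod; case: i => j /=.
- apply: le_trans (hj z.1 j); rewrite ler_piMr//.
    by case/andP: (h z.1 xpredT).
  by case/andP: (h z.2 xpredT).
- apply: le_trans (hj z.2 j); rewrite ler_piMl//.
    by case/andP: (h z.2 xpredT).
  by case/andP: (h z.1 xpredT).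
Qed.

Lemma cauchy_fun_shift (a x : R) :
  cauchy_fun (a + x) <= 2 * (1 + a ^+ 2) * cauchy_fun x.
Proof.
have p (y : R) : 0 < 1 + y ^+ 2 by rewrite ltr_pwDl// sqr_ge0.
rewrite /cauchy_fun ler_pdivlMr// mulrC ler_pdivrMr//.
(* The last square is [2 (a + x)^2 + 2 a^2 - x^2]. *)
have := sqr_ge0 a; have := sqr_ge0 (a + x); have := sqr_ge0 (a + a + x).
nra.
Qed.

Lemma is_derive_line f z i (t : R) : differentiable f (z + t *: e_ i) ->
  is_derive t 1 (fun u : R => f (z + u *: e_ i)) (pderiv i f (z + t *: e_ i)).
Proof.
move=> df; have dfi : derivable f (z + t *: e_ i) (e_ i) by exact: diff_derivable.
have E : (fun h : R => h^-1 *: (((fun u : R => f (z + u *: e_ i)) \o shift t) (h *: 1)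
    - f (z + t *: e_ i))) =
    (fun h : R => h^-1 *: ((f \o shift (z + t *: e_ i)) (h *: e_ i) - f (z + t *: e_ i))).
  apply/funext => h; congr (_ *: (f _ - _)).
  by rewrite /shift /= [h *: 1]mulr1 scalerDl addrCA.
apply: DeriveDef.
- by rewrite /derivable E; exact: dfi.
- by rewrite /derive E.
Qed.

End schwartz_functions.

(** * Decay of the symplectic Fourier transform of a Schwartz function *)

Section fourier_decay.
Context (R : realType) (d : nat).
Local Notation mu := (@lebesgue_measure R).
Local Notation pm := (lebesgue_rV R d \x lebesgue_rV R d)%E.
Local Notation e_ i := (Defs.basis R i).
Implicit Types (f g : phase R d -> R) (z w : phase R d) (i : 'I_d + 'I_d).

Definition sphase z w : R := 2 * pi * symplectic z w.

Definition freq i z : R := sphase z (e_ i).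

Lemma dot_line (v w u : 'rV[R]_d) (t : R) :
  dot v (w + t *: u) = dot v w + t * dot v u.
Proof.
rewrite /dot mulr_sumr -big_split /=; apply: eq_bigr => i _.
by rewrite !mxE; ring.
Qed.

Lemma dot_delta (v : 'rV[R]_d) j : dot v (delta_mx ord0 j) = v ord0 j.
Proof.
rewrite /dot (bigD1 j)//= mxE !eqxx mulr1 big1 ?addr0// => i ij.
by rewrite mxE eqxx (negbTE ij) mulr0.
Qed.

Lemma dot0 (v : 'rV[R]_d) : dot v 0 = 0.
Proof. by rewrite /dot big1// => i _; rewrite mxE mulr0. Qed.

Lemma sphase_line z w i (t : R) :
  sphase z (w + t *: e_ i) = sphase z w + freq i z * t.
Proof.
rewrite /freq /sphase /symplectic /= !dot_line; ring.
Qed.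

Lemma freq_inl j z : freq (inl j) z = 2 * pi * z.2 ord0 j.
Proof. by rewrite /freq /sphase /symplectic /= dot_delta dot0 subr0. Qed.

Lemma freq_inr j z : freq (inr j) z = - (2 * pi * z.1 ord0 j).
Proof. by rewrite /freq /sphase /symplectic /= dot_delta dot0 sub0r mulrN. Qed.

Lemma measurable_sphase : measurable_fun setT
  (fun p : phase R d * phase R d => sphase p.1 p.2).
Proof.
have m11 (i : 'I_d) := measurableT_comp (@measurable_phase1 R d i)
  (@measurable_fst _ _ (phase R d) (phase R d)).
have m12 (i : 'I_d) := measurableT_comp (@measurable_phase2 R d i)
  (@measurable_fst _ _ (phase R d) (phase R d)).
have m21 (i : 'I_d) := measurableT_comp (@measurable_phase1 R d i)
  (@measurable_snd _ _ (phase R d) (phase R d)).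
have m22 (i : 'I_d) := measurableT_comp (@measurable_phase2 R d i)
  (@measurable_snd _ _ (phase R d) (phase R d)).
apply: measurable_funM => //; apply: measurable_funB.
- by apply: measurable_sum => i; apply: measurable_funM; [exact: m12|exact: m21].
- by apply: measurable_sum => i; apply: measurable_funM; [exact: m11|exact: m22].
Qed.

Lemma measurable_sphase1 z : measurable_fun setT (sphase z).
Proof. exact: (measurableT_comp measurable_sphase (measurable_pair1 z)). Qed.

Lemma measurable_dot : measurable_fun setT (fun z : phase R d => dot z.1 z.2).
Proof.
apply: measurable_sum => i.
by apply: measurable_funM; [exact: measurable_phase1|exact: measurable_phase2].
Qed.

Lemma integrable_trig_mul (h : R -> R) z f : continuous h ->
  (forall x, `|h x| <= 1) -> rschwartz f ->
  pm.-integrable setT (EFin \o (fun w => h (sphase z w) * f w)).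
Proof.
move=> ch h1 sf; have [M M0 hM] := rschwartz_le sf.
apply: (@integrable_phase_le R d _ M).
  apply: measurable_funM; last exact: rschwartz_measurable.
  apply: (measurableT_comp (continuous_measurable_fun ch)).
  exact: measurable_sphase1.
move=> w; rewrite normrM (le_trans _ (hM w))// ler_piMl//.
Qed.

Definition cos_transform z f : R := \int[pm]_w (cos (sphase z w) * f w).
Definition sin_transform z f : R := \int[pm]_w (sin (sphase z w) * f w).

(* Abstracts the pairs (cos, -sin) and (sin, cos). *)
Lemma trig_transform_pderiv (h h' : R -> R) z i f :
  continuous h -> continuous h' ->
  (forall x, `|h x| <= 1) -> (forall x, `|h' x| <= 1) ->
  (forall c a x : R, is_derive x 1 (fun y : R => h (a + c * y)) (c * h' (a + c * x))) ->
  rschwartz f ->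
  \int[pm]_w (h (sphase z w) * pderiv i f w) =
  - (freq i z * \int[pm]_w (h' (sphase z w) * f w)).
Proof.
move=> ch ch' h1 h1' dh sf; have sdf := rschwartz_pderiv i sf.
have I1 := integrable_trig_mul z ch h1 sdf.
have I2 := integrable_trig_mul z ch' h1' sf.
have I3 := integrableZ_real (freq i z) measurableT I2.
have [M M0 hM] := rschwartz_le sf; have [M' M0' hM'] := rschwartz_le sdf.
(* [G] is the derivative along the [i]-th axis of [h (sphase z w) * f w], which vanishes at both
   ends of each line; so its integral is 0. *)
pose G w := h (sphase z w) * pderiv i f w + freq i z * (h' (sphase z w) * f w).
have GI : pm.-integrable setT (EFin \o G).
  exact: (integrableD measurableT I1 I3).
suff : \int[pm]_w G w = 0.
  rewrite RintegralD// RintegralZl// => /eqP; rewrite addr_eq0 => /eqP ->.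
  by [].
apply: (Rintegral_phase_lines (i := i)) => // w.
pose F (t : R) := h (sphase z w + freq i z * t) * f (w + t *: e_ i).
pose x0 := phase_coord i w.
(* On the line the Cauchy factor is centred at [- x0]; [cauchy_fun_shift] recentres it at 0 at the
   cost of a constant depending on [w]. *)
have bnd g K (t : R) : 0 <= K -> (forall u, `|g u| <= K * phase_prod (@cauchy_fun R) u) ->
    `|g (w + t *: e_ i)| <= K * (2 * (1 + x0 ^+ 2)) * cauchy_fun t.
  move=> K0 hK; rewrite (le_trans (hK _))// -mulrA ler_wpM2l//.
  rewrite (le_trans (phase_prod_le_coord i _))// phase_coord_basis.
  exact: cauchy_fun_shift.
have dline g (t : R) : rschwartz g ->
    is_derive t 1 (fun u : R => g (w + u *: e_ i)) (pderiv i g (w + t *: e_ i)).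
  by move=> [sg _]; apply: is_derive_line; exact: (sg [::]).
have cline g : rschwartz g -> continuous (fun u : R => g (w + u *: e_ i)).
  by move=> sg t; exact: is_derive1_continuous (dline g t sg).
have csp (k : R -> R) : continuous k ->
    continuous (fun t : R => k (sphase z w + freq i z * t)).
  move=> ck t; apply: (@continuous_comp _ _ _ (fun t : R => sphase z w + freq i z * t) k).
    by apply: cvgD; [exact: cvg_cst|apply: cvgMr; exact: cvg_id].
  exact: ck.
have dF (t : R) : is_derive t 1 F (G (w + t *: e_ i)).
  have d1 := dh (freq i z) (sphase z w) t; have d2 := dline f t sf.
  have := is_deriveM d1 d2; rewrite /G sphase_line /GRing.scale /=.
  by move=> h2; apply: is_derive_eq h2 _; ring.
have cG : continuous (fun t : R => G (w + t *: e_ i)).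
  rewrite (_ : (fun t : R => _) = (fun t : R =>
    h (sphase z w + freq i z * t) * pderiv i f (w + t *: e_ i) +
    freq i z * (h' (sphase z w + freq i z * t) * f (w + t *: e_ i)))); last first.
    by apply/funext => t; rewrite /G sphase_line.
  move=> t; apply: cvgD.
    by apply: cvgM; [exact: csp|exact: cline].
  by apply: cvgMr; apply: cvgM; [exact: csp|exact: cline].
have FI : mu.-integrable setT (EFin \o (fun t : R => G (w + t *: e_ i))).
  have := integrableZ_real ((M' + `|freq i z| * M) * (2 * (1 + x0 ^+ 2)))
    measurableT (@integrable_cauchy_fun R).
  apply: le_integrable => //.
    by apply/measurable_EFinP; exact: continuous_measurable_fun.
  move=> t _; rewrite lee_fin; apply: le_trans (ler_norm _).
  rewrite (le_trans (ler_normD _ _))// -[leRHS]mulrA [leRHS]mulrDl lerD//.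
    rewrite normrM [leRHS]mulrA (le_trans _ (bnd _ _ t M0' hM'))//.
    by rewrite ler_piMl.
  rewrite normrM -[leRHS]mulrA ler_wpM2l// normrM [leRHS]mulrA.
  by rewrite (le_trans _ (bnd _ _ t M0 hM))// ler_piMl.
have FN (t : R) : `|F t| <= M * (2 * (1 + x0 ^+ 2)) * cauchy_fun t.
  by rewrite normrM (le_trans _ (bnd _ _ t M0 hM))// ler_piMl.
rewrite (@Rintegral_FTCT R _ F 0 0)//.
- by rewrite subr0.
- exact: cauchy_bound_cvg0 (fun n => FN n.+1%:R).
- apply: cauchy_bound_cvg0 => n; apply: (le_trans (FN _)).
  by rewrite /cauchy_fun sqrrN.
Qed.

Lemma is_derive_affine (a c x : R) : is_derive x 1 (fun y => a + c * y) c.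
Proof.
by have := is_deriveD (is_derive_cst a x 1) (is_derive_lin c x); rewrite add0r.
Qed.

Lemma cos_transform_pderiv z i f : rschwartz f ->
  cos_transform z (pderiv i f) = freq i z * sin_transform z f.
Proof.
move=> sf; have dh (c a x : R) :
    is_derive x 1 (fun y => cos (a + c * y)) (c * - sin (a + c * x)).
  rewrite mulrC.
  exact: (is_derive1_comp (is_derive_cos _) (is_derive_affine a c x)).
have ch : continuous (fun x : R => - sin x).
  by move=> x; apply: cvgN; exact: continuous_sin.
have h1 (x : R) : `|- sin x| <= 1 by rewrite normrN; exact: sin_max.
rewrite /cos_transform.
rewrite (trig_transform_pderiv z i (@continuous_cos R) ch (@cos_max R) h1 dh sf).
rewrite -mulrN; congr (_ * _); rewrite -mulN1r -RintegralZl//; last first.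
  have := integrable_trig_mul z ch h1 sf; exact.
by apply: eq_Rintegral => w _; rewrite mulN1r mulNr opprK.
Qed.

Lemma sin_transform_pderiv z i f : rschwartz f ->
  sin_transform z (pderiv i f) = - (freq i z * cos_transform z f).
Proof.
move=> sf; have dh (c a x : R) :
    is_derive x 1 (fun y => sin (a + c * y)) (c * cos (a + c * x)).
  rewrite mulrC.
  exact: (is_derive1_comp (is_derive_sin _) (is_derive_affine a c x)).
rewrite /sin_transform.
by rewrite (trig_transform_pderiv z i (@continuous_sin R) (@continuous_cos R)
  (@sin_max R) (@cos_max R) dh sf).
Qed.

(** Two integrations by parts exchange sine and cosine twice and produce [- freq^2], so [1 - D_i^2]
    becomes multiplication by [1 + freq^2], a factor one can divide by everywhere. *)
Lemma transform_weight z i f : rschwartz f ->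
  let g := fun w => f w - pderiv i (pderiv i f) w in
  cos_transform z g = (1 + freq i z ^+ 2) * cos_transform z f /\
  sin_transform z g = (1 + freq i z ^+ 2) * sin_transform z f.
Proof.
move=> sf g; have s1 := rschwartz_pderiv i sf; have s2 := rschwartz_pderiv i s1.
have C h : rschwartz h ->
    pm.-integrable setT (EFin \o (fun w => cos (sphase z w) * h w)).
  by move=> sh; apply: integrable_trig_mul => //;
    [exact: continuous_cos|exact: cos_max].
have S h : rschwartz h ->
    pm.-integrable setT (EFin \o (fun w => sin (sphase z w) * h w)).
  by move=> sh; apply: integrable_trig_mul => //;
    [exact: continuous_sin|exact: sin_max].
split.
- have -> : cos_transform z g =
      cos_transform z f - cos_transform z (pderiv i (pderiv i f)).
    rewrite /cos_transform -RintegralB; [|by []|exact: C|exact: C].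
    by apply: eq_Rintegral => w _; rewrite mulrBr.
  by rewrite cos_transform_pderiv// sin_transform_pderiv//; ring.
- have -> : sin_transform z g =
      sin_transform z f - sin_transform z (pderiv i (pderiv i f)).
    rewrite /sin_transform -RintegralB; [|by []|exact: S|exact: S].
    by apply: eq_Rintegral => w _; rewrite mulrBr.
  by rewrite sin_transform_pderiv// cos_transform_pderiv//; ring.
Qed.

Lemma transform_weights (r : seq ('I_d + 'I_d)) f : rschwartz f ->
  exists2 g, rschwartz g & forall z,
    cos_transform z g = (\prod_(i <- r) (1 + freq i z ^+ 2)) * cos_transform z f /\
    sin_transform z g = (\prod_(i <- r) (1 + freq i z ^+ 2)) * sin_transform z f.
Proof.
move=> sf; elim: r => [|i r [g sg hg]].
  by exists f => // z; rewrite big_nil !mul1r.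
exists (fun w => g w - pderiv i (pderiv i g) w).
  by apply: rschwartzB => //; do 2 apply: rschwartz_pderiv.
move=> z; have [-> ->] := transform_weight z i sg; have [-> ->] := hg z.
by rewrite big_cons !mulrA.
Qed.

(** Applying [1 - D_i^2] once per coordinate gives a Schwartz [g] whose transforms are bounded by
    its [L^1] norm [K]; dividing by the weights leaves a product of Cauchy factors. *)
Lemma transform_le f : rschwartz f -> exists2 K, 0 <= K & forall z,
  `|cos_transform z f| <= K * phase_prod (@cauchy_fun R) z /\
  `|sin_transform z f| <= K * phase_prod (@cauchy_fun R) z.
Proof.
move=> sf.
(* The symplectic form crosses the variables: [freq (inr j) z] involves [z.1] and [freq (inl j) z]
   involves [z.2]. Listing [inr] first matches the order of factors in [phase_prod]. *)
pose r : seq ('I_d + 'I_d) := map inr (index_enum 'I_d) ++ map inl (index_enum 'I_d).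
have [g sg hg] := transform_weights r sf.
have gi := rschwartz_integrable sg.
pose K := \int[pm]_w `|g w|.
exists K; first exact: Rintegral_ge0.
have hK (h : R -> R) z : continuous h -> (forall x, `|h x| <= 1) ->
    `|\int[pm]_w (h (sphase z w) * g w)| <= K.
  move=> ch h1; have hi := integrable_trig_mul z ch h1 sg.
  apply: (le_trans (le_normr_Rintegral _ hi)) => //.
  apply: le_Rintegral => //; try exact: integrable_norm.
  by move=> w _; rewrite normrM ler_piMl.
have p (x y : R) : `|y| <= `|x| -> 1 <= (1 + x ^+ 2) * cauchy_fun y.
  move=> xy; rewrite /cauchy_fun ler_pdivlMr ?mul1r; last first.
    by rewrite ltr_pwDl// sqr_ge0.
  by rewrite lerD2l -[leLHS]real_normK ?num_real// -[leRHS]real_normK ?num_real//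
    ler_pXn2r ?nnegrE.
have pi1 : (1 : R) <= 2 * pi.
  by have := @pi_ge2 R; move: (pi : R) => q; lra.
have hp z : 1 <= (\prod_(i <- r) (1 + freq i z ^+ 2)) * phase_prod (@cauchy_fun R) z.
  rewrite /r big_cat !big_map /= /phase_prod mulrACA.
  rewrite -[leLHS]mulr1 ler_pM// -big_split /=.
  - apply: (@le_trans _ _ (\prod_(i < d) 1)); first by rewrite big1_eq.
    apply: ler_prod => i _; rewrite ler01/= p// freq_inr normrN !normrM.
    by rewrite -normrM ler_peMl// ger0_norm ?(le_trans _ pi1).
  - apply: (@le_trans _ _ (\prod_(i < d) 1)); first by rewrite big1_eq.
    apply: ler_prod => i _; rewrite ler01/= p// freq_inl !normrM.
    by rewrite -normrM ler_peMl// ger0_norm ?(le_trans _ pi1).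
have fin (x y W : R) : 0 <= W -> 1 <= x * W -> `|x * y| <= K -> `|y| <= K * W.
  move=> W0 xW xK.
  apply: (le_trans (ler_peMl (normr_ge0 y) xW)).
  rewrite mulrAC ler_wpM2r// (le_trans _ xK)// normrM ler_wpM2r// ler_norm.
  by [].
move=> z; have [hc hs] := hg z; split.
- apply: fin (phase_prod_ge0 z) (hp z) _; rewrite -hc.
  by apply: hK; [exact: continuous_cos|exact: cos_max].
- apply: fin (phase_prod_ge0 z) (hp z) _; rewrite -hs.
  by apply: hK; [exact: continuous_sin|exact: sin_max].
Qed.

(* [phase_fourier phi z] is the symplectic Fourier transform at [- z]. *)
Definition phase_fourier (phi : phase R d -> R[i]) z : R[i] :=
  cintegral pm setT (fun w => expi (sphase z w) * phi w).

Lemma symplectic_fourierN phi z :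
  symplectic_fourier phi (- z) = phase_fourier phi z.
Proof.
apply: eq_cintegral => w _; congr (expi _ * _).
have dotN (v u : 'rV[R]_d) : dot (- v) u = - dot v u.
  by rewrite /dot -sumrN; apply: eq_bigr => i _; rewrite mxE mulNr.
rewrite /sphase /symplectic /= !dotN; ring.
Qed.

Lemma schwartz_cmeasurable (phi : phase R d -> R[i]) :
  schwartz phi -> cmeasurable phi.
Proof.
by move=> s; split; apply: rschwartz_measurable; [exact: schwartz_Re|
  exact: schwartz_Im].
Qed.

Lemma schwartz_cintegrable (phi : phase R d -> R[i]) :
  schwartz phi -> cintegrable pm setT phi.
Proof.
by move=> s; split; apply: rschwartz_integrable; [exact: schwartz_Re|
  exact: schwartz_Im].
Qed.

Lemma schwartz_le (phi : phase R d -> R[i]) : schwartz phi ->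
  exists2 M, 0 <= M & forall z, normc (phi z) <= M * phase_prod (@cauchy_fun R) z.
Proof.
move=> s; have [M M0 hM] := rschwartz_le (schwartz_Re s).
have [M' M0' hM'] := rschwartz_le (schwartz_Im s).
exists (M + M'); first exact: addr_ge0.
by move=> z; rewrite (le_trans (normc_le _))// mulrDl lerD.
Qed.

Lemma phase_fourier_le (phi : phase R d -> R[i]) : schwartz phi ->
  exists2 K, 0 <= K & forall z,
    normc (phase_fourier phi z) <= K * phase_prod (@cauchy_fun R) z.
Proof.
move=> s; have sRe := schwartz_Re s; have sIm := schwartz_Im s.
have [K K0 hK] := transform_le sRe; have [K' K0' hK'] := transform_le sIm.
exists (K + K' + (K' + K)); first by rewrite !addr_ge0.
have C h z : rschwartz h ->
    pm.-integrable setT (EFin \o (fun w => cos (sphase z w) * h w)).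
  by move=> sh; apply: integrable_trig_mul => //;
    [exact: continuous_cos|exact: cos_max].
have S h z : rschwartz h ->
    pm.-integrable setT (EFin \o (fun w => sin (sphase z w) * h w)).
  by move=> sh; apply: integrable_trig_mul => //;
    [exact: continuous_sin|exact: sin_max].
move=> z; rewrite (le_trans (normc_le _))// mulrDl lerD// mulrDl.
- have -> : complex.Re (phase_fourier phi z) =
      cos_transform z (fun w => complex.Re (phi w)) -
      sin_transform z (fun w => complex.Im (phi w)).
    rewrite -RintegralB; [|by []|exact: C|exact: S].
    by apply: eq_Rintegral => w _; rewrite Re_mulc.
  by rewrite (le_trans (ler_normB _ _))// lerD//; [case: (hK z)|case: (hK' z)].
- have -> : complex.Im (phase_fourier phi z) =
      cos_transform z (fun w => complex.Im (phi w)) +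
      sin_transform z (fun w => complex.Re (phi w)).
    rewrite -RintegralD; [|by []|exact: C|exact: S].
    by apply: eq_Rintegral => w _; rewrite Im_mulc.
  by rewrite (le_trans (ler_normD _ _))// lerD//; [case: (hK' z)|case: (hK z)].
Qed.

Lemma cmeasurable_phase_fourier (phi : phase R d -> R[i]) : schwartz phi ->
  cmeasurable (phase_fourier phi).
Proof.
move=> s; have h : cmeasurable
    (fun p : phase R d * phase R d => expi (sphase p.1 p.2) * phi p.2).
  apply: cmeasurableM; last first.
    exact: (cmeasurable_comp measurable_snd (schwartz_cmeasurable s)).
  by apply: cmeasurable_expi; exact: measurable_sphase.
exact: (cmeasurable_cintegral
  (product_sfm (lebesgue_rV R d) (lebesgue_rV R d)) h).
Qed.

End fourier_decay.

(** * Chirps and the sinc kernel *)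

Section chirp_identity.
Context (R : realType) (d : nat).
Local Notation pm := (lebesgue_rV R d \x lebesgue_rV R d)%E.
Local Notation pms := (product_sfm (lebesgue_rV R d) (lebesgue_rV R d)).
Variable s : R.
Hypothesis s0 : s != 0.
Implicit Types (z w : phase R d).

Definition chirp z : R[i] := expi (- (2 * pi * dot z.1 z.2 / s)).

Lemma cmeasurable_chirp : cmeasurable chirp.
Proof.
apply: cmeasurable_expi; apply: measurable_funN; apply: measurable_funM => //.
by apply: measurable_funM => //; exact: measurable_dot.
Qed.

Let reg e z := phase_prod (laplace_fun e) z.

Let measurable_reg e : measurable_fun setT (reg e).
Proof.
apply: measurable_funM; apply: measurable_prod => i _.
- exact: (measurableT_comp (measurable_laplace_fun e) (measurable_phase1 i)).
- exact: (measurableT_comp (measurable_laplace_fun e) (measurable_phase2 i)).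
Qed.

Let reg_ge0 e z : 0 <= reg e z.
Proof. by rewrite mulr_ge0// prodr_ge0// => i _; exact/ltW/laplace_fun_gt0. Qed.

Let reg_le1 e z : 0 < e -> reg e z <= 1.
Proof.
move=> e0; have h (v : 'rV[R]_d) : 0 <= \prod_(i < d) laplace_fun e (v ord0 i) <= 1.
  rewrite prodr_ge0 ?prodr_ile1//.
    by move=> i _; rewrite laplace_fun_le1// ltW// laplace_fun_gt0.
  by move=> i _; exact/ltW/laplace_fun_gt0.
by rewrite mulr_ile1//; [case/andP: (h z.1)|case/andP: (h z.2)|
  case/andP: (h z.1)|case/andP: (h z.2)].
Qed.

Let integrable_reg e : 0 < e -> pm.-integrable setT (EFin \o reg e).
Proof.
move=> e0; apply: integrable_phase_prod; first exact: measurable_laplace_fun.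
exact: integrable_laplace_fun.
Qed.

(** The phase is a sum over coordinate pairs and the damping a product, which reduces dimension [d]
    to dimension 1. *)
Let chirp_prod e z w : chirp z * (reg e z)%:C * expi (sphase z w) =
  \prod_(i < d) reg_chirp s e (w.1 ord0 i) (w.2 ord0 i) (z.1 ord0 i) (z.2 ord0 i).
Proof.
rewrite /reg_chirp big_split /= -expi_sum -rmorph_prod big_split /=.
rewrite mulrAC -expiD; congr (expi _ * _).
rewrite -mulr_sumr big_split /= sumrN -mulr_suml sumrB.
rewrite /sphase /symplectic -/(dot z.1 z.2) -/(dot z.1 w.2) -/(dot z.2 w.1).
by field.
Qed.

Let cintegrable_reg_chirp_prod e w : 0 < e ->
  cintegrable pm setT (fun z => chirp z * (reg e z)%:C * expi (sphase z w)).
Proof.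
move=> e0; apply: (le_cintegrable measurableT (h := reg e)).
- apply: cmeasurableM.
    apply: cmeasurableM; first exact: cmeasurable_chirp.
    by apply: cmeasurable_real; exact: measurable_reg.
  apply: cmeasurable_expi.
  exact: (measurableT_comp (@measurable_sphase R d) (measurable_pair2 w)).
- exact: integrable_reg.
- move=> z _; rewrite !ComplexField.Normc.normcM !normc_expi mul1r mulr1 normcR.
  by rewrite ger0_norm ?reg_ge0.
Qed.

(** At fixed [z.1] the integral over [z.2] factors into terms [reg_chirp1]; the outer integral over
    [z.1] then factors into the kernels. *)
Let cintegral_reg_chirp_prod e w : 0 < e ->
  cintegral pm setT (fun z => chirp z * (reg e z)%:C * expi (sphase z w)) =
  \prod_(i < d) chirp_kernel s e (w.1 ord0 i) (w.2 ord0 i).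
Proof.
move=> e0; rewrite -(cfubini1 (cintegrable_reg_chirp_prod w e0)).
have h1 i := cmeasurable_reg_chirp1 s0 (w.1 ord0 i) (w.2 ord0 i) e0.
have h2 i := cintegrable_reg_chirp1 s0 (w.1 ord0 i) (w.2 ord0 i) e0.
have [_ <-] := cintegral_rV_prod h1 h2.
apply: eq_cintegral => x _.
under eq_cintegral => v _ do rewrite chirp_prod /=.
have m1 i := cmeasurable_comp (measurable_pair1 (x ord0 i))
  (cmeasurable_reg_chirp s e (w.1 ord0 i) (w.2 ord0 i)).
have m2 i := cintegrable_reg_chirp s (w.1 ord0 i) (w.2 ord0 i) (x ord0 i) e0.
have [_ ->] := cintegral_rV_prod m1 m2.
by apply: eq_bigr => i _; rewrite cintegral_reg_chirp.
Qed.

Variable phi : phase R d -> R[i].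
Hypothesis sphi : schwartz phi.

Let kern e w := (\prod_(i < d) chirp_kernel s e (w.1 ord0 i) (w.2 ord0 i)) * phi w.

Let integrand e (p : phase R d * phase R d) :=
  (chirp p.1 * (reg e p.1)%:C * expi (sphase p.1 p.2)) * phi p.2.

Let cmeasurable_integrand e : cmeasurable (integrand e).
Proof.
apply: cmeasurableM; last first.
  exact: (cmeasurable_comp measurable_snd (schwartz_cmeasurable sphi)).
apply: cmeasurableM; last by apply: cmeasurable_expi; exact: measurable_sphase.
apply: cmeasurableM.
  exact: (cmeasurable_comp measurable_fst cmeasurable_chirp).
apply: cmeasurable_real.
exact: (measurableT_comp (measurable_reg e) measurable_fst).
Qed.

Let cintegral_integrand1 e w : 0 < e ->
  cintegral pms setT (fun z => integrand e (z, w)) = kern e w.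
Proof.
move=> e0; rewrite /kern -cintegral_reg_chirp_prod// mulrC.
rewrite -(cintegralZl _ _ (cintegrable_reg_chirp_prod w e0))//.
by apply: eq_cintegral => z _; rewrite mulrC.
Qed.

Let cintegrable_fourier_integrand z :
  cintegrable pm setT (fun w => expi (sphase z w) * phi w).
Proof.
have mphi := schwartz_cmeasurable sphi.
apply: (le_cintegrable measurableT (h := fun w => normc (phi w))).
- apply: cmeasurableM => //; apply: cmeasurable_expi.
  exact: measurable_sphase1.
- exact: (cintegrable_normc measurableT mphi (schwartz_cintegrable sphi)).
- by move=> w _; rewrite ComplexField.Normc.normcM normc_expi mul1r.
Qed.

Let cintegral_integrand2 e z :
  cintegral pms setT (fun w => integrand e (z, w)) =
  chirp z * (reg e z)%:C * phase_fourier phi z.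
Proof.
rewrite -(cintegralZl _ _ (cintegrable_fourier_integrand z))//.
by apply: eq_cintegral => w _; rewrite mulrA.
Qed.

Let cintegrable_integrand e : 0 < e ->
  cintegrable (pms \x pms)%E setT (integrand e).
Proof.
move=> e0; apply: (le_cintegrable measurableT
    (h := fun p : phase R d * phase R d => reg e p.1 * normc (phi p.2))).
- exact: cmeasurable_integrand.
- apply: (integrable_prod (m1 := pms) (m2 := pms) (f := reg e)
    (g := fun w => normc (phi w))); first exact: integrable_reg.
  exact: (cintegrable_normc measurableT (schwartz_cmeasurable sphi)
    (schwartz_cintegrable sphi)).
- move=> p _; rewrite !ComplexField.Normc.normcM !normc_expi mul1r mulr1 normcR.
  by rewrite ger0_norm.
Qed.

(** Duality for the damped chirp: the damping makes the double integral absolutely convergent in the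
    first variable, [phi] in the second. *)
Let swap_integrals e : 0 < e ->
  cintegral pm setT (fun z => chirp z * (reg e z)%:C * phase_fourier phi z) =
  cintegral pm setT (kern e).
Proof.
move=> e0; have := cfubini (cintegrable_integrand e0).
under eq_cintegral => z _ do rewrite cintegral_integrand2.
move=> ->; apply: eq_cintegral => w _; exact: cintegral_integrand1.
Qed.

(** Measurability is read off the representation of the kernel as an integral depending on a
    parameter. *)
Let cmeasurable_kern e : 0 < e -> cmeasurable (kern e).
Proof.
move=> e0; have -> : kern e = (fun w => cintegral pms setT
    (fun z => integrand e (z, w))).
  by apply/funext => w; rewrite cintegral_integrand1.
apply: (cmeasurable_cintegral pms
  (f := fun p : phase R d * phase R d => integrand e (p.2, p.1))).
apply: (cmeasurable_comp _ (cmeasurable_integrand e)).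
by apply/measurable_fun_pair => //=.
Qed.

(** Both sides of [swap_integrals] are followed as the damping is removed. The left one is dominated
    through the decay of [phase_fourier phi], the right one by [(2 |s|)^d |phi|]. *)
Lemma chirp_phase_fourier :
  cintegral pm setT (fun z => chirp z * phase_fourier phi z) =
  (`|s| ^+ d)%:C * oscillatory phi s.
Proof.
have h0 n : 0 < harmonic n :> R by rewrite /harmonic invr_gt0 ltr0n.
have [K K0 hK] := phase_fourier_le sphi.
have mF := cmeasurable_phase_fourier sphi.
have mphi := schwartz_cmeasurable sphi.
have c1 : ccvg (fun n => cintegral pm setT
    (fun z => chirp z * (reg (harmonic n) z)%:C * phase_fourier phi z))
    (cintegral pm setT (fun z => chirp z * phase_fourier phi z)).
  have [|||||_ h1 h2] := @cdominated_cvg R _ (phase R d) pm setT measurableT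
    (fun n z => chirp z * (reg (harmonic n) z)%:C * phase_fourier phi z)
    (fun z => chirp z * phase_fourier phi z)
    (fun z => K * phase_prod (@cauchy_fun R) z).
  - move=> n; apply: cmeasurableM => //.
    apply: cmeasurableM; first exact: cmeasurable_chirp.
    by apply: cmeasurable_real; exact: measurable_reg.
  - by apply: cmeasurableM => //; exact: cmeasurable_chirp.
  - apply: nearW => z _; apply: ccvgM; last exact: ccvg_cst.
    rewrite -[X in ccvg _ X]mulr1; apply: ccvgM; first exact: ccvg_cst.
    apply: ccvg_real.
    have lap (x : R) : laplace_fun (harmonic n) x @[n --> \oo] --> (1 : R).
      rewrite /laplace_fun -expR0; apply: continuous_cvg; first exact: continuous_expR.
      rewrite -oppr0; apply: cvgN; rewrite -(mul0r `|x|).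
      by apply: cvgMl; exact: cvg_harmonic.
    have lapv (v : 'rV[R]_d) :
        \prod_(i < d) laplace_fun (harmonic n) (v ord0 i) @[n --> \oo] --> (1 : R).
      rewrite -[X in _ --> X](@big1_eq R 1 *%R _ (index_enum 'I_d) xpredT).
      elim: (index_enum _) => [|i r ih].
        by rewrite big_nil; under eq_fun do rewrite big_nil; exact: cvg_cst.
      by rewrite big_cons; under eq_fun do rewrite big_cons; exact: cvgM.
    by rewrite -[X in _ --> X]mulr1; apply: cvgM; exact: lapv.
  - exact: (integrableZ_real K measurableT (@integrable_phase_cauchy R d)).
  - apply: nearW => z _ n; rewrite !ComplexField.Normc.normcM normc_expi mul1r normcR.
    rewrite ger0_norm// (le_trans _ (hK z))// ler_piMl//; first exact: normc_ge0.
    exact: reg_le1.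
  by split.
have c2 : ccvg (fun n => cintegral pm setT (kern (harmonic n)))
    (cintegral pm setT (fun w => (`|s| ^+ d)%:C *
      (expi (- (2 * pi * s * dot w.1 w.2)) * phi w))).
  have [|||||_ h1 h2] := @cdominated_cvg R _ (phase R d) pm setT measurableT
    (fun n => kern (harmonic n))
    (fun w => (`|s| ^+ d)%:C * (expi (- (2 * pi * s * dot w.1 w.2)) * phi w))
    (fun w => (2 * `|s|) ^+ d * normc (phi w)).
  - by move=> n; exact: cmeasurable_kern.
  - apply: cmeasurableM; first by apply: cmeasurable_real; exact: measurable_cst.
    apply: cmeasurableM => //; apply: cmeasurable_expi; apply: measurable_funN.
    by apply: measurable_funM => //; exact: measurable_dot.
  - apply: nearW => w _.
    have -> : (`|s| ^+ d)%:C * (expi (- (2 * pi * s * dot w.1 w.2)) * phi w) =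
      (\prod_(i < d) (`|s|%:C *
        expi (- (2 * pi * s * (w.1 ord0 i * w.2 ord0 i))))) * phi w.
      rewrite mulrA big_split /= prodr_const card_ord rmorphXn -expi_sum.
      by rewrite sumrN -mulr_sumr.
    apply: ccvgM; last exact: ccvg_cst.
    by apply: ccvg_prod => i; exact: ccvg_chirp_kernel.
  - apply: integrableZ_real => //.
    exact: (cintegrable_normc measurableT mphi (schwartz_cintegrable sphi)).
  - apply: nearW => w _ n; rewrite ComplexField.Normc.normcM ler_wpM2r ?normc_ge0//.
    rewrite normc_prod -[X in _ ^+ X]card_ord -prodr_const.
    apply: ler_prod => i _; rewrite normc_ge0/=.
    exact: normc_chirp_kernel.
  by split.
have -> : (`|s| ^+ d)%:C * oscillatory phi s =
    cintegral pm setT (fun w => (`|s| ^+ d)%:C *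
      (expi (- (2 * pi * s * dot w.1 w.2)) * phi w)).
  rewrite cintegralZl//.
  apply: (le_cintegrable measurableT (h := fun w => normc (phi w))).
  - apply: cmeasurableM => //; apply: cmeasurable_expi; apply: measurable_funN.
    by apply: measurable_funM => //; exact: measurable_dot.
  - exact: (cintegrable_normc measurableT mphi (schwartz_cintegrable sphi)).
  - by move=> w _; rewrite ComplexField.Normc.normcM normc_expi mul1r.
apply: (ccvg_unique c1).
have e : (fun n => cintegral pm setT (fun z =>
    chirp z * (reg (harmonic n) z)%:C * phase_fourier phi z)) =
    (fun n => cintegral pm setT (kern (harmonic n))).
  by apply/funext => n; exact: swap_integrals.
by rewrite e.
Qed.

End chirp_identity.

(** * The sinc function as an integral over [|s| >= 2] *)

Section sinc_representation.
Context (R : realType).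
Local Notation mu := (@lebesgue_measure R).
Local Notation tail := [set s : R | 2 <= `|s|].
Implicit Types (s t : R).

Lemma measurable_inv : measurable_fun setT (@GRing.inv R).
Proof.
rewrite -(setvU [set (0 : R)]); apply/measurable_funU => //.
  exact: measurableC.
split; last exact: measurable_fun_set1.
apply: open_continuous_measurable_fun.
  exact/closed_openC/closed_eq.
by move=> x; rewrite inE /= => /eqP x0; exact: inv_continuous.
Qed.

Lemma tailE : tail = `]-oo, (-2)] `|` `[2, +oo[.
Proof.
apply/seteqP; split => x /=; rewrite !in_itv/= andbT ler_normr.
  by case/orP => h; [right|left]; rewrite // lerNr.
by case=> h; apply/orP; [right|left]; rewrite // lerNr.
Qed.

Lemma measurable_tail : measurable tail.
Proof. by rewrite tailE; exact: measurableU. Qed.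

Lemma tailN s : tail (- s) <-> tail s.
Proof. by rewrite /= normrN. Qed.

Lemma tail_pos : tail `&` `[0, +oo[ = `[2, +oo[%classic.
Proof.
apply/seteqP; split => x /=; rewrite !in_itv/= !andbT.
  by case=> h x0; rewrite -(ger0_norm x0).
by move=> h; have x0 := le_trans (ler0n R 2) h; rewrite ger0_norm.
Qed.

Lemma tail_neq0 s : tail s -> s != 0.
Proof. by rewrite /= -normr_gt0; apply: lt_le_trans. Qed.

Lemma measurable_inv_sqr : measurable_fun setT (fun s => `|s| ^- 2).
Proof.
apply: (measurableT_comp measurable_inv).
by apply: measurable_funX; exact: normr_measurable.
Qed.

Lemma inv_sqr_le s : tail s -> `|s| ^- 2 <= 2 * cauchy_fun s.
Proof.
move=> ts; have s0 := tail_neq0 ts.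
have h : 1 <= s ^+ 2.
  rewrite -[leRHS]real_normK ?num_real//; apply: exprn_ege1.
  by apply: le_trans ts; rewrite ler1n.
rewrite real_normK ?num_real// /cauchy_fun ler_pdivlMr; last first.
  by rewrite ltr_pwDl// sqr_ge0.
rewrite mulrC ler_pdivrMr; last by rewrite exprn_even_gt0.
lra.
Qed.

Lemma integrable_tail : mu.-integrable tail (EFin \o (fun s => `|s| ^- 2)).
Proof.
have mt := measurable_tail.
have h : mu.-integrable tail (EFin \o (fun s => 2 * @cauchy_fun R s)).
  apply: integrableZ_real => //.
  by apply: integrableS (@integrable_cauchy_fun R).
apply: (le_integrable _ _ _ h) => //.
  by apply/measurable_EFinP; apply: measurable_funS measurable_inv_sqr.
move=> s ts; rewrite lee_fin ger0_norm ?invr_ge0 ?exprn_ge0//.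
by rewrite (le_trans (inv_sqr_le ts))// ler_norm.
Qed.

Definition sinc_integrand t s : R[i] :=
  (`|s| ^- 2)%:C * expi (- (2 * pi * t / s)).

Lemma cmeasurable_sinc_integrand d (T : measurableType d) (h : T -> R)
    (k : T -> measurableTypeR R) :
  measurable_fun setT h -> measurable_fun setT k ->
  cmeasurable (fun x => sinc_integrand (h x) (k x)).
Proof.
move=> mh mk; apply: cmeasurableM.
  by apply: cmeasurable_real; exact: (measurableT_comp measurable_inv_sqr mk).
apply: cmeasurable_expi; apply: measurable_funN; apply: measurable_funM.
  exact: measurable_funM.
exact: (measurableT_comp measurable_inv mk).
Qed.

Lemma normc_sinc_integrand t s : normc (sinc_integrand t s) = `|s| ^- 2.
Proof.
by rewrite ComplexField.Normc.normcM normc_expi mulr1 normcR ger0_norm.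
Qed.

Lemma cintegrable_sinc t : cintegrable mu tail (sinc_integrand t).
Proof.
apply: (@le_cintegrable R _ (measurableTypeR R) mu tail measurable_tail _
  (fun s => `|s| ^- 2)).
- apply: (@cmeasurable_sinc_integrand _ (measurableTypeR R) (fun=> t) id) => //.
- exact: integrable_tail.
- by move=> s _; rewrite normc_sinc_integrand.
Qed.

Lemma is_derive_inv_lin (c x : R) : x != 0 ->
  is_derive x 1 (fun y => c * y^-1) (- (c * x ^- 2)).
Proof.
move=> x0; have h := is_deriveV (f := id) x0 (is_derive_id x (1 : R)).
have := is_deriveZ c h; rewrite /GRing.scale /= mulr1 mulrN.
exact.
Qed.

Lemma cvg_inv_shift : (2 + n.+1%:R : R)^-1 @[n --> \oo] --> (0 : R).
Proof.
apply: (squeeze_cvgr _ (cvg_cst 0) cvg_harmonic); apply: nearW => n.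
rewrite invr_ge0 addr_ge0//= /harmonic /= lef_pV2 ?posrE ?ltr0n//.
by rewrite lerDr.
Qed.

Lemma cintegral_sinc t : cintegral mu tail (sinc_integrand t) = (sinc t)%:C.
Proof.
have [i1 i2] := cintegrable_sinc t.
have xN (s : R) : - (2 * pi * t / - s) = - - (2 * pi * t / s).
  by rewrite invrN mulrN.
apply: complex_eqP => /=; last first.
  apply: (Rintegral_odd measurable_tail tailN i2) => s.
  by rewrite /sinc_integrand !Im_mulc /= normrN !mul0r !addr0 xN sinN mulrN.
rewrite (Rintegral_even measurable_tail tailN i1); last first.
  by move=> s; rewrite /sinc_integrand !Re_mulc /= normrN !mul0r !subr0 xN cosN.
rewrite tail_pos.
pose c := 2 * pi * t.
have pos (s : R) : 2 <= s -> 0 < s by apply: lt_le_trans.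
transitivity (2 * \int[mu]_(s in `[2, +oo[) (cos (c * s^-1) * s ^- 2)).
  congr (_ * _); apply: eq_Rintegral => s /set_mem /=.
  rewrite in_itv/= andbT => /pos s0.
  by rewrite /sinc_integrand ?Re_mulc /= mul0r subr0 cosN (gtr0_norm s0) mulrC.
have fi : mu.-integrable `[2, +oo[ (EFin \o (fun s => cos (c * s^-1) * s ^- 2)).
  have : mu.-integrable `[2, +oo[ (fun s => (complex.Re (sinc_integrand t s))%:E).
    apply: integrableS i1 => //; first exact: measurable_tail.
    by rewrite -tail_pos; exact: subIsetl.
  apply: eq_integrable => // s /set_mem /=; rewrite in_itv/= andbT => /pos s0.
  by rewrite /sinc_integrand ?Re_mulc /= mul0r subr0 cosN (gtr0_norm s0) mulrC.
have cf (s : R) : 2 <= s -> {for s, continuous (fun s : R => cos (c * s^-1) * s ^- 2)}.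
  move=> /pos s0; have sn0 : s != 0 by rewrite gt_eqF.
  have cinv : {for s, continuous (@GRing.inv R)} by exact: inv_continuous.
  apply: cvgM.
    apply: continuous_cvg; first exact: continuous_cos.
    by apply: cvgMr; exact: cinv.
  apply: cvgV; first by rewrite expf_neq0.
  exact: exprn_continuous.
(* At [t = 0] the general primitive would divide by [c = 0]; the integrand is then [s^-2]. *)
have [t0|t0] := eqVneq t 0.
  pose F (s : R) := - 1 * s^-1.
  have dF (s : R) : 2 <= s -> is_derive s 1 F (cos (c * s^-1) * s ^- 2).
    move=> /pos s0; have sn0 : s != 0 by rewrite gt_eqF.
    rewrite /c t0 mulr0 mul0r cos0 mul1r.
    by have := is_derive_inv_lin (-1) sn0; rewrite mulN1r opprK.
  rewrite (Rintegral_FTCy cf dF fi (l := 0)).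
    by rewrite /F t0 /sinc eqxx; field.
  rewrite -(mulr0 (-1)); apply: cvgMr; exact: cvg_inv_shift.
have pi0 := @pi_gt0 R.
have c0 : c != 0 by rewrite /c mulf_neq0// gt_eqF// mulr_gt0.
(* It vanishes at infinity, and [- 2 F(2) = 2 sin(pi t) / (2 pi t)] is [sinc t]; the bound 2 on
   [|s|] is what makes the argument [pi t]. *)
pose F (s : R) := - c^-1 * sin (c * s^-1).
have dF (s : R) : 2 <= s -> is_derive s 1 F (cos (c * s^-1) * s ^- 2).
  move=> /pos s0; have sn0 : s != 0 by rewrite gt_eqF.
  have h := is_derive1_comp (g := fun y : R => c * y^-1)
    (is_derive_sin (c * s^-1)) (is_derive_inv_lin c sn0).
  have := is_deriveZ (- c^-1) h; rewrite /GRing.scale /= => h2.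
  by apply: is_derive_eq h2 _; field; rewrite c0 sn0.
rewrite (Rintegral_FTCy cf dF fi (l := 0)).
  rewrite /F /sinc (negbTE t0) /c.
  have -> : 2 * pi * t * 2^-1 = pi * t by move: (pi : R) => p; field.
  by move: (sin _) => y; move: (pi : R) pi0 => p p0; field; rewrite t0 gt_eqF.
rewrite -(mulr0 (- c^-1)); apply: cvgMr; rewrite -sin0.
apply: continuous_cvg; first exact: continuous_sin.
by rewrite -(mulr0 c); apply: cvgMr; exact: cvg_inv_shift.
Qed.

End sinc_representation.

(** * Integration over [s] and the formula in every dimension *)

Section sinc_transform.
Context (R : realType) (d : nat).
Local Notation mu := (@lebesgue_measure R).
Local Notation pms := (product_sfm (lebesgue_rV R d) (lebesgue_rV R d)).
Local Notation tail := [set s : R | 2 <= `|s|].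
Variable phi : phase R d -> R[i].
Hypothesis sphi : schwartz phi.

Lemma cintegrable_fubini1 d1 d2 (T1 : measurableType d1) (T2 : measurableType d2)
    (m1 : {sigma_finite_measure set T1 -> \bar R})
    (m2 : {sigma_finite_measure set T2 -> \bar R}) (f : T1 * T2 -> R[i]) :
  cintegrable (m1 \x m2)%E setT f ->
  cintegrable m1 setT (fun x => cintegral m2 setT (fun y => f (x, y))).
Proof.
move=> [f1 f2]; split.
- exact: (integrable_Rfubini1 f1).
- exact: (integrable_Rfubini1 f2).
Qed.

Let F (p : measurableTypeR R * phase R d) : R[i] :=
  (\1_tail p.1)%:C * (sinc_integrand (dot p.2.1 p.2.2) p.1 * phase_fourier phi p.2).

Let cmeasurable_F : cmeasurable F.
Proof.
apply: cmeasurableM.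
  apply: cmeasurable_real.
  have m1 : measurable_fun setT (\1_tail : measurableTypeR R -> R).
    by apply: measurable_indic; exact: measurable_tail.
  exact: (measurableT_comp m1 measurable_fst).
apply: cmeasurableM.
  apply: (@cmeasurable_sinc_integrand R _ (measurableTypeR R * phase R d)%type
    (fun p => dot p.2.1 p.2.2) fst).
    exact: (measurableT_comp (@measurable_dot R d) measurable_snd).
  exact: measurable_fst.
exact: (cmeasurable_comp measurable_snd (cmeasurable_phase_fourier sphi)).
Qed.

(** The modulus is [|s|^-2] on the tail times that of [phase_fourier phi], both below Cauchy
    profiles whatever the dimension. *)
Let cintegrable_F : cintegrable (mu \x pms)%E setT F.
Proof.
have [K K0 hK] := phase_fourier_le sphi.
apply: (@le_cintegrable R _ (measurableTypeR R * phase R d)%type (mu \x pms)%E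
  setT measurableT _
  (fun p => (2 * cauchy_fun p.1) * (K * phase_prod (@cauchy_fun R) p.2))).
- exact: cmeasurable_F.
- apply: (integrable_prod (m1 := mu) (m2 := pms) (f := fun s => 2 * @cauchy_fun R s)
    (g := fun z => K * phase_prod (@cauchy_fun R) z)).
    exact: (integrableZ_real 2 measurableT (@integrable_cauchy_fun R)).
  exact: (integrableZ_real K measurableT (@integrable_phase_cauchy R d)).
move=> p _; rewrite /F indicE; case: (boolP (p.1 \in tail)) => [/set_mem tp|_].
  rewrite mul1r ComplexField.Normc.normcM normc_sinc_integrand ler_pM ?normc_ge0//.
  exact: inv_sqr_le.
rewrite mul0r ComplexField.Normc.normc0 mulr_ge0// mulr_ge0 ?phase_prod_ge0//.
exact/ltW/cauchy_fun_gt0.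
Qed.

Let integral1 z : cintegral mu setT (fun s => F (s, z)) =
  (sinc (dot z.1 z.2))%:C * phase_fourier phi z.
Proof.
rewrite -cintegral_sinc mulrC -(@cintegralZl R _ (measurableTypeR R) mu tail (@measurable_tail R)
  _ _ (cintegrable_sinc _)).
rewrite [RHS]cintegral_mkcond; apply: eq_cintegral => s _.
by rewrite /F /= [_ * phase_fourier _ _]mulrC.
Qed.

Let integral2 s : cintegral pms setT (fun z => F (s, z)) =
  (\1_tail s)%:C * ((weight d s)%:C * oscillatory phi s).
Proof.
have [K K0 hK] := phase_fourier_le sphi.
rewrite indicE; case: (boolP (s \in tail)) => [ts|ts]; last first.
  rewrite mul0r [LHS](_ : _ = cintegral pms setT (fun=> 0)).
    by apply: complex_eqP; rewrite /= /Rintegral integral0.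
  by apply: eq_cintegral => z _; rewrite /F /= indicE (negbTE ts) mul0r.
have s0 : s != 0 by apply: tail_neq0; exact: set_mem ts.
have -> : (weight d s)%:C * oscillatory phi s =
    (`|s| ^- 2)%:C * ((`|s| ^+ d)%:C * oscillatory phi s).
  rewrite mulrA -rmorphM; congr ((_)%:C * _).
  by rewrite /weight expfzDr ?normr_eq0// mulrC -exprnN.
rewrite mul1r -(chirp_phase_fourier s0 sphi) -cintegralZl//; last first.
  apply: (le_cintegrable measurableT (h := fun z => K * phase_prod (@cauchy_fun R) z)).
  - apply: cmeasurableM; first exact: cmeasurable_chirp.
    exact: cmeasurable_phase_fourier.
  - exact: (integrableZ_real K measurableT (@integrable_phase_cauchy R d)).
  - by move=> z _; rewrite ComplexField.Normc.normcM normc_expi mul1r.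
by apply: eq_cintegral => z _; rewrite /F /= indicE ts mul1r mulrA.
Qed.

(** No direct decay estimate of [oscillatory] in [s] is made: up to the indicator, this function is
    the partial integral of [F] over [z], hence integrable by Fubini. *)
Lemma cintegrable_fourier_weight :
  cintegrable mu tail (fun s => (weight d s)%:C * oscillatory phi s).
Proof.
apply/(@cintegrable_mkcond R _ (measurableTypeR R) mu tail (@measurable_tail R)).
have := cintegrable_fubini1 cintegrable_F.
have -> // : (fun s => cintegral pms setT (fun z => F (s, z))) =
  (fun s => (\1_tail s)%:C * ((weight d s)%:C * oscillatory phi s)).
by apply/funext => s; exact: integral2.
Qed.

Lemma sinc_fourier_weight :
  symplectic_fourier_dist (dist_of_fun (@Theta R d)) phi = fourier_weight phi.
Proof.
rewrite /symplectic_fourier_dist /dist_of_fun /fourier_weight [RHS]cintegral_mkcond.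
transitivity (cintegral pms setT (fun z => cintegral mu setT (fun s => F (s, z)))).
  by apply: eq_cintegral => z _; rewrite integral1 symplectic_fourierN.
rewrite -(cfubini cintegrable_F).
by apply: eq_cintegral => s _; rewrite integral2.
Qed.

End sinc_transform.

(** * The cosine integral and the case d = 1 *)

Section cosine_integral.
Context (R : realType).
Local Notation mu := (@lebesgue_measure R).
Implicit Types (c s A B : R).

Lemma continuous_itv_integrable (f : R -> R) (a b : R) :
  (forall x, a <= x <= b -> {for x, continuous f}) ->
  mu.-integrable `[a, b] (EFin \o f).
Proof.
move=> cf; apply: continuous_compact_integrable; first exact: segment_compact.
apply: continuous_in_subspaceT => x; rewrite inE /= in_itv/=; exact: cf.
Qed.

Lemma sin_norm_le (y : R) : `|sin y| <= `|y|.
Proof.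
have h (x : R) : 0 < x -> `|sin x| <= x.
  move=> x0; have [|x1 _] := @MVT R sin cos 0 x x0 (fun u _ => is_derive_sin u).
    by apply: continuous_subspaceT; exact: continuous_sin.
  rewrite sin0 !subr0 => ->; rewrite normrM (gtr0_norm x0) ler_piMl ?cos_max//.
  exact: ltW.
have [y0|y0|->] := ltgtP y 0; last by rewrite sin0 normr0.
  by rewrite -normrN -sinN -[leRHS]normrN [leRHS]gtr0_norm ?oppr_gt0// h// oppr_gt0.
by rewrite [leRHS]gtr0_norm// h.
Qed.

Definition sin_prim c s := c^-1 * sin (c * s).

Lemma sin_prim_le c s : 0 < c -> `|sin_prim c s| <= c^-1.
Proof.
move=> c0; rewrite normrM gtr0_norm ?invr_gt0// ler_piMr ?sin_max//.
by rewrite invr_ge0 ltW.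
Qed.

(** From [|sin y| <= 1] and [|sin y| <= |y|] one gets [|sin y| <= sqrt |y|]. The resulting
    singularity [c^(-1/2)] is locally integrable, whereas the [c^-1] of [sin_prim_le] is not. *)
Lemma sin_prim_le_sqrt c s : 0 < c -> 0 < s ->
  `|sin_prim c s| <= (Num.sqrt c)^-1 * Num.sqrt s.
Proof.
move=> c0 s0; rewrite normrM gtr0_norm ?invr_gt0//.
have sc0 : 0 < Num.sqrt c by rewrite sqrtr_gt0.
have h : `|sin (c * s)| <= Num.sqrt c * Num.sqrt s.
  rewrite -sqrtrM ?(ltW c0)// -[leLHS]sqrtr_sqr ler_wsqrtr//.
  have h1 := sin_norm_le (c * s); rewrite (gtr0_norm (mulr_gt0 c0 s0)) in h1.
  apply: le_trans h1; rewrite -real_normK ?num_real//.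
  by rewrite expr2 ler_piMl// sin_max.
have -> : c^-1 = (Num.sqrt c)^-1 * (Num.sqrt c)^-1.
  by rewrite -invfM -expr2 sqr_sqrtr// ltW.
rewrite -mulrA ler_wpM2l// ?invr_ge0 ?(ltW sc0)//.
by rewrite [leLHS]mulrC ler_pdivrMr// [leRHS]mulrC.
Qed.

Definition cos_integral c A := \int[mu]_(s in `[2, A]) (cos (c * s) * s^-1).

Let pos s : 2 <= s -> 0 < s. Proof. exact: lt_le_trans. Qed.

Let csin_prim c s : 0 < s ->
  {for s, continuous (fun s => sin_prim c s * s ^- 2)}.
Proof.
move=> s0; apply: cvgM; last first.
  apply: cvgV; first by rewrite expf_neq0// gt_eqF.
  exact: exprn_continuous.
apply: cvgMr; apply: is_derive1_continuous (is_derive_sin_lin c s).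
Qed.

Let ccos c s : 0 < s -> {for s, continuous (fun s => cos (c * s) * s^-1)}.
Proof.
move=> s0; apply: cvgM; last by apply: cvgV; [rewrite gt_eqF|exact: cvg_id].
exact: is_derive1_continuous (is_derive_cos_lin c s).
Qed.

Lemma cos_integral_small c A : A <= 2 -> cos_integral c A = 0.
Proof.
rewrite le_eqVlt => /predU1P[->|A2].
  by rewrite /cos_integral set_itv1 Rintegral_set1.
by rewrite /cos_integral set_itv_ge ?Rintegral_set0// bnd_simp -ltNge.
Qed.

(** Integration by parts replaces [1/s], for which convergence is only conditional, by the
    absolutely convergent [1/s^2]. *)
Lemma cos_integral_parts c A : 0 < c -> 2 < A ->
  cos_integral c A = sin_prim c A * A^-1 - sin_prim c 2 * 2^-1 +
    \int[mu]_(s in `[2, A]) (sin_prim c s * s ^- 2).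
Proof.
move=> c0 A2.
have i1 : mu.-integrable `[2, A] (EFin \o (fun s => cos (c * s) * s^-1)).
  by apply: continuous_itv_integrable => x /andP[/pos x0 _]; exact: ccos.
have i2 : mu.-integrable `[2, A] (EFin \o (fun s => sin_prim c s * s ^- 2)).
  by apply: continuous_itv_integrable => x /andP[/pos x0 _]; exact: csin_prim.
have cf (s : R) : 2 <= s <= A ->
    {for s, continuous (fun s => cos (c * s) * s^-1 - sin_prim c s * s ^- 2)}.
  by move=> /andP[/pos s0 _]; apply: cvgB; [exact: ccos|exact: csin_prim].
have dF (s : R) : 2 <= s <= A -> is_derive s 1 (fun s => sin_prim c s * s^-1)
    (cos (c * s) * s^-1 - sin_prim c s * s ^- 2).
  move=> /andP[/pos s0 _]; have sn0 : s != 0 by rewrite gt_eqF.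
  have h1 := is_deriveZ c^-1 (is_derive_sin_lin c s).
  have h2 := is_derive_inv_lin 1 sn0.
  have := is_deriveM h1 h2.
  rewrite (_ : _ * _ = fun s => sin_prim c s * s^-1); last first.
    apply/funext => u.
    change (c^-1 * sin (c * u) * (1 * u^-1) = c^-1 * sin (c * u) * u^-1).
    by rewrite mul1r.
  rewrite /GRing.scale /= => h; apply: is_derive_eq h _.
  by rewrite /sin_prim /GRing.scale /=; field; rewrite sn0 gt_eqF.
have := Rintegral_FTC A2 cf dF; rewrite RintegralB//.
by rewrite /cos_integral => /eqP; rewrite subr_eq => /eqP.
Qed.

(** In units of [c^(-1/2)], each of the two boundary terms contributes at most 1 and the integral of
    [s^(-3/2)] from 2 at most 2. *)
Lemma cos_integral_le c A : 0 < c -> `|cos_integral c A| <= 4 * (Num.sqrt c)^-1.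
Proof.
move=> c0; have sc0 : 0 < (Num.sqrt c)^-1 by rewrite invr_gt0 sqrtr_gt0.
have [A2|A2] := leP A 2.
  by rewrite cos_integral_small// normr0 mulr_ge0// ltW.
have i2 : mu.-integrable `[2, A] (EFin \o (fun s => sin_prim c s * s ^- 2)).
  by apply: continuous_itv_integrable => x /andP[/pos x0 _]; exact: csin_prim.
have bnd (s : R) : 2 <= s -> `|sin_prim c s * s^-1| <= (Num.sqrt c)^-1.
  move=> s2; have s0 := pos s2.
  rewrite normrM [`|s^-1|]gtr0_norm ?invr_gt0// ler_pdivrMr//.
  apply: (le_trans (sin_prim_le_sqrt c0 s0)); rewrite ler_pM2l//.
  rewrite -[leRHS]gtr0_norm// -sqrtr_sqr ler_wsqrtr//.
  by rewrite expr2 ler_peMl ?(ltW s0)// (le_trans _ s2)// ler1n.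
pose G s := - 2 * (Num.sqrt s)^-1.
have cg (s : R) : 2 <= s <= A ->
    {for s, continuous (fun s => Num.sqrt s * s ^- 2)}.
  move=> /andP[/pos s0 _]; apply: cvgM; first exact: sqrt_continuous.
  apply: cvgV; first by rewrite expf_neq0// gt_eqF.
  exact: exprn_continuous.
have ig : mu.-integrable `[2, A] (EFin \o (fun s => Num.sqrt s * s ^- 2)).
  exact: continuous_itv_integrable.
have dG (s : R) : 2 <= s <= A -> is_derive s 1 G (Num.sqrt s * s ^- 2).
  move=> /andP[/pos s0 _]; have ss0 : 0 < Num.sqrt s by rewrite sqrtr_gt0.
  have h := is_deriveV (f := @Num.sqrt R) (lt0r_neq0 ss0) (is_derive1_sqrt s0).
  have := is_deriveZ (- 2) h; rewrite /GRing.scale /= => h2.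
  apply: is_derive_eq h2 _.
  have sE : s = Num.sqrt s ^+ 2 by rewrite sqr_sqrtr// ltW.
  move: (Num.sqrt s) ss0 sE => r r0 ->.
  by field; rewrite gt_eqF.
have e : \int[mu]_(s in `[2, A]) (Num.sqrt s * s ^- 2) <= 2.
  rewrite (Rintegral_FTC A2 cg dG) /G.
  have h2 : (Num.sqrt 2)^-1 <= 1 :> R.
    by rewrite invf_le1 ?sqrtr_gt0// -[leLHS]sqrtr1 ler_wsqrtr// ler1n.
  have hA : 0 <= (Num.sqrt A)^-1 by rewrite invr_ge0 sqrtr_ge0.
  lra.
rewrite cos_integral_parts//.
rewrite (le_trans (ler_normD _ _))//.
have -> : 4 * (Num.sqrt c)^-1 = ((Num.sqrt c)^-1 + (Num.sqrt c)^-1) + 2 * (Num.sqrt c)^-1.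
  by ring.
apply: lerD.
  by rewrite (le_trans (ler_normB _ _))// lerD// bnd// ltW.
apply: (le_trans (le_normr_Rintegral _ i2)) => //.
apply: (@le_trans _ _
  (\int[mu]_(s in `[2, A]) ((Num.sqrt c)^-1 * (Num.sqrt s * s ^- 2)))).
  apply: le_Rintegral => //.
  - exact: integrable_norm.
  - exact: integrableZ_real.
  move=> s; rewrite /= in_itv/= => /andP[/pos s0 _].
  rewrite normrM [`|s ^- 2|]gtr0_norm ?invr_gt0 ?exprn_gt0// mulrA ler_pM2r.
    exact: sin_prim_le_sqrt.
  by rewrite invr_gt0 exprn_gt0.
by rewrite RintegralZl// mulrC ler_wpM2r// ltW.
Qed.

Let integrable_sin_prim c : 0 < c ->
  mu.-integrable `[2, +oo[ (EFin \o (fun s => sin_prim c s * s ^- 2)).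
Proof.
move=> c0.
have h : mu.-integrable `[2, +oo[ (EFin \o (fun s => c^-1 * `|s| ^- 2)).
  apply: integrableZ_real => //.
  apply: integrableS (@integrable_tail R) => //; first exact: measurable_tail.
  by rewrite -tail_pos; exact: subIsetl.
apply: (le_integrable _ _ _ h) => //.
  apply/measurable_EFinP; apply: (measurable_funS measurableT) => //.
  apply: measurable_funM.
    apply: continuous_measurable_fun => x.
    by apply: cvgMr; apply: is_derive1_continuous (is_derive_sin_lin c x).
  by apply: (measurableT_comp (@measurable_inv R)); exact: measurable_funX.
move=> s; rewrite /= in_itv/= andbT => /pos s0; rewrite lee_fin.
have s2 : 0 < s ^- 2 by rewrite invr_gt0 exprn_gt0.
have ci : 0 < c^-1 by rewrite invr_gt0.
rewrite /= (gtr0_norm s0) (gtr0_norm (mulr_gt0 ci s2)) normrM (gtr0_norm s2).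
by rewrite ler_pM2r// sin_prim_le.
Qed.

(** The limit of [cos_integral_parts], its boundary term at [A] being gone; by [Ci_cos_limit] it is
    [- Ci (2 c)] for [c > 0]. *)
Definition cos_limit c :=
  - (sin_prim c 2 * 2^-1) + \int[mu]_(s in `[2, +oo[) (sin_prim c s * s ^- 2).

Lemma cvg_cos_integral c : 0 < c ->
  cos_integral c A @[A --> +oo] --> cos_limit c.
Proof.
move=> c0; apply/cvg_pinftyP => u uy.
pose f s := sin_prim c s * s ^- 2.
pose D n : set R := `[2, u n]%classic.
have DS n : D n `<=` `[2, +oo[ by move=> x; rewrite /D /= !in_itv/= => /andP[-> _].
have fi := integrable_sin_prim c0.
have /measurable_EFinP mf := measurable_int mu fi.
have mD n : measurable (D n) by exact: measurable_itv.
have [||||||_ cI] := @Rdominated_cvg R _ _ mu `[2, +oo[%classic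
  (fun n => f \_ (D n)) f (fun x => `|f x|).
- by [].
- move=> n; apply/measurable_restrict; [exact: mD|by []|apply: measurable_funS mf => //].
- exact: mf.
- apply: nearW => x; rewrite /= in_itv/= andbT => x2.
  apply: cvg_near_cst; near=> n; rewrite patchE mem_set//=.
  rewrite /D /= in_itv/= x2 /=; near: n; exact: (cvgry_ge uy).
- exact: integrable_norm.
- by apply: nearW => x _ n; rewrite patchE; case: ifPn => // _; rewrite normr0.
have cu : sin_prim c (u n) * (u n)^-1 @[n --> \oo] --> 0.
  have up : \forall n \near \oo, 0 < u n by exact: (cvgry_gt uy).
  have cV : (u n)^-1 @[n --> \oo] --> 0 by apply/(gtr0_cvgV0 up).
  apply: norm_cvg0.
  have cK : c^-1 * (u n)^-1 @[n --> \oo] --> 0.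
    by rewrite -(mulr0 c^-1); exact: cvgMr.
  apply: (squeeze_cvgr _ (cvg_cst 0) cK); near=> n.
  have un : 0 < u n by near: n.
  rewrite normr_ge0 normrM [`|(u n)^-1|]gtr0_norm ?invr_gt0//.
  by rewrite ler_pM2r ?invr_gt0// sin_prim_le.
have cH : sin_prim c (u n) * (u n)^-1 - sin_prim c 2 * 2^-1 +
    \int[mu]_(x in `[2, +oo[) (f \_ (D n)) x @[n --> \oo] --> cos_limit c.
  rewrite /cos_limit -[X in _ --> X + _]add0r; apply: cvgD => //.
  by apply: cvgB => //; exact: cvg_cst.
apply: cvg_trans cH; apply: near_eq_cvg; near=> n.
have un : 2 < u n by near: n; exact: (cvgry_gt uy).
by rewrite cos_integral_parts// -Rintegral_mkcondr setIC (setIidl (DS n)).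
Unshelve. all: by end_near. Qed.

Lemma cos_integral_scale c B : 0 < c ->
  \int[mu]_(v in `[2 * c, B]) (cos v / v) = cos_integral c (B / c).
Proof.
move=> c0; have cn0 : c != 0 by rewrite gt_eqF.
have fi : mu.-integrable `[2 * c, B] (EFin \o (fun v : R => cos v / v)).
  apply: continuous_itv_integrable => x /andP[xc _].
  have x0 : 0 < x by rewrite (lt_le_trans _ xc)// mulr_gt0.
  apply: cvgM; first exact: continuous_cos.
  by apply: cvgV; [rewrite gt_eqF|exact: cvg_id].
rewrite [LHS]Rintegral_mkcond (@Rintegral_affine _ 0 c)//; last first.
  by rewrite -restrict_EFin; apply/(@integrable_mkcond _ _ _ mu `[2 * c, B]%classic).
rewrite gtr0_norm// -RintegralZl//; last first.
  have := @integrable_affine R 0 c cn0 ((fun v : R => cos v / v) \_ `[2 * c, B]).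
  apply; rewrite -restrict_EFin.
  by apply/(@integrable_mkcond _ _ _ mu `[2 * c, B]%classic).
rewrite [RHS]Rintegral_mkcond; apply: eq_Rintegral => s _.
rewrite add0r !patchE.
have -> : (c * s \in `[2 * c, B]%classic) = (s \in `[2%R, B / c]%classic).
  have E : (2 * c <= c * s <= B) = (2 <= s <= B / c).
    by rewrite [c * s]mulrC ler_pM2r// ler_pdivlMr.
  by apply/idP/idP => /set_mem h; apply/mem_set; move: h; rewrite /= !in_itv/= E.
case: ifPn => [/set_mem|_]; last by rewrite mulr0.
rewrite /= in_itv/= => /andP[/pos s0 _].
by move: (cos _) => y; field; rewrite cn0 gt_eqF.
Qed.

Lemma Ci_cos_limit c : 0 < c -> Ci (2 * c) = - cos_limit c.
Proof.
move=> c0; rewrite /Ci; congr (- _); apply/cvg_lim => //.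
under eq_fun do rewrite cos_integral_scale//.
apply/cvg_pinftyP => u uy; have /cvg_pinftyP h := cvg_cos_integral c0.
apply: (h (fun n => u n / c)); apply/cvgryPge => A; near=> n.
by rewrite ler_pdivlMr//; near: n; exact: (cvgry_ge uy).
Unshelve. all: by end_near. Qed.

End cosine_integral.

(** * Integrability of the inverse square root near 0 *)

Section inverse_sqrt.
Context (R : realType).
Local Notation mu := (@lebesgue_measure R).
Implicit Types x : R.

Let inv_sqrt x := (Num.sqrt x)^-1.

Let measurable_inv_sqrt : measurable_fun setT inv_sqrt.
Proof.
apply: (measurableT_comp (@measurable_inv R)).
by apply: continuous_measurable_fun; exact: sqrt_continuous.
Qed.

Let is_derive_sqrt2 x : 0 < x -> is_derive x 1 (fun y => 2 * Num.sqrt y) (inv_sqrt x).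
Proof.
move=> x0; have := is_deriveZ 2 (is_derive1_sqrt x0).
rewrite /GRing.scale /= => h; apply: is_derive_eq h _.
have s0 : 0 < Num.sqrt x by rewrite sqrtr_gt0.
by rewrite /inv_sqrt; field; rewrite gt_eqF.
Qed.

Let continuous_inv_sqrt x : 0 < x -> {for x, continuous inv_sqrt}.
Proof.
move=> x0; apply: cvgV; first by rewrite gt_eqF// sqrtr_gt0.
exact: sqrt_continuous.
Qed.

(** Monotone convergence along [[1 / n.+2, 1]], where the primitive [2 sqrt x] bounds the integrals
    by 2; [n.+2] keeps the left end strictly below 1. *)
Lemma integrable_inv_sqrt : mu.-integrable `]0, 1] (EFin \o inv_sqrt).
Proof.
pose F n : set R := `[n.+2%:R^-1, 1]%classic.
have F0 n x : F n x -> 0 < x.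
  rewrite /F /= in_itv/= => /andP[+ _]; apply: lt_le_trans.
  by rewrite invr_gt0 ltr0n.
have UF : \bigcup_n F n = `]0, 1]%classic.
  apply/seteqP; split => [x [n _ Fx]|x].
    rewrite /= in_itv/= (F0 _ _ Fx)/=; move: Fx; rewrite /F /= in_itv/=.
    by case/andP.
  rewrite /= in_itv/= => /andP[x0 x1]; exists (Num.truncn x^-1) => //.
  rewrite /F /= in_itv/= x1 andbT -[leRHS]invrK lef_pV2 ?posrE ?invr_gt0//.
  by rewrite (le_trans (ltW (truncnS_gt _)))// ler_nat.
have mf D : measurable D -> measurable_fun D (EFin \o inv_sqrt).
  by move=> mD; apply/measurable_EFinP; exact: measurable_funS measurable_inv_sqrt.
apply/integrableP; split; first exact: mf.
under eq_integral do rewrite /= ger0_norm ?invr_ge0 ?sqrtr_ge0//.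
have cvgF : (\int[mu]_(x in F n) (inv_sqrt x)%:E @[n --> \oo] -->
    \int[mu]_(x in `]0%R, 1%R]) (inv_sqrt x)%:E)%E.
  rewrite -UF; apply: (@ge0_nondecreasing_set_cvg_integral _ (measurableTypeR R)).
  - move=> n m nm; rewrite subsetEset => x; rewrite /F /= !in_itv/=.
    move=> /andP[h ->]; rewrite andbT (le_trans _ h)// lef_pV2 ?posrE ?ltr0n//.
    by rewrite ler_nat.
  - by move=> n; exact: measurable_itv.
  - by move=> n; apply: mf; exact: measurable_itv.
  - by move=> n x _; rewrite lee_fin invr_ge0 sqrtr_ge0.
apply: (@le_lt_trans _ _ 2%:E); last by rewrite ltry.
apply: (cvge_le _ cvgF) => //.
apply: nearW => n.
have n1 : n.+2%:R^-1 < 1 :> R by rewrite invf_lt1 ?ltr0n// ltr1n.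
have Fi : mu.-integrable (F n) (EFin \o inv_sqrt).
  apply: continuous_itv_integrable => x /andP[h _]; apply: continuous_inv_sqrt.
  by apply: lt_le_trans h; rewrite invr_gt0 ltr0n.
rewrite -[leLHS]fineK; last first.
  by apply: (integrable_fin_num _ Fi); exact: measurable_itv.
rewrite lee_fin -/(Rintegral mu (F n) inv_sqrt).
have h (x : R) : n.+2%:R^-1 <= x <= 1 -> 0 < x.
  by move=> /andP[h _]; apply: lt_le_trans h; rewrite invr_gt0 ltr0n.
rewrite (Rintegral_FTC n1 (fun x hx => continuous_inv_sqrt (h x hx))
  (fun x hx => is_derive_sqrt2 (h x hx))).
by rewrite sqrtr1 mulr1 lerBlDr lerDl mulr_ge0// sqrtr_ge0.
Qed.

(** For [d = 1] the product of its values at the two coordinates is [|zeta_1 zeta_2|^(-1/2)] times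
    the Cauchy majorant of a Schwartz function. *)
Definition sing_cauchy x := (Num.sqrt `|x|)^-1 * cauchy_fun x.

Lemma measurable_sing_cauchy : measurable_fun setT sing_cauchy.
Proof.
apply: measurable_funM; last first.
  by apply: continuous_measurable_fun; exact: continuous_cauchy_fun.
by apply: (measurableT_comp measurable_inv_sqrt); exact: normr_measurable.
Qed.

Lemma integrable_sing_cauchy : mu.-integrable setT (EFin \o sing_cauchy).
Proof.
have I1 : mu.-integrable setT (EFin \o (inv_sqrt \_ `]0, 1])).
  rewrite -restrict_EFin.
  apply/(@integrable_mkcond _ _ _ mu `]0, 1]%classic) => //.
  exact: integrable_inv_sqrt.
have n0 : (-1 : R) != 0 by rewrite oppr_eq0 oner_eq0.
have I2 := integrable_affine 0 n0 I1.
have I3 := integrableD measurableT I1 I2.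
(* The three summands dominate on []0, 1]], on [[-1, 0[] and on [|x| > 1] respectively; at 0 the
   convention [0^-1 = 0] makes [sing_cauchy] vanish. *)
have I4 := integrableD measurableT I3 (@integrable_cauchy_fun R).
apply: (le_integrable _ _ _ I4) => //.
  by apply/measurable_EFinP; exact: measurable_sing_cauchy.
move=> x _; rewrite /= lee_fin.
have p0 y : 0 <= (inv_sqrt \_ `]0, 1]) y.
  by rewrite patchE; case: ifPn => // _; rewrite invr_ge0 sqrtr_ge0.
have c0 := cauchy_fun_gt0 x; have c1 := cauchy_fun_le1 x.
have s0 : 0 <= sing_cauchy x.
  by apply: mulr_ge0; [rewrite invr_ge0 sqrtr_ge0|exact: ltW].
have S0 : 0 <= (inv_sqrt \_ `]0, 1]) x + (inv_sqrt \_ `]0, 1]) (0 + -1 * x) +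
    cauchy_fun x.
  by apply: addr_ge0; [exact: addr_ge0|exact: ltW].
rewrite (ger0_norm s0) (ger0_norm S0) {S0 s0}.
rewrite add0r mulN1r.
have [x1|x1] := leP `|x| 1; last first.
  apply: (@le_trans _ _ (cauchy_fun x)); last by rewrite lerDr addr_ge0.
  rewrite ler_piMl ?(ltW c0)// invf_le1 ?sqrtr_gt0 ?(lt_trans _ x1)//.
  by rewrite -[leLHS]sqrtr1 ler_wsqrtr// ltW.
have [x0|x0|->] := ltgtP x 0; last first.
- by rewrite /sing_cauchy normr0 sqrtr0 invr0 mul0r !addr_ge0// ltW// cauchy_fun_gt0.
- apply: (@le_trans _ _ ((inv_sqrt \_ `]0, 1]) x)).
    rewrite patchE mem_set/=; last first.
      by rewrite in_itv/= x0; move: x1; rewrite gtr0_norm.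
    rewrite /sing_cauchy (gtr0_norm x0) ler_piMr// invr_ge0 sqrtr_ge0//.
  by rewrite -addrA lerDl addr_ge0// ltW.
- apply: (@le_trans _ _ ((inv_sqrt \_ `]0, 1]) (- x))).
    rewrite patchE mem_set/=; last first.
      by rewrite in_itv/= oppr_gt0 x0; move: x1; rewrite ltr0_norm.
    rewrite /sing_cauchy (ltr0_norm x0) ler_piMr// invr_ge0 sqrtr_ge0//.
  by rewrite -addrA addrCA lerDl addr_ge0// ltW.
Qed.

End inverse_sqrt.

(** * The formula for [d = 1] *)

Section dimension_one.
Context (R : realType).
Local Notation mu := (@lebesgue_measure R).
Local Notation pm := (lebesgue_rV R 1 \x lebesgue_rV R 1)%E.
Local Notation pms := (product_sfm (lebesgue_rV R 1) (lebesgue_rV R 1)).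
Local Notation tail := [set s : R | 2 <= `|s|].
Local Notation trunc A := [set s : R | 2 <= `|s| <= A].
Implicit Types (s t A : R).

Lemma weight1 s : weight 1 s = `|s|^-1.
Proof. by []. Qed.

Lemma measurable_weight1 : measurable_fun setT (weight 1 : R -> R).
Proof.
have -> : weight 1 = (fun s : R => `|s|^-1) by apply/funext => s; rewrite weight1.
by apply: (measurableT_comp (@measurable_inv R)); exact: normr_measurable.
Qed.

Lemma trunc_sub A : trunc A `<=` tail.
Proof. by move=> s /= /andP[]. Qed.

Lemma measurable_trunc A : measurable (trunc A).
Proof.
have -> : trunc A = tail `&` `[- A, A].
  apply/seteqP; split => s; rewrite /= in_itv/= -ler_norml; first by case/andP.
  by case=> -> ->.
by apply: measurableI; [exact: measurable_tail|exact: measurable_itv].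
Qed.

Lemma truncN A s : trunc A (- s) <-> trunc A s.
Proof. by rewrite /= normrN. Qed.

Lemma trunc_pos A : trunc A `&` `[0, +oo[ = `[2, A]%classic.
Proof.
apply/seteqP; split => s; rewrite /= !in_itv/= ?andbT.
  by case=> h s0; rewrite -(ger0_norm s0).
by move=> /andP[h1 h2]; have s0 := le_trans (ler0n R 2) h1; rewrite ger0_norm// h1 h2.
Qed.

(** Truncation trades a factor [|A|] for the integrable decay [|s|^-2]. *)
Lemma weight1_le A s : trunc A s -> `|s|^-1 <= `|A| * `|s| ^- 2.
Proof.
move=> /andP[s2 sA]; have s0 : 0 < `|s| by exact: lt_le_trans s2.
rewrite -[leLHS]mul1r; have -> : `|s| ^- 2 = `|s|^-1 * `|s|^-1 by rewrite -invfM.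
rewrite mulrA ler_pM2r ?invr_gt0// ler_pdivlMr// mul1r (le_trans sA)// ler_norm.
by [].
Qed.

Let integrand t s : R[i] := expi (- (2 * pi * s * t)) * (weight 1 s)%:C.

Let cmeasurable_integrand t : cmeasurable (integrand t : measurableTypeR R -> R[i]).
Proof.
apply: cmeasurableM; last by apply: cmeasurable_real; exact: measurable_weight1.
apply: cmeasurable_expi; apply: measurable_funN.
by apply: measurable_funM => //; exact: measurable_funM.
Qed.

Let normc_integrand t s : normc (integrand t s) = `|s|^-1.
Proof.
by rewrite ComplexField.Normc.normcM normc_expi mul1r normcR weight1 ger0_norm.
Qed.

Let cintegrable_integrand t A : cintegrable mu (trunc A) (integrand t).
Proof.
apply: (@le_cintegrable R _ (measurableTypeR R) mu (trunc A) (measurable_trunc A) _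
  (fun s => `|A| * `|s| ^- 2)).
- exact: cmeasurable_integrand.
- apply: integrableZ_real; first exact: measurable_trunc.
  apply: integrableS (@integrable_tail R); last exact: trunc_sub.
    exact: measurable_tail.
  exact: measurable_trunc.
- by move=> s As; rewrite normc_integrand weight1_le.
Qed.

Lemma truncated_fourier_weightE t A :
  truncated_fourier_weight 1 t A = (2 * cos_integral (2 * pi * `|t|) A)%:C.
Proof.
have [i1 i2] := cintegrable_integrand t A.
have xN s : - (2 * pi * - s * t) = - - (2 * pi * s * t).
  by rewrite mulrN mulNr.
have wN s : weight 1 (- s) = weight 1 s by rewrite !weight1 normrN.
apply: complex_eqP => /=; last first.
  apply: (Rintegral_odd (measurable_trunc A) (truncN A) i2) => s.
  by rewrite /integrand !Im_mulc /= !mulr0 !add0r xN wN sinN mulNr.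
rewrite (Rintegral_even (measurable_trunc A) (truncN A) i1); last first.
  by move=> s; rewrite /integrand !Re_mulc /= !mulr0 !subr0 xN wN cosN.
rewrite trunc_pos; congr (_ * _); apply: eq_Rintegral => s /set_mem.
rewrite /= in_itv/= => /andP[s2 _]; have s0 : 0 < s by exact: lt_le_trans s2.
rewrite /integrand ?Re_mulc /= mulr0 subr0 weight1 (gtr0_norm s0); congr (_ * _).
rewrite cosN -cos_norm; congr cos.
rewrite !normrM (gtr0_norm s0) (gtr0_norm (@pi_gt0 R)) ger0_norm//.
by move: (pi : R) => p; ring.
Qed.

Let freq_gt0 t : t != 0 -> 0 < 2 * pi * `|t|.
Proof. by move=> t0; rewrite mulr_gt0 ?normr_gt0// mulr_gt0// pi_gt0. Qed.

Lemma Ci_cos_limit2 t : t != 0 ->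
  - 2 * Ci (4 * pi * `|t|) = 2 * cos_limit (2 * pi * `|t|).
Proof.
move=> t0; have -> : 4 * pi * `|t| = 2 * (2 * pi * `|t|).
  by move: (pi : R) => p; ring.
by rewrite Ci_cos_limit ?freq_gt0// mulrNN.
Qed.

Lemma cvg_truncated_fourier_weight t : t != 0 ->
  complex.Re (truncated_fourier_weight 1 t A) @[A --> +oo]
    --> - 2 * Ci (4 * pi * `|t|) /\
  complex.Im (truncated_fourier_weight 1 t A) @[A --> +oo] --> (0 : R).
Proof.
move=> t0; rewrite Ci_cos_limit2//; split.
- under eq_fun do rewrite truncated_fourier_weightE /=.
  by apply: cvgMr; apply: cvg_cos_integral; exact: freq_gt0.
- by under eq_fun do rewrite truncated_fourier_weightE /=; exact: cvg_cst.
Qed.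

Lemma dot1 (z : phase R 1) : dot z.1 z.2 = z.1 ord0 ord0 * z.2 ord0 ord0.
Proof. by rewrite /dot big_ord1. Qed.

Let radius n : R := n.+2%:R.

Let cvg_radius t : t != 0 ->
  2 * cos_integral (2 * pi * `|t|) (radius n) @[n --> \oo] -->
  - 2 * Ci (4 * pi * `|t|).
Proof.
move=> t0; rewrite Ci_cos_limit2//; apply: cvgMr.
have /cvg_pinftyP h := cvg_cos_integral (freq_gt0 t0).
apply: h; apply/cvgryPge => A.
apply: filterS (nbhs_infty_ger A) => n /le_trans; apply.
by rewrite ler_nat; exact: leq_trans (leqnSn _) (leqnSn _).
Qed.

(** Measurability in [t] follows by writing the function as the truncated Fourier integral, an
    integral depending on the parameter [t]. *)
Let measurable_cos_integral A :
  measurable_fun setT (fun t => 2 * cos_integral (2 * pi * `|t|) A).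
Proof.
pose f (p : measurableTypeR R * measurableTypeR R) : R[i] :=
  (\1_(trunc A) p.2)%:C * (expi (- (2 * pi * p.2 * p.1)) * (weight 1 p.2)%:C).
have m1 : measurable_fun setT
    (fun p : measurableTypeR R * measurableTypeR R => p.1 : R).
  exact: measurable_fst.
have m2 : measurable_fun setT
    (fun p : measurableTypeR R * measurableTypeR R => p.2 : R).
  exact: measurable_snd.
have mf : cmeasurable f.
  apply: cmeasurableM.
    apply: cmeasurable_real.
    have mi : measurable_fun setT (\1_(trunc A) : measurableTypeR R -> R).
      by apply: measurable_indic; exact: measurable_trunc.
    exact: (measurableT_comp mi m2).
  apply: cmeasurableM.
    apply: cmeasurable_expi; apply: measurable_funN; apply: measurable_funM => //.
    exact: measurable_funM.
  by apply: cmeasurable_real; exact: (measurableT_comp measurable_weight1 m2).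
have [+ _] := cmeasurable_cintegral mu mf.
have -> // : (fun t => complex.Re (cintegral mu setT (fun s => f (t, s)))) =
  (fun t => 2 * cos_integral (2 * pi * `|t|) A).
by apply/funext => t; rewrite -cintegral_mkcond -/(truncated_fourier_weight 1 t A)
  truncated_fourier_weightE.
Qed.

(** Away from [t = 0] the function is a pointwise limit of measurable ones; the remaining point is a
    singleton, on which any function is measurable. *)
Lemma cmeasurable_Ci_kernel : cmeasurable (@Ci_kernel R 1).
Proof.
have h : measurable_fun setT (fun t => - 2 * Ci (4 * pi * `|t|)).
  rewrite -(setvU [set (0 : R)]); apply/measurable_funU => //.
    exact: measurableC.
  split; last exact: measurable_fun_set1.
  apply: (@measurable_fun_cvg _ _ _ _
    (fun n t => 2 * cos_integral (2 * pi * `|t|) (radius n))).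
    by move=> n; exact: measurable_funTS.
  by move=> t /= /eqP t0; exact: cvg_radius.
apply: cmeasurable_real.
exact: (measurableT_comp h (@measurable_dot R 1)).
Qed.

(** In dimension 1 the zero set is the union of the two coordinate axes. *)
Lemma ae_dot_neq0 : {ae pm, forall z, dot z.1 z.2 != 0}.
Proof.
pose Z := [set v : 'rV[R]_1 | forall i, [set 0] (v ord0 i)].
have Z0 : lebesgue_rV R 1 Z = 0%E.
  rewrite (lebesgue_rV_box (A := fun=> [set 0]))//.
  by rewrite big_ord1 lebesgue_measure_set1.
have mZ : measurable Z.
  have -> : Z = (fun v : 'rV[R]_1 => v ord0 ord0) @^-1` [set 0].
    by apply/seteqP; split => v /= h; [exact: h|move=> i; rewrite (ord1 i)].
  by rewrite -[X in measurable X]setTI; exact: measurable_coord.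
have ZT : pm (Z `*` setT) = 0%E.
  by rewrite [LHS]product_measure1E// [X in (X * _)%E]Z0 mul0e.
have TZ : pm (setT `*` Z) = 0%E.
  by rewrite [LHS]product_measure1E// [X in (_ * X)%E]Z0 mule0.
exists (Z `*` setT `|` setT `*` Z); split.
- by apply: measurableU; exact: measurableX.
- apply/eqP; rewrite eq_le measure_ge0 andbT.
  apply: (le_trans (measureU2 _ _ _)); try exact: measurableX.
  by rewrite [X in (X + _)%E]ZT [X in (_ + X)%E]TZ adde0.
- move=> z /= /negP; rewrite negbK dot1 mulf_eq0 => /orP[|] /eqP h; [left|right];
    by split => //= i; rewrite (ord1 i).
Qed.

Variable phi : phase R 1 -> R[i].
Hypothesis sphi : schwartz phi.

Let osc s := (weight 1 s)%:C * oscillatory phi s.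

Let G n (p : measurableTypeR R * phase R 1) : R[i] :=
  (\1_(trunc (radius n)) p.1)%:C * (integrand (dot p.2.1 p.2.2) p.1 * phi p.2).

Let measurable_indic_trunc n :
  measurable_fun setT (\1_(trunc (radius n)) : measurableTypeR R -> R).
Proof. by apply: measurable_indic; exact: measurable_trunc. Qed.

Let measurable_phase_pairing :
  measurable_fun setT (fun p : measurableTypeR R * phase R 1 =>
    - (2 * pi * p.1 * dot p.2.1 p.2.2)).
Proof.
apply: measurable_funN; apply: measurable_funM.
  by apply: measurable_funM => //; exact: measurable_fst.
exact: (measurableT_comp (@measurable_dot R 1) measurable_snd).
Qed.

Let cmeasurable_G n : cmeasurable (G n).
Proof.
apply: cmeasurableM.
  apply: cmeasurable_real.
  exact: (measurableT_comp (measurable_indic_trunc n) measurable_fst).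
apply: cmeasurableM; last exact: (cmeasurable_comp measurable_snd
  (schwartz_cmeasurable sphi)).
apply: cmeasurableM; first by apply: cmeasurable_expi; exact: measurable_phase_pairing.
by apply: cmeasurable_real; exact: (measurableT_comp measurable_weight1 measurable_fst).
Qed.

(** Fubini is applied at each truncation level because [|s|^-1] is not integrable over the whole
    tail. *)
Let cintegrable_G n : cintegrable (mu \x pms)%E setT (G n).
Proof.
have [M M0 hM] := schwartz_le sphi.
apply: (@le_cintegrable R _ (measurableTypeR R * phase R 1)%type (mu \x pms)%E setT
  measurableT _ (fun p => (`|radius n| * 2 * cauchy_fun p.1) *
    (M * phase_prod (@cauchy_fun R) p.2))).
- exact: cmeasurable_G.
- apply: (integrable_prod (m1 := mu) (m2 := pms)
    (f := fun s => `|radius n| * 2 * @cauchy_fun R s)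
    (g := fun z => M * phase_prod (@cauchy_fun R) z)).
    exact: (integrableZ_real _ measurableT (@integrable_cauchy_fun R)).
  exact: (integrableZ_real M measurableT (@integrable_phase_cauchy R 1)).
move=> p _; rewrite /G indicE.
case: (boolP (p.1 \in trunc (radius n))) => [/set_mem tp|_].
  rewrite mul1r ComplexField.Normc.normcM normc_integrand ler_pM ?normc_ge0//.
  apply: (le_trans (weight1_le tp)); rewrite -mulrA ler_wpM2l//.
  exact/inv_sqr_le/(trunc_sub tp).
rewrite mul0r ComplexField.Normc.normc0; apply: mulr_ge0.
  by rewrite mulr_ge0 ?mulr_ge0//; exact/ltW/cauchy_fun_gt0.
by rewrite mulr_ge0//; exact: phase_prod_ge0.
Qed.

Let cintegral_G1 n z : cintegral mu setT (fun s => G n (s, z)) =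
  (2 * cos_integral (2 * pi * `|dot z.1 z.2|) (radius n))%:C * phi z.
Proof.
rewrite -truncated_fourier_weightE mulrC.
rewrite -(@cintegralZl R _ (measurableTypeR R) mu (trunc (radius n))
  (measurable_trunc _) _ _ (cintegrable_integrand _ _)).
rewrite [RHS]cintegral_mkcond; apply: eq_cintegral => s _.
by rewrite /G /= [_ * phi _]mulrC.
Qed.

Let cintegral_G2 n s : cintegral pms setT (fun z => G n (s, z)) =
  (\1_(trunc (radius n)) s)%:C * osc s.
Proof.
have i0 : cintegrable pm setT (fun w => expi (- (2 * pi * s * dot w.1 w.2)) * phi w).
  have mphi := schwartz_cmeasurable sphi.
  apply: (le_cintegrable measurableT (h := fun w => normc (phi w))).
  - apply: cmeasurableM => //; apply: cmeasurable_expi; apply: measurable_funN.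
    by apply: measurable_funM => //; exact: measurable_dot.
  - exact: (cintegrable_normc measurableT mphi (schwartz_cintegrable sphi)).
  - by move=> w _; rewrite ComplexField.Normc.normcM normc_expi mul1r.
rewrite /osc mulrA -(cintegralZl measurableT _ i0).
apply: eq_cintegral => z _; rewrite /G /= /integrand.
by rewrite -!mulrA; congr (_ * _); rewrite mulrCA.
Qed.

Let cmeasurable_osc : cmeasurable (osc : measurableTypeR R -> R[i]).
Proof.
apply: cmeasurableM; first by apply: cmeasurable_real; exact: measurable_weight1.
have mh : cmeasurable (fun p : measurableTypeR R * phase R 1 =>
    expi (- (2 * pi * p.1 * dot p.2.1 p.2.2)) * phi p.2).
  apply: cmeasurableM; last exact: (cmeasurable_comp measurable_snd
    (schwartz_cmeasurable sphi)).
  by apply: cmeasurable_expi; exact: measurable_phase_pairing.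
exact: (cmeasurable_cintegral pms mh).
Qed.

(** The majorant is [|osc|] itself, whose integrability on the tail is [cintegrable_fourier_weight]
    at [d = 1]. *)
Let cvg_trunc_osc : ccvg (fun n => cintegral mu setT
    (fun s => (\1_(trunc (radius n)) s)%:C * osc s)) (fourier_weight phi).
Proof.
have [|||||_ h1 h2] := @cdominated_cvg R _ (measurableTypeR R) mu tail
  (@measurable_tail R) (fun n s => (\1_(trunc (radius n)) s)%:C * osc s) osc
  (fun s => normc (osc s)).
- move=> n; apply: cmeasurableM => //.
  by apply: cmeasurable_real; exact: measurable_indic_trunc.
- exact: cmeasurable_osc.
- apply: nearW => s ts; rewrite -[X in complex.Re X]mul1r -[X in complex.Im X]mul1r.
  apply: (@ccvgM R _ _ 1); last exact: ccvg_cst.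
  apply: (@ccvg_real R _ 1); apply: cvg_near_cst.
  apply: filterS (nbhs_infty_ger `|s|) => n sn; rewrite indicE mem_set//=.
  apply/andP; split; first exact: ts.
  apply: (le_trans sn).
  by rewrite ler_nat; exact: leq_trans (leqnSn _) (leqnSn _).
- apply: (@cintegrable_normc R _ (measurableTypeR R) mu tail (@measurable_tail R) osc
    cmeasurable_osc).
  exact: cintegrable_fourier_weight sphi.
- apply: nearW => s _ n; rewrite ComplexField.Normc.normcM normcR.
  by rewrite ler_piMl ?normc_ge0// indicE; case: (_ \in _); rewrite ?normr1 ?normr0.
have e n : cintegral mu tail (fun s => (\1_(trunc (radius n)) s)%:C * osc s) =
    cintegral mu setT (fun s => (\1_(trunc (radius n)) s)%:C * osc s).
  rewrite [LHS]cintegral_mkcond; apply: eq_cintegral => s _.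
  rewrite mulrA -rmorphM; congr ((_)%:C * _); rewrite !indicE.
  case: (boolP (s \in trunc (radius n))) => [/set_mem h|_]; last by rewrite mulr0.
  by rewrite mem_set ?mulr1//; exact: trunc_sub h.
by split; [under eq_fun do rewrite -e|under eq_fun do rewrite -e].
Qed.

Lemma Ci_kernel_transform :
  cintegrable pm setT (fun z => Ci_kernel z * phi z) /\
  dist_of_fun (@Ci_kernel R 1) phi = fourier_weight phi.
Proof.
have [M M0 hM] := schwartz_le sphi.
have [|||||i1 h1 h2] := @cdominated_cvg R _ (phase R 1) pm setT measurableT
  (fun n z => (2 * cos_integral (2 * pi * `|dot z.1 z.2|) (radius n))%:C * phi z)
  (fun z => Ci_kernel z * phi z)
  (* Here [8 = 2 * 4]: the 2 in front of [cos_integral] and the 4 of [cos_integral_le]; [M] comes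
     from the Cauchy bound on [phi], and [2 pi >= 1] is dropped under the square root. *)
  (fun z => 8 * M * phase_prod (@sing_cauchy R) z).
- move=> n; apply: cmeasurableM; last exact: schwartz_cmeasurable.
  apply: cmeasurable_real.
  exact: (measurableT_comp (measurable_cos_integral (radius n)) (@measurable_dot R 1)).
- apply: cmeasurableM; last exact: schwartz_cmeasurable.
  exact: cmeasurable_Ci_kernel.
- apply: filterS ae_dot_neq0 => z z0 _; apply: ccvgM; last exact: ccvg_cst.
  by apply: ccvg_real; exact: cvg_radius.
- apply: (integrableZ_real (8 * M) measurableT).
  apply: integrable_phase_prod; first exact: measurable_sing_cauchy.
  exact: integrable_sing_cauchy.
- apply: filterS ae_dot_neq0 => z z0 _ n.
  rewrite ComplexField.Normc.normcM normcR normrM ger0_norm//.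
  have c0 := freq_gt0 z0.
  have hc := cos_integral_le (radius n) c0.
  have d0 : 0 < `|dot z.1 z.2| by rewrite normr_gt0.
  have hs : (Num.sqrt (2 * pi * `|dot z.1 z.2|))^-1 <= (Num.sqrt `|dot z.1 z.2|)^-1.
    rewrite lef_pV2 ?posrE ?sqrtr_gt0// ler_wsqrtr// ler_peMl ?(ltW d0)//.
    by have := @pi_ge2 R; move: (pi : R) => q; lra.
  (* In dimension 1 the scalar product is an ordinary product, so its inverse square root splits
     over the coordinates. *)
  have sE : phase_prod (@sing_cauchy R) z = (Num.sqrt `|dot z.1 z.2|)^-1 *
      phase_prod (@cauchy_fun R) z.
    rewrite /phase_prod !big_ord1 dot1 normrM sqrtrM// invfM /sing_cauchy.
    by rewrite mulrACA.
  rewrite sE.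
  have -> : 8 * M * ((Num.sqrt `|dot z.1 z.2|)^-1 * phase_prod (@cauchy_fun R) z) =
    (2 * (4 * (Num.sqrt `|dot z.1 z.2|)^-1)) * (M * phase_prod (@cauchy_fun R) z).
    by ring.
  apply: ler_pM => //; first exact: normc_ge0.
  by rewrite ler_wpM2l// (le_trans hc)// ler_wpM2l.
split; first exact: i1.
apply: (@ccvg_unique R (fun n => cintegral pm setT (fun z =>
  (2 * cos_integral (2 * pi * `|dot z.1 z.2|) (radius n))%:C * phi z))).
  by split.
have e : (fun n => cintegral pm setT (fun z =>
    (2 * cos_integral (2 * pi * `|dot z.1 z.2|) (radius n))%:C * phi z)) =
    (fun n => cintegral mu setT (fun s => (\1_(trunc (radius n)) s)%:C * osc s)).
  apply/funext => n.
  transitivity (cintegral pms setT (fun z => cintegral mu setT (fun s => G n (s, z)))).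
    by apply: eq_cintegral => z _; rewrite cintegral_G1.
  rewrite -(cfubini (cintegrable_G n)).
  by apply: eq_cintegral => s _; rewrite cintegral_G2.
by rewrite e; exact: cvg_trunc_osc.
Qed.

End dimension_one.

Theorem proposition3p4 (R : realType) (d : nat) (hd : (1 <= d)%N)
    (Theta_sigma : functional R d)
    (hT : tempered Theta_sigma)
    (hTheta : eq_dist Theta_sigma
                (symplectic_fourier_dist (dist_of_fun (@Theta R d)))) :
  [/\ d = 1%N ->
        tested_integrable (@Ci_kernel R d) /\
        eq_dist Theta_sigma (dist_of_fun (@Ci_kernel R d)),
      (2 <= d)%N ->
        fourier_weight_converges R d /\
        eq_dist Theta_sigma (@fourier_weight R d)
    & d = 1%N ->
        [/\ fourier_weight_converges R d,
            eq_dist Theta_sigma (@fourier_weight R d)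
          & forall t : R, t != 0 ->
              complex.Re (truncated_fourier_weight d t A) @[A --> +oo]
                --> - 2 * Ci (4 * pi * `|t|) /\
              complex.Im (truncated_fourier_weight d t A) @[A --> +oo] --> (0 : R)]].

Proof.
(* This identity holds for every [d]; at [d = 1] it both recaptures the formula and, with
   [Ci_kernel_transform], yields the one with [Ci]. *)
have hw phi : schwartz phi -> Theta_sigma phi = fourier_weight phi.
  by move=> sphi; rewrite hTheta// sinc_fourier_weight.
have hc : fourier_weight_converges R d.
  by move=> phi; exact: cintegrable_fourier_weight.
split => [d1|_|d1]; first 1 last.
- by split.
- by subst d; split => // t; exact: cvg_truncated_fourier_weight.
subst d; split => phi sphi; first by case: (Ci_kernel_transform sphi).
by rewrite hw//; case: (Ci_kernel_transform sphi).
Qed.
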